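(* Let $N\ge3$, $p\in[1,\infty]$, and let $u_0\ge0$ be nontrivial with $u_0\in L^1(\mathbb{R}^N)$ if $p<p_c$, or $u_0\in L^1(\mathbb{R}^N)\cap\mathcal{D}_N$ if $p\in[p_c,\infty]$. Let $u$ be the mild solution and $M=\int u_0$. Let $g:(0,\infty)\to(0,\infty)$ satisfy $g(t)\to\infty$ and $g(t)/t^{\alpha/2}\to0$ as $t\to\infty$, and let $0<\nu<\mu<\infty$. Then $$(g(t))^{N(1-\frac1p)-2}\big\|t^\alpha u(\cdot,t)-M\kappa E_N\big\|_{L^p(\{\nu<|x|/g(t)<\mu\})}\to0\quad\text{as }t\to\infty,$$ and consequently $$t^\alpha(g(t))^{N(1-\frac1p)-2}\big\|u(\cdot,t)-MZ(\cdot,t)\big\|_{L^p(\{\nu<|x|/g(t)<\mu\})}\to0\quad\text{as }t\to\infty.$$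
   Context: Fix $N\ge1$ and $\alpha\in(0,1)$. Let $\mathbb{E}_\alpha(s)=\sum_{k\ge0}s^k/\Gamma(1+k\alpha)$ be the Mittag-Leffler function. The fundamental solution of the time-fractional heat equation $\partial_t^\alpha u=\Delta u$ (where $\partial_t^\alpha$ is the Caputo derivative $\partial_t^\alpha u(x,t)=\frac{1}{\Gamma(1-\alpha)}\partial_t\int_0^t\frac{u(x,\tau)-u(x,0)}{(t-\tau)^\alpha}\,d\tau$) is the function $Z$ on $\mathbb{R}^N\times(0,\infty)$ whose Fourier transform in $x$ is $\widehat Z(\omega,t)=\mathbb{E}_\alpha(-|\omega|^2t^\alpha)$. It has the self-similar form $Z(x,t)=t^{-\alpha N/2}F(xt^{-\alpha/2})$ with a positive radially symmetric profile $F$, smooth on $\mathbb{R}^N\setminus\{0\}$, $\int F=1$. For nonnegative nontrivial $u_0\in L^1(\mathbb{R}^N)$ the (mild) solution of $\partial_t^\alpha u=\Delta u$ in $\mathbb{R}^N\times(0,\infty)$, $u(\cdot,0)=u_0$, is $u(x,t)=\int_{\mathbb{R}^N}Z(x-y,t)u_0(y)\,dy$. $p_c=N/(N-2)$ if $N\ge3$ and $p_c=\infty$ if $N=2$. $E_N(\xi)=|\xi|^{2-N}$ for $N\ge3$ and $E_2(\xi)=-\ln|\xi|$. For $N\ge2$, $\kappa=\kappa(N)>0$ is the constant such that $F(\xi)/E_N(\xi)\to\kappa$ as $\xi\to0$. For $\beta>0$, $\mathcal{D}_\beta$ is the class of functions $f$ for which there exist $C,R>0$ with $|x|^\beta|f(x)|\le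 C$ for all $|x|>R$. *)

(* Defs.v *)
From HB Require Import structures.
From mathcomp Require Import all_boot all_order all_algebra.
From mathcomp Require Import all_classical all_reals all_analysis.
Set Implicit Arguments. Unset Strict Implicit. Unset Printing Implicit Defensive.
Import Order.TTheory GRing.Theory Num.Theory.
Import numFieldNormedType.Exports.
Local Open Scope classical_set_scope.
Local Open Scope ring_scope.

Section defs.
Variable R : realType.

Definition Gammaf (s : R) : R :=
  fine (\int[@lebesgue_measure R]_(x in `]0%R, +oo[) ((x `^ (s - 1)) * expR (- x))%:E)%E.

Definition mittag_leffler (a s : R) : R :=
  limn (fun n => \sum_(k < n) (s ^+ k / Gammaf (1 + k%:R * a))).

Definition tsub n (x y : n.-tuple R) : n.-tuple R :=
  [tuple tnth x i - tnth y i | i < n].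
Definition tscale n (c : R) (x : n.-tuple R) : n.-tuple R :=
  [tuple c * tnth x i | i < n].
Definition tdot n (x y : n.-tuple R) : R := \sum_(i < n) tnth x i * tnth y i.
Definition tnorm n (x : n.-tuple R) : R := Num.sqrt (tdot x x).

(* Lebesgue integral of a nonnegative function on R^n, as the iterated
   integral (Tonelli) over the n coordinates. *)
Fixpoint intN (n : nat) : (n.-tuple R -> \bar R) -> \bar R :=
  match n return (n.-tuple R -> \bar R) -> \bar R with
  | 0 => fun f => f [tuple]
  | n'.+1 => fun f =>
      (\int[@lebesgue_measure R]_(x in [set: R])
         intN (fun t : n'.-tuple R => f [tuple of x :: t]))%E
  end.

Definition RintN n (f : n.-tuple R -> R) : R :=
  fine (intN (fun x => (Num.max (f x) 0)%:E)) -
  fine (intN (fun x => (Num.max (- f x) 0)%:E)).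

Definition LpN n (p : \bar R) (A : set (n.-tuple R)) (f : n.-tuple R -> R)
    : \bar R :=
  match p with
  | r%:E => ((intN (fun x => (\1_A x * (`|f x| `^ r))%:E)) `^ r^-1)%E
  | +oo%E => ereal_inf [set c%:E | c in
       [set c : R | 0 <= c /\
          intN (fun x => (\1_(A `&` [set y | c < `|f y|]) x)%:E) = 0%E]]
  | -oo%E => 0%E
  end.

Definition invp (p : \bar R) : R :=
  match p with r%:E => r^-1 | _ => 0 end.

Definition p_crit (N : nat) : \bar R :=
  if (N <= 2)%N then +oo%E else (N%:R / (N%:R - 2))%:E.

(* Fundamental solution E_N of the Laplacian (up to constants). *)
Definition E_N N (x : N.-tuple R) : R :=
  if N == 2%N then - ln (tnorm x) else (tnorm x ^+ (N - 2))^-1.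

Definition class_D N (beta : R) (f : N.-tuple R -> R) : Prop :=
  exists C R0 : R, 0 < C /\ 0 < R0 /\
    forall x, R0 < tnorm x -> tnorm x `^ beta * `|f x| <= C.

Definition Zfun N (a : R) (F : N.-tuple R -> R) (x : N.-tuple R) (t : R) : R :=
  t `^ (- (a * N%:R / 2)) * F (tscale (t `^ (- (a / 2))) x).

(* Mild solution u(x,t) = int Z(x-y,t) u0(y) dy (real part; +oo on a null set
   is mapped to 0 by fine, irrelevant for L^p norms). *)
Definition mild N a F (u0 : N.-tuple R -> R) (x : N.-tuple R) (t : R) : R :=
  fine (intN (fun y => (Zfun a F (tsub x y) t * u0 y)%:E)).

End defs.

(* Main.v *)
Require Import Defs.
From HB Require Import structures.
From mathcomp Require Import all_boot all_order all_algebra.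
From mathcomp Require Import all_classical all_reals all_analysis.
From mathcomp Require Import measurable_realfun.
From mathcomp Require Import ring lra.
Set Implicit Arguments. Unset Strict Implicit. Unset Printing Implicit Defensive.
Import Order.TTheory GRing.Theory Num.Theory.
Import numFieldNormedType.Exports.
Local Open Scope classical_set_scope.
Local Open Scope ring_scope.

(* Write [s = t^(alpha/2)]. The kernel [t^alpha Z(z,t) = s^(2-N) F(z/s)] is close to the Newtonian
   kernel [kappa |z|^(2-N)] as soon as [|z|] is small compared with [s], and it is dominated by
   [C |z|^(2-N)] everywhere. On the annulus [|x| ~ g(t) << s] the part [|y| < gam g(t)] of the datum
   therefore contributes [M kappa |x|^(2-N)] up to [o(g^(2-N))], while the part [|y| >= gam g(t)] has
   small mass. Its Newtonian potential is controlled in [L^p] by Jensen and Tonelli when [p < p_c]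
   (then [|z|^((2-N)p)] is locally integrable), and uniformly by the decay [u0 <= C |y|^(-N)] when
   [p >= p_c].

   The global domination, i.e. [F(x) <= C |x|^(-N)], is extracted from the Fourier transform of [F].
   The function [s |-> E_alpha(-s)] is a limit of mixtures of exponentials: with [lam > 0], the
   coefficients of [U(z) = (1-z)^(alpha-1) / ((1-z)^alpha + lam)] are nonnegative polynomials in
   [1/(1+lam)], and for [lam = exp(s n^(-alpha)) - 1] the [n]-th one tends to [E_alpha(-s)] by Gauss's product
   for the Gamma function. Pairing [F] with a narrow Gaussian, the multiplication formula turns such a
   mixture into a mixture of heat kernels, each at most [C |x|^(-N)] at [x], and continuity of [F]
   removes the Gaussian. *)

(** * Lebesgue measure on tuples *)

(** The hypotheses describe the profile by its Fourier transform and its behaviour at the origin;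
    decay at infinity has to be derived. Complete monotonicity of [E_alpha(-s)] would make F a
    mixture of heat kernels, and at a fixed x no heat kernel exceeds [C |x|^(-N)], whatever its
    time. Approximating mixtures suffice for this bound, so no mixing measure is constructed. [U] is
    the generating function of the implicit Grunwald-Letnikov scheme for the Caputo relaxation
    equation with rate lam. Nonnegativity comes from [(1-z)^alpha], all of whose coefficients after
    the first are nonpositive; total weight 1 comes from lam = 0, where [U = 1/(1-z)]. Taking
    [lam = exp(s n^(-alpha)) - 1] rather than [s n^(-alpha)] makes [1/(1+lam)] equal to
    [exp(-s n^(-alpha))]: its powers are exponentials in s, hence Gaussians in w at [s = |w|^2]. The
    norm in the claim is scale invariant, so every estimate keeps the exact power [g^(2-N)], and
    smallness comes only from the ratio g/s, from gam and from the mass of the datum far out. *)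

Section tuple_lebesgue.
Variable R : realType.
Local Notation leb := (@lebesgue_measure R).

Local Notation mR := (measurableTypeR R).

Definition consT n (z : mR * n.-tuple R) : n.+1.-tuple R := [tuple of z.1 :: z.2].

Lemma measurable_consT n : measurable_fun [set: mR * n.-tuple R] (@consT n).
Proof.
exact: measurable_cons.
Qed.

Lemma measurable_unconsT n :
  measurable_fun [set: n.+1.-tuple R] (fun x => (thead x : mR, [tuple of behead x])).
Proof.
apply/measurable_fun_pairP; split => /=; last exact: measurable_behead.
exact: (@measurable_tnth _ R n.+1 ord0).
Qed.

Section succ.
Variables (n : nat) (l : {sigma_finite_measure set mR -> \bar R}) (m : {sigma_finite_measure set (n.-tuple R) -> \bar R}).

(** Product measures live on pairs, while the functions at hand live on tuples; pushing forward
    along [consT] transports the product together with Fubini and Tonelli. *)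
Definition tuple_measureS : set (n.+1.-tuple R) -> \bar R :=
  pushforward (l \x m)%E (@consT n).

Let t0 : tuple_measureS set0 = 0%E.
Proof. by rewrite /tuple_measureS /pushforward preimage_set0 measure0. Qed.
Let tge A : (0 <= tuple_measureS A)%E.
Proof. exact: (@measure_ge0 _ _ _ (l \x m)%E). Qed.
Let tsig : semi_sigma_additive tuple_measureS.
Proof.
move=> A mA tA mbA; rewrite /tuple_measureS /pushforward preimage_bigcup.
have mp i : measurable (@consT n @^-1` A i).
  by rewrite -[X in measurable X]setTI; exact: measurable_consT.
apply: (@measure_semi_sigma_additive _ _ _ (l \x m)%E) => //.
  apply/trivIsetP => i j _ _ ij.
  rewrite -preimage_setI; move/trivIsetP : tA => /(_ i j I I ij) ->.
  by rewrite preimage_set0.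
by rewrite -preimage_bigcup -[X in measurable X]setTI; exact: measurable_consT.
Qed.

HB.instance Definition _ := isMeasure.Build _ _ _ tuple_measureS t0 tge tsig.

Let tfin : sigma_finite [set: n.+1.-tuple R] tuple_measureS.
Proof.
have /sigma_finiteP[A [AT ndA Afin]] := sigma_finiteT l.
have /sigma_finiteP[B [BT ndB Bfin]] := sigma_finiteT m.
pose un (x : n.+1.-tuple R) := (thead x : mR, [tuple of behead x]).
(* Both exhaustions are nondecreasing, so the diagonal boxes already cover: coordinates that enter
   at stages i and j lie together in the box of index [maxn i j]. *)
exists (fun k => un @^-1` (A k `*` B k)).
  rewrite -preimage_bigcup -[LHS](preimage_setT un); congr (_ @^-1` _).
  apply/seteqP; split => -[x y] // _.
  have : (\bigcup_i A i) x by rewrite -AT.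
  have : (\bigcup_i B i) y by rewrite -BT.
  move=> [i _ Biy] [j _ Ajx]; exists (maxn i j) => //; split => /=.
    by move: Ajx; exact/subsetPset/ndA/leq_maxr.
  by move: Biy; exact/subsetPset/ndB/leq_maxl.
move=> k; have [mA Ak] := Afin k; have [mB Bk] := Bfin k; split.
  rewrite -[X in measurable X]setTI; apply: measurable_unconsT => //.
  exact: measurableX.
rewrite /tuple_measureS /pushforward /=.
rewrite (_ : _ @^-1` _ = A k `*` B k); last first.
  have E (x : mR) t : un (consT (x, t)) = (x, t).
    by rewrite /un /consT theadE; congr pair; exact/val_inj.
  apply/funext => -[x t].
  by change ((A k `*` B k) (un (consT (x, t))) = (A k `*` B k) (x, t)); rewrite E.
by rewrite product_measure1E// lte_mul_pinfty// ge0_fin_numE.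
Qed.

HB.instance Definition _ := Measure_isSigmaFinite.Build _ _ _ tuple_measureS tfin.

End succ.

Definition dirac_tuple0 : set (0.-tuple R) -> \bar R := dirac [tuple].
HB.instance Definition _ := Measure.on dirac_tuple0.
Let d0fin : sigma_finite [set: 0.-tuple R] dirac_tuple0.
Proof.
exists (fun=> setT); first by rewrite bigcup_const.
by move=> _; split => //; rewrite /dirac_tuple0 diracT ltry.
Qed.
HB.instance Definition _ := Measure_isSigmaFinite.Build _ _ _ dirac_tuple0 d0fin.

(** The recursion splits off the first coordinate exactly as [intN] does. Sigma-finiteness is
    carried in the type because each further product needs it. *)
Fixpoint muN n : {sigma_finite_measure set (n.-tuple R) -> \bar R} :=
  match n return {sigma_finite_measure set (n.-tuple R) -> \bar R} with
  | 0 => dirac_tuple0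
  | n'.+1 => tuple_measureS (@lebesgue_measure R) (muN n')
  end.

Lemma ge0_integral_muNS n (f : n.+1.-tuple R -> \bar R) :
  measurable_fun [set: n.+1.-tuple R] f -> (forall x, 0 <= f x)%E ->
  (\int[muN n.+1]_z f z =
   \int[leb]_x \int[muN n]_t f [tuple of x :: t])%E.
Proof.
move=> mf f0.
rewrite [LHS](ge0_integral_pushforward (@measurable_consT n))//.
rewrite preimage_setT.
rewrite (@fubini_tonelli1 _ _ _ _ R leb (muN n) (f \o @consT n))//.
  by apply: measurableT_comp => //; exact: measurable_consT.
by move=> x; exact: f0.
Qed.

Lemma measurable_integral_cons n (f : n.+1.-tuple R -> \bar R) :
  measurable_fun [set: n.+1.-tuple R] f -> (forall x, 0 <= f x)%E ->
  measurable_fun [set: mR] (fun x => \int[muN n]_t f [tuple of x :: t])%E.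
Proof.
move=> mf f0.
apply: (@measurable_fun_fubini_tonelli_F _ _ _ _ R (muN n) (f \o @consT n)).
  by apply: measurableT_comp => //; exact: measurable_consT.
by move=> x; exact: f0.
Qed.

Lemma measurable_cons_slice n (f : n.+1.-tuple R -> \bar R) x :
  measurable_fun [set: n.+1.-tuple R] f ->
  measurable_fun [set: n.-tuple R] (fun t : n.-tuple R => f [tuple of x :: t]).
Proof. by move=> mf; apply: measurableT_comp => //; exact: measurable_cons. Qed.

(** Tonelli, one coordinate at a time. This is the bridge from the iterated integrals of the
    statement to integrals against a measure, where the convergence theorems apply. *)
Lemma intN_integral n (f : n.-tuple R -> \bar R) :
  measurable_fun [set: n.-tuple R] f -> (forall x, 0 <= f x)%E ->
  intN f = (\int[muN n]_z f z)%E.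
Proof.
elim: n f => [|n ih] f mf f0.
  by rewrite /= integral_dirac// diracT mul1e.
rewrite ge0_integral_muNS//=; apply: eq_integral => x _.
by apply: ih => //; exact: measurable_cons_slice.
Qed.

Lemma integrable_muNS n (f : n.+1.-tuple R -> \bar R) :
  (muN n.+1).-integrable setT f ->
  (\int[muN n.+1]_z f z =
   \int[leb]_x \int[muN n]_t f [tuple of x :: t])%E.
Proof.
move=> mf.
have mfc : (leb \x muN n)%E.-integrable setT (f \o @consT n).
  apply/integrableP; split.
    apply: measurableT_comp => //; last exact: measurable_consT.
    exact: measurable_int mf.
  move/integrableP: mf => [mf].
  rewrite [X in (X < _)%E -> _](ge0_integral_pushforward (@measurable_consT n))//.
  exact: measurableT_comp.
rewrite [LHS](integral_pushforward (@measurable_consT n))//; last exact: measurable_int mf.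
rewrite preimage_setT.
by rewrite -(@integral12_prod_meas1 _ _ _ _ R leb (muN n) (f \o @consT n)).
Qed.

Lemma ge0_integral_muN_prod n (h : 'I_n -> R -> R) (I_ : 'I_n -> R) :
  (forall i, measurable_fun setT (h i)) -> (forall i x, 0 <= h i x) ->
  (forall i, \int[leb]_x (h i x)%:E = (I_ i)%:E)%E ->
  (\int[muN n]_z (\prod_(i < n) h i (tnth z i))%:E = (\prod_(i < n) I_ i)%:E)%E.
Proof.
elim: n h I_ => [|n ih] h I_ mh h0 hI.
  under eq_integral do rewrite big_ord0.
  by rewrite /= integral_dirac// diracT mul1e big_ord0.
have mprod k (h' : 'I_k -> R -> R) : (forall i, measurable_fun setT (h' i)) ->
    measurable_fun [set: k.-tuple R] (fun z : k.-tuple R => \prod_(i < k) h' i (tnth z i)).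
  move=> mh'; apply: measurable_prod => i _.
  by apply: measurableT_comp => //; exact: measurable_tnth.
rewrite ge0_integral_muNS; last 2 first.
- by apply/measurable_EFinP; exact: mprod.
- by move=> x; rewrite lee_fin prodr_ge0.
under eq_integral => x _.
  under eq_integral => t _.
    rewrite big_ord_recl tnth0 EFinM.
    under eq_bigr do rewrite tnthS.
    over.
  rewrite ge0_integralZl//; last 3 first.
  - by apply/measurable_EFinP; apply: (mprod n (fun i => h (lift ord0 i))) => i.
  - by move=> t _; rewrite lee_fin prodr_ge0.
  - by rewrite lee_fin.
  rewrite (ih (fun i => h (lift ord0 i)) (fun i => I_ (lift ord0 i)))//.
  over.
rewrite ge0_integralZr//.
- by rewrite hI -EFinM [in RHS]big_ord_recl.
- by apply/measurable_EFinP; exact: mh.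
- by move=> x _; rewrite lee_fin.
- rewrite lee_fin prodr_ge0// => i _.
  by rewrite -lee_fin -hI integral_ge0// => x _; rewrite lee_fin.
Qed.

End tuple_lebesgue.

(** * Improper integrals by exhaustion *)

Lemma dominated_cvg_on d (T : measurableType d) (R : realType)
    (mu : {measure set T -> \bar R}) (D : set T) (f_ : (T -> \bar R)^nat)
    (f g : T -> \bar R) : measurable D ->
  (forall n, measurable_fun D (f_ n)) ->
  (forall x, D x -> f_ ^~ x @ \oo --> f x) ->
  mu.-integrable D g ->
  (forall n x, D x -> `|f_ n x| <= g x)%E ->
  ((fun n => \int[mu]_(x in D) f_ n x) @ \oo --> \int[mu]_(x in D) f x)%E.
Proof.
move=> mD mf cf ig fg.
have mf' : measurable_fun D f by apply: emeasurable_fun_cvg mf cf.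
have cf' : {ae mu, forall x, D x -> f_ ^~ x @ \oo --> f x}.
  by apply: aeW => x; exact: cf.
have fg' : {ae mu, forall x n, D x -> `|f_ n x| <= g x}%E.
  by apply: aeW => x n; exact: fg.
by have [] := @dominated_convergence _ _ _ mu D mD f_ f g mf mf' cf' ig fg'.
Qed.

Section ftc_exhaustion.
Variable R : realType.
Local Notation leb := (@lebesgue_measure R).
Variables (D : set R) (a b : nat -> R) (f F : R -> R) (l0 l : R).
Hypothesis mD : measurable D.
Hypothesis ab : forall n, a n < b n.
Hypothesis abD : forall n x, a n <= x <= b n -> D x.
Hypothesis Dab : forall x, D x -> \forall n \near \oo, a n <= x <= b n.
Hypothesis cf : forall x, D x -> {for x, continuous f}.
Hypothesis dF : forall x, D x -> is_derive x 1 F (f x).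
Hypothesis Fa : F (a n) @[n --> \oo] --> l0.
Hypothesis Fb : F (b n) @[n --> \oo] --> l.
Hypothesis mf : measurable_fun D f.

Let f_ n x : \bar R := ((f \_ `[a n, b n]) x)%:E.

Let f_E n x : f_ n x = ((EFin \o f) \_ `[a n, b n]) x.
Proof. by rewrite /f_ /patch; case: ifP. Qed.

Let int_f_ n : (\int[leb]_(x in D) f_ n x = (F (b n) - F (a n))%:E)%E.
Proof.
under eq_integral do rewrite f_E.
rewrite -integral_mkcondr setIidr; last first.
  by move=> x /=; rewrite in_itv/=; exact: abD.
have sabD x : x \in `[a n, b n]%classic -> D x.
  by rewrite inE/= in_itv/=; exact: abD.
have cF x : D x -> {for x, continuous F}.
  move=> Dx; apply: differentiable_continuous; apply/derivable1_diffP.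
  by have := dF Dx.
rewrite EFinB; apply: continuous_FTC2 => //.
- by apply: continuous_in_subspaceT => x /sabD; exact: cf.
- split.
  + move=> x /[!in_itv]/= /andP[ax xb].
    have Dx : D x by apply: (@abD n); rewrite !ltW.
    by have := dF Dx.
  + apply: cvg_at_right_filter; apply: cF; apply: (@abD n).
    by rewrite lexx ltW.
  + apply: cvg_at_left_filter; apply: cF; apply: (@abD n).
    by rewrite lexx ltW.
- move=> x /[!in_itv]/= /andP[ax xb].
  have Dx : D x by apply: (@abD n); rewrite !ltW.
  by rewrite derive1E; have := dF Dx => /@derive_val.
Qed.

Let mf_ n : measurable_fun D (f_ n).
Proof.
apply: (eq_measurable_fun ((EFin \o f) \_ `[a n, b n])).
  by move=> x _; rewrite f_E.
apply/measurable_restrict => //.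
have := measurable_funS mD (@subIsetl _ D `[a n, b n]) mf.
by move/measurable_EFinP.
Qed.

Let cvg_f_ x : D x -> f_ ^~ x @ \oo --> (f x)%:E.
Proof.
move=> Dx; apply: cvg_near_cst; apply: filterS (Dab Dx) => n abx.
by rewrite f_E patchE mem_set//= in_itv.
Qed.

(** The fundamental theorem on each [[a n, b n]], then dominated convergence with [|f|] as the
    dominating function. *)
Lemma FTC_exhaustion : leb.-integrable D (EFin \o f) ->
  (\int[leb]_(x in D) (f x)%:E = (l - l0)%:E)%E.
Proof.
move=> intf.
have h := @dominated_cvg_on _ _ _ leb D f_ (EFin \o f) (abse \o (EFin \o f)) mD
  mf_ cvg_f_ (integrable_abse intf) _.
apply: (cvg_unique _ (h _)) => //.
  move=> n x Dx; rewrite f_E patchE; case: ifPn => // _.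
  by rewrite abse0; exact: abse_ge0.
rewrite (_ : (fun _ => _) = fun n => (F (b n) - F (a n))%:E); last first.
  by apply/funext => n; exact: int_f_.
by apply: cvg_EFin; [exact: nearW|exact: cvgB].
Qed.

(** Fatou along the exhaustion: the integrals over [[a n, b n]] converge to [l - l0], which
    therefore bounds the full integral. *)
Lemma ge0_FTC_exhaustion_integrable : (forall x, D x -> 0 <= f x) ->
  leb.-integrable D (EFin \o f).
Proof.
move=> f0; apply/integrableP; split; first exact/measurable_EFinP.
have f_0 n x : D x -> (0 <= f_ n x)%E.
  by move=> Dx; rewrite f_E patchE; case: ifPn => //= _; rewrite lee_fin f0.
have := @fatou _ _ _ leb D mD f_ mf_ f_0.
rewrite (_ : limn_einf _ = (l - l0)%:E); last first.
  have h : (fun n => \int[leb]_(x in D) f_ n x)%E @ \oo --> (l - l0)%:E.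
    rewrite (_ : (fun _ => _) = fun n => (F (b n) - F (a n))%:E); last first.
      by apply/funext => n; exact: int_f_.
    by apply: cvg_EFin; [exact: nearW|exact: cvgB].
  by rewrite is_cvg_limn_einfE; [exact/cvg_lim|apply/cvg_ex; eexists; exact: h].
move=> h; apply: le_lt_trans (le_lt_trans h (ltry _)).
rewrite le_eqVlt; apply/orP; left; apply/eqP.
apply: eq_integral => x /set_mem Dx.
rewrite is_cvg_limn_einfE; last by apply/cvg_ex; eexists; exact: cvg_f_.
by rewrite (cvg_lim _ (cvg_f_ Dx))//= ger0_norm// f0.
Qed.

End ftc_exhaustion.

(** * The Gamma function *)

Section gamma.
Variable R : realType.
Local Notation leb := (@lebesgue_measure R).
Local Notation D := (`]0%R, +oo[%classic : set R).

Lemma FTC_0y (f F : R -> R) (l0 l : R) :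
  (forall x : R, 0 < x -> {for x, continuous f}) ->
  (forall x : R, 0 < x -> is_derive x 1 F (f x)) ->
  F x @[x --> 0^'+] --> l0 -> F x @[x --> +oo] --> l ->
  ((forall x : R, 0 < x -> 0 <= f x) -> leb.-integrable D (EFin \o f)) /\
  (leb.-integrable D (EFin \o f) ->
    (\int[leb]_(x in D) (f x)%:E = (l - l0)%:E)%E).
Proof.
move=> cf dF F0 Fy.
(* Starting at 1/2 keeps [a n] strictly below 1, hence below the right endpoint [n.+1], already for
   n = 0. *)
pose a n : R := n.+2%:R^-1.
have DE x : D x = (0 < x) :> Prop by rewrite /= in_itv/= andbT.
have a0 n : 0 < a n by rewrite invr_gt0.
have ab n : a n < n.+1%:R.
  rewrite (@lt_le_trans _ _ 1)// ?ler1n// invf_lt1//.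
  by rewrite ltr1n.
have abD n x : a n <= x <= n.+1%:R -> D x.
  by rewrite DE => /andP[+ _]; exact: lt_le_trans.
have aD : a n @[n --> \oo] --> 0.
  apply/gtr0_cvgV0; first exact: nearW.
  by have := @cvgr_idn R; rewrite -(cvg_shiftn 2); under eq_fun do rewrite addn2.
have Dab x : D x -> \forall n \near \oo, a n <= x <= n.+1%:R.
  rewrite DE => x0; near=> n; apply/andP; split.
    by apply: ltW; near: n; exact: (cvgr_lt 0).
  near: n; have : (n.+1%:R : R) @[n --> \oo] --> +oo.
    by have := @cvgr_idn R; rewrite -(cvg_shiftS).
  by move=> /cvgryPge; exact.
have cf' x : D x -> {for x, continuous f} by rewrite DE; exact: cf.
have dF' x : D x -> is_derive x 1 F (f x) by rewrite DE; exact: dF.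
have Fa : F (a n) @[n --> \oo] --> l0.
  by move/cvg_at_rightP : F0; apply; split.
have Fb : F n.+1%:R @[n --> \oo] --> l.
  move/cvg_pinftyP : Fy; apply.
  by have := @cvgr_idn R; rewrite -(cvg_shiftS).
have mf : measurable_fun D f.
  apply: open_continuous_measurable_fun; first exact: interval_open.
  by move=> x /set_mem; exact: cf'.
split; last exact: (@FTC_exhaustion R D a (fun n => n.+1%:R) f F l0 l).
move=> f0; apply: (@ge0_FTC_exhaustion_integrable R D a (fun n => n.+1%:R) f F l0 l) => //.
by move=> x; rewrite DE; exact: f0.
Unshelve. all: end_near. Qed.

Lemma continuous_powR (x a : R) : 0 < x -> {for x, continuous (@powR R ^~ a)}.
Proof.
move=> x0; apply: differentiable_continuous; apply/derivable1_diffP.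
by have := is_derive1_powR a x0.
Qed.

Lemma continuous_expRN (c x : R) : {for x, continuous (fun x : R => expR (- (c * x)))}.
Proof.
apply: continuous_comp; last exact: continuous_expR.
apply: continuousN; apply: continuousM => //; exact: cst_continuous.
Qed.

Lemma cvg_expRN0y (c : R) : 0 < c -> expR (- (c * x)) @[x --> +oo] --> (0 : R).
Proof.
move=> c0.
apply: (@cvg_comp _ _ _ (fun x => c * x) (fun z : R => expR (- z)) _ (pinfty_nbhs R)).
  exact: gt0_cvgMry.
exact: cvgr_expR.
Qed.

Lemma integrable_expRN0y (c : R) : 0 < c ->
  leb.-integrable D (EFin \o (fun x => expR (- (c * x)))).
Proof.
move=> c0.
have cf (x : R) : 0 < x -> {for x, continuous (fun x => expR (- (c * x)))}.
  by move=> _; exact: continuous_expRN.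
have dF (x : R) : 0 < x ->
    is_derive x 1 (fun x => - (c^-1 * expR (- (c * x)))) (expR (- (c * x))).
  move=> _; apply: is_derive_eq; rewrite /GRing.scale /=.
  by field; rewrite gt_eqF.
have F0 : - (c^-1 * expR (- (c * x))) @[x --> 0^'+] --> - (c^-1 * 1).
  apply: cvgN; apply: cvgMl_tmp; apply: cvg_at_right_filter.
  have : expR (- (c * x)) @[x --> (0 : R)] --> expR (- (c * 0)) by exact: continuous_expRN.
  by rewrite mulr0 oppr0 expR0.
have Fy : - (c^-1 * expR (- (c * x))) @[x --> +oo] --> - (c^-1 * 0).
  by apply: cvgN; apply: cvgMl_tmp; exact: cvg_expRN0y.
have [+ _] := FTC_0y cf dF F0 Fy.
by apply => x _; exact: expR_ge0.
Qed.

Definition gamma_integrand (s x : R) : R := x `^ (s - 1) * expR (- x).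

(** From [ln y < y] at [y = x / (2 s)]: the slope [(s - 1) / (2 s)] is at most 1/2, so half of the
    decay of [exp(-x)] is left over for integrability. *)
Lemma powR_le_expR (s : R) : 1 <= s ->
  exists2 C, 0 <= C & forall x, 0 < x -> x `^ (s - 1) <= C * expR (2^-1 * x).
Proof.
move=> s1; exists (expR ((s - 1) * ln (2 * s))) => [|x x0]; first exact: expR_ge0.
have s0 : 0 < s by lra.
rewrite /powR gt_eqF// -expRD ler_expR.
have : ln (x / (2 * s)) <= x / (2 * s).
  by apply/ltW/ln_sublinear; rewrite divr_gt0// mulr_gt0.
rewrite ln_div ?posrE ?mulr_gt0// => h.
have : (s - 1) * ln x <= (s - 1) * (x / (2 * s) + ln (2 * s)).
  by apply: ler_wpM2l; lra.
move=> /le_trans; apply; rewrite mulrDr addrC lerD2l.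
rewrite -subr_ge0 [leRHS](_ : _ = x / (2 * s)); last by field; rewrite gt_eqF.
by rewrite divr_ge0// ltW// mulr_gt0.
Qed.

Lemma integrable_gamma (s : R) : 1 <= s ->
  leb.-integrable D (EFin \o gamma_integrand s).
Proof.
move=> s1; have [C C0 hC] := powR_le_expR s1.
have hi := integrableZl (mu := leb) _ C (integrable_expRN0y (c := 2^-1) _).
have {}hi := hi (measurable_itv _) ltac:(by rewrite invr_gt0).
apply: le_integrable hi => //.
  apply/measurable_EFinP; apply: measurable_funM => //.
    exact: measurable_funTS (measurable_powR _).
  by apply: measurable_funTS; apply: measurableT_comp.
move=> x; rewrite /= in_itv/= andbT => x0; rewrite lee_fin.
rewrite !ger0_norm ?mulr_ge0 ?expR_ge0 ?powR_ge0//.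
apply: (@le_trans _ _ (C * expR (2^-1 * x) * expR (- x))).
  by rewrite ler_wpM2r ?expR_ge0// hC.
rewrite -mulrA -expRD; apply: ler_wpM2l => //; rewrite ler_expR; lra.
Qed.

Lemma GammafE s : 1 <= s ->
  (\int[leb]_(x in D) (gamma_integrand s x)%:E = (Gammaf s)%:E)%E.
Proof.
move=> s1; rewrite /Gammaf fineK//.
exact: (integrable_fin_num _ (integrable_gamma s1)).
Qed.

Lemma Gammaf1 : Gammaf 1 = 1 :> R.
Proof.
apply: EFin_inj; rewrite -GammafE//.
have cf (x : R) : 0 < x -> {for x, continuous (fun x : R => expR (- (1 * x)))}.
  by move=> _; exact: continuous_expRN.
have dF (x : R) : 0 < x ->
    is_derive x 1 (fun x => - expR (- (1 * x))) (expR (- (1 * x))).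
  move=> _; apply: is_derive_eq; rewrite /GRing.scale /=; ring.
have F0 : - expR (- (1 * x)) @[x --> 0^'+] --> (-1 : R).
  apply: cvgN; apply: cvg_at_right_filter.
  have : expR (- (1 * x)) @[x --> (0 : R)] --> expR (- (1 * 0)) by exact: continuous_expRN.
  by rewrite mulr0 oppr0 expR0.
have Fy : - expR (- (1 * x)) @[x --> +oo] --> - (0 : R).
  by apply: cvgN; exact: cvg_expRN0y.
have [_ /(_ (integrable_expRN0y ltr01))] := FTC_0y cf dF F0 Fy.
rewrite oppr0 sub0r opprK => <-.
apply: eq_integral => x /[!inE]/=; rewrite in_itv/= andbT => x0.
by rewrite /gamma_integrand subrr powRr0 !mul1r.
Qed.

Lemma cvg_powR_expRy (s : R) : 1 <= s ->
  x `^ (s - 1) * expR (- x) @[x --> +oo] --> 0.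
Proof.
move=> s1; have [C C0 hC] := powR_le_expR s1.
apply: (@squeeze_cvgr _ _ _ _ (cst 0) (fun x => C * expR (- (2^-1 * x)))).
- near=> x; have x0 : 0 < x by [].
  rewrite mulr_ge0 ?expR_ge0 ?powR_ge0//=.
  apply: (@le_trans _ _ (C * expR (2^-1 * x) * expR (- x))).
    by rewrite ler_wpM2r ?expR_ge0// hC.
  rewrite -mulrA -expRD; apply: ler_wpM2l => //; rewrite ler_expR; lra.
- exact: cvg_cst.
- rewrite -(mulr0 C); apply: cvgMl_tmp; apply: cvg_expRN0y.
  by rewrite invr_gt0.
Unshelve. all: end_near. Qed.

(** Integration by parts: [x^s exp(-x)] vanishes at both ends and its derivative is the difference
    of the two integrands. Arguments at least 1 are enough, since only [1 + k alpha] occurs in the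
    Mittag-Leffler series. *)
Lemma GammafS (s : R) : 1 <= s -> Gammaf (s + 1) = s * Gammaf s.
Proof.
move=> s1; have s0 : 0 < s by lra.
have s11 : 1 <= s + 1 by lra.
pose f x := s * gamma_integrand s x - gamma_integrand (s + 1) x.
have cg (r x : R) : 0 < x -> {for x, continuous (gamma_integrand r)}.
  move=> x0; apply: continuousM; first exact: continuous_powR.
  by apply: continuous_comp; [exact: continuousN|exact: continuous_expR].
have cf (x : R) : 0 < x -> {for x, continuous f}.
  move=> x0; apply: continuousB; last exact: cg.
  by apply: continuousM; [exact: cst_continuous|exact: cg].
have dF (x : R) : 0 < x -> is_derive x 1 (fun x => x `^ s * expR (- x)) (f x).
  move=> x0.
  have d1 := is_derive1_powR s x0.
  have d2 : is_derive x 1 (fun x => expR (- x)) (- expR (- x)).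
    by apply: is_derive_eq; rewrite /GRing.scale /=; ring.
  apply: is_derive_eq; rewrite /GRing.scale /= /f /gamma_integrand addrK; ring.
have F0 : x `^ s * expR (- x) @[x --> 0^'+] --> (0 : R).
  rewrite -[X in _ --> X](mul0r (expR (- 0))); apply: cvgM; first exact: powR_cvg0.
  apply: cvg_at_right_filter.
  by apply: continuous_comp; [exact: continuousN|exact: continuous_expR].
have Fy : x `^ s * expR (- x) @[x --> +oo] --> (0 : R).
  by have := cvg_powR_expRy s11; rewrite addrK.
have [_ h] := FTC_0y cf dF F0 Fy.
have i1 : leb.-integrable D (fun x => s%:E * (gamma_integrand s x)%:E)%E.
  by apply: integrableZl => //; exact: integrable_gamma.
have i2 := integrable_gamma s11.
have E : (\int[leb]_(x in D) (f x)%:E = (s * Gammaf s - Gammaf (s + 1))%:E)%E.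
  rewrite /f; under eq_integral do rewrite EFinB EFinM.
  rewrite integralB// integralZl//; last exact: integrable_gamma.
  by rewrite !GammafE.
have fi : leb.-integrable D (EFin \o f).
  rewrite (_ : EFin \o f = (fun x => s%:E * (gamma_integrand s x)%:E) \-
      (EFin \o gamma_integrand (s + 1)))%E; first exact: integrableB.
  by apply/funext => x; rewrite /= EFinB EFinM.
by have := h fi; rewrite E subrr => -[] /eqP; rewrite subr_eq0 => /eqP.
Qed.

Lemma Gammaf_ge0 s : 0 <= Gammaf s :> R.
Proof.
by rewrite fine_ge0// integral_ge0// => x _; rewrite lee_fin mulr_ge0 ?powR_ge0 ?expR_ge0.
Qed.

(* The concavity bound [y^t <= 1 + t (y - 1)] at [y = x / s], integrated. *)
Lemma Gammaf_le (s t : R) : 1 <= s -> 0 <= t <= 1 ->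
  Gammaf (s + t) <= s `^ t * Gammaf s.
Proof.
move=> s1 /andP[t0 t1]; have s0 : 0 < s by lra.
have h (x : R) : 0 < x -> gamma_integrand (s + t) x <=
    s `^ t * ((1 - t) * gamma_integrand s x + t / s * gamma_integrand (s + 1) x).
  move=> x0; rewrite /gamma_integrand !mulrA -mulrDl mulrA ler_wpM2r ?expR_ge0//.
  have -> : x `^ (s + t - 1) = x `^ (s - 1) * x `^ t.
    rewrite -powRD; last by rewrite (gt_eqF x0) implybT.
    by congr (_ `^ _); ring.
  have -> : x `^ (s + 1 - 1) = x `^ (s - 1) * x.
    rewrite -[X in _ * X](powRr1 (ltW x0)) -powRD; last by rewrite (gt_eqF x0) implybT.
    by congr (_ `^ _); ring.
  have -> : x `^ t = s `^ t * (x / s) `^ t.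
    rewrite -powRM ?divr_ge0 ?ltW//; congr (_ `^ t); field; by rewrite gt_eqF.
  have -> : s `^ t * ((1 - t) * x `^ (s - 1) + t / s * (x `^ (s - 1) * x)) =
    x `^ (s - 1) * (s `^ t * (1 + t * (x / s - 1))).
    by field; rewrite gt_eqF.
  rewrite ler_wpM2l ?powR_ge0// ler_wpM2l ?powR_ge0//.
  have y0 : 0 < x / s by rewrite divr_gt0.
  move: (x / s) y0 => y y0.
  have [->|t_neq0] := eqVneq t 0; first by rewrite powRr0 mul0r addr0.
  have [->|t_neq1] := eqVneq t 1; first by rewrite (powRr1 (ltW y0)) mul1r addrC subrK.
  have t_gt0 : 0 < t by rewrite lt0r t_neq0.
  have t_lt1 : 0 < 1 - t by rewrite subr_gt0 lt_neqAle t_neq1.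
  (* Young's inequality for the product of [y^t] and 1, with conjugate exponents 1/t and 1/(1-t);
     the degenerate values t = 0 and t = 1 were removed just before. *)
  have := @conjugate_powR R (y `^ t) 1 t^-1 (1 - t)^-1 (powR_ge0 _ _) ler01.
  rewrite !invr_gt0 !invrK => /(_ t_gt0 t_lt1 ltac:(ring)).
  rewrite mulr1 powR1 mul1r -powRrM mulfV// (powRr1 (ltW y0)) => /le_trans; apply.
  by rewrite le_eqVlt; apply/orP; left; apply/eqP; ring.
have s11 : 1 <= s + 1 by lra.
have st1 : 1 <= s + t by lra.
have i1 : leb.-integrable D (fun x => (1 - t)%:E * (gamma_integrand s x)%:E)%E.
  by apply: integrableZl => //; exact: integrable_gamma.
have i2 : leb.-integrable D (fun x => (t / s)%:E * (gamma_integrand (s + 1) x)%:E)%E.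
  by apply: integrableZl => //; exact: integrable_gamma.
have E : (\int[leb]_(x in D) (s `^ t * ((1 - t) * gamma_integrand s x + t / s * gamma_integrand (s + 1) x))%:E = (s `^ t * Gammaf s)%:E)%E.
  transitivity (\int[leb]_(x in D) ((s `^ t)%:E * ((1 - t)%:E * (gamma_integrand s x)%:E +
      (t / s)%:E * (gamma_integrand (s + 1) x)%:E)))%E.
    by exact: eq_integral.
  rewrite integralZl//; last exact: integrableD.
  rewrite integralD// !integralZl//; [|exact: integrable_gamma..].
  rewrite !GammafE// GammafS//.
  rewrite [LHS](_ : _ = (s `^ t * ((1 - t) * Gammaf s + t / s * (s * Gammaf s)))%:E)//.
  by congr EFin; field; rewrite gt_eqF.
rewrite -lee_fin -E -GammafE//.
apply: ge0_le_integral => //.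
- by move=> x _; rewrite lee_fin mulr_ge0 ?powR_ge0 ?expR_ge0.
- exact: measurable_int (integrable_gamma st1).
- have mg r : 1 <= r -> measurable_fun D (gamma_integrand r).
    by move=> /integrable_gamma/measurable_int/measurable_EFinP.
  apply/measurable_EFinP; apply: measurable_funM => //.
  by apply: measurable_funD; apply: measurable_funM => //; exact: mg.
- by move=> x; rewrite /= in_itv/= andbT => x0; rewrite lee_fin h.
Qed.

Lemma Gammaf_nat n : Gammaf n.+1%:R = n`!%:R :> R.
Proof.
elim: n => [|n ih]; first by rewrite Gammaf1 fact0.
by rewrite -[n.+2]addn1 natrD GammafS ?ler1n// ih factS natrM.
Qed.

Lemma Gammaf_prod n (a : R) : 0 <= a ->
  Gammaf (n%:R + 1 + a) = Gammaf (1 + a) * \prod_(j < n) (1 + a / j.+1%:R) * n`!%:R.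
Proof.
move=> a0; elim: n => [|n ih]; first by rewrite big_ord0 !mulr1 add0r.
rewrite (_ : n.+1%:R + 1 + a = n%:R + 1 + a + 1); last by rewrite -natr1; ring.
rewrite GammafS; last by have : 0 <= n%:R :> R by []; lra.
rewrite ih big_ord_recr /= factS natrM -natr1; field.
by rewrite natr1.
Qed.

(** [Gammaf_le] is used twice: from n + 1 with increment t for the upper bound, and from n + 1 + t
    with increment 1 - t, which lands on the factorial at n + 2, for the lower bound. *)
Lemma Gammaf_ratio_itv01 (t : R) n : 0 <= t <= 1 -> (0 < n)%N ->
  (n%:R + 1) / (n%:R + 2) <= Gammaf (n%:R + 1 + t) / (n`!%:R * n%:R `^ t) <=
  (n%:R + 1) / n%:R.
Proof.
move=> t01 n0; have n_gt0 : 0 < n%:R :> R by rewrite ltr0n.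
have [t0 t1] := andP t01.
have f0 : 0 < n`!%:R :> R by rewrite ltr0n fact_gt0.
have p0 : 0 < n%:R `^ t :> R by rewrite powR_gt0.
have N1 : 1 <= n%:R + 1 :> R by lra.
have Nt : 1 <= n%:R + 1 + t :> R by lra.
apply/andP; split.
- rewrite ler_pdivlMr ?mulr_gt0// mulrAC ler_pdivrMr; last by lra.
  have := @Gammaf_le (n%:R + 1 + t) (1 - t) Nt ltac:(lra).
  rewrite (_ : n%:R + 1 + t + (1 - t) = n.+2%:R); last by rewrite -!natr1; ring.
  rewrite Gammaf_nat factS natrM mulrA -natr1 => h.
  apply: (@le_trans _ _ ((n%:R + 1) * n`!%:R * (n%:R + 2) `^ t)).
    rewrite ler_wpM2l// ge0_ler_powR// ?nnegrE; lra.
  apply: (@le_trans _ _ ((n%:R + 1 + t) `^ (1 - t) * Gammaf (n%:R + 1 + t) * (n%:R + 2) `^ t)).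
    by rewrite ler_wpM2r ?powR_ge0.
  rewrite mulrAC mulrC ler_wpM2l ?Gammaf_ge0//.
  apply: (@le_trans _ _ ((n%:R + 2) `^ (1 - t) * (n%:R + 2) `^ t)).
    rewrite ler_wpM2r ?powR_ge0// ge0_ler_powR// ?nnegrE; lra.
  rewrite -powRD; last by apply/implyP => _; rewrite gt_eqF//; lra.
  by rewrite subrK powRr1//; lra.
- rewrite ler_pdivrMr ?mulr_gt0//.
  apply: (le_trans (Gammaf_le N1 t01)).
  rewrite natr1 Gammaf_nat mulrC mulrCA ler_wpM2l//.
  rewrite -ler_pdivrMr// -powR_inv1 ?powR_ge0//.
  have -> : n.+1%:R `^ t * n%:R `^ t `^ (-1) = (n.+1%:R / n%:R) `^ t :> R.
    by rewrite powRM ?invr_ge0// -(powR_inv1 (ltW n_gt0)) -!powRrM (mulrC t).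
  apply: ler1_powR => //.
  by rewrite ler_pdivlMr// mul1r ler_nat.
Qed.

(** For exponents in [0, 1] the two-sided bound squeezes. The functional equation then raises the
    exponent by one at the price of a factor [1 + (1 + b)/n], which tends to 1, and the integer part
    of a counts the shifts. *)
Lemma cvg_Gammaf_ratio (a : R) : 0 <= a ->
  Gammaf (n%:R + 1 + a) / (n`!%:R * n%:R `^ a) @[n --> \oo] --> (1 : R).
Proof.
move=> a0.
have cvgn_inv : (n%:R^-1 : R) @[n --> \oo] --> (0 : R).
  by apply/gtr0_cvgV0; [near=> n; rewrite ltr0n; near: n; exists 1%N|exact: cvgr_idn].
have base t : 0 <= t <= 1 ->
    Gammaf (n%:R + 1 + t) / (n`!%:R * n%:R `^ t) @[n --> \oo] --> (1 : R).
  move=> t01.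
  apply: (@squeeze_cvgr _ _ _ _ (fun n => (1 + n%:R^-1) / (1 + 2 * n%:R^-1)) (fun n => 1 + n%:R^-1)).
  - near=> n; have n0 : (0 < n)%N by near: n; exists 1%N.
    have n_gt0 : 0 < n%:R :> R by rewrite ltr0n.
    have := Gammaf_ratio_itv01 t01 n0.
    congr (is_true (_ && _)); congr (_ <= _); field; rewrite ?gt_eqF//; lra.
  - rewrite [X in _ --> X](_ : 1 = (1 + 0) / (1 + 2 * 0) :> R); last by field.
    apply: cvgM; first by apply: cvgD => //; exact: cvg_cst.
    apply: cvgV; first by rewrite mulr0 addr0 oner_eq0.
    by apply: cvgD; [exact: cvg_cst|exact: cvgMl_tmp].
  - by rewrite -[X in _ --> X]addr0; apply: cvgD => //; exact: cvg_cst.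
have step b : 0 <= b -> 
    Gammaf (n%:R + 1 + b) / (n`!%:R * n%:R `^ b) @[n --> \oo] --> (1 : R) ->
    Gammaf (n%:R + 1 + (b + 1)) / (n`!%:R * n%:R `^ (b + 1)) @[n --> \oo] --> (1 : R).
  move=> b0 hb.
  apply: (@cvg_trans _ ((Gammaf (n%:R + 1 + b) / (n`!%:R * n%:R `^ b) * (1 + (1 + b) * n%:R^-1)) @[n --> \oo])).
    apply: near_eq_cvg; near=> n.
    have n0 : 0 < n%:R :> R by rewrite ltr0n; near: n; exists 1%N.
    have -> : n%:R + 1 + (b + 1) = n%:R + 1 + b + 1 :> R by ring.
    rewrite GammafS; last by lra.
    rewrite powRD ?(powRr1 (ltW n0)); last by rewrite (gt_eqF n0) implybT.
    field; rewrite !gt_eqF ?powR_gt0//= ltr0n fact_gt0//.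
  have hd : 1 + (1 + b) * n%:R^-1 @[n --> \oo] --> 1 + (1 + b) * 0.
    by apply: cvgD; [exact: cvg_cst|exact: cvgMl_tmp].
  have h3 : Gammaf (n%:R + 1 + b) / (n`!%:R * n%:R `^ b) *
      (1 + (1 + b) * n%:R^-1) @[n --> \oo] --> 1 * (1 + (1 + b) * 0).
    exact: cvgM hb hd.
  by rewrite mulr0 addr0 mulr1 in h3; exact: h3.
have ind m t : 0 <= t <= 1 ->
    Gammaf (n%:R + 1 + (t + m%:R)) / (n`!%:R * n%:R `^ (t + m%:R)) @[n --> \oo] --> (1 : R).
  move=> t01; elim: m => [|m ih]; first by rewrite addr0; exact: base.
  rewrite -natr1 addrA; apply: step => //.
  by move/andP : t01 => [? _]; rewrite addr_ge0.
have [m /andP[ma am]] : exists m, m%:R <= a < m.+1%:R.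
  by exists (Num.trunc a); exact: truncn_itv.
rewrite (_ : a = (a - m%:R) + m%:R); last by ring.
by apply: ind; rewrite subr_ge0 ma lerBlDl natr1 ltW.
Unshelve. all: end_near. Qed.

(** [Gammaf (n + 1 + a)] is known both exactly, from the functional equation, and asymptotically;
    comparing the two gives Gauss's product. *)
Lemma cvg_gauss_product (a : R) : 0 <= a ->
  (\prod_(j < n) (1 + a / j.+1%:R)) / n%:R `^ a @[n --> \oo] --> (Gammaf (1 + a))^-1.
Proof.
move=> a0; have h := cvg_Gammaf_ratio a0.
pose u n : R := (\prod_(j < n) (1 + a / j.+1%:R)) / n%:R `^ a.
have hu : Gammaf (1 + a) * u n @[n --> \oo] --> (1 : R).
  apply: cvg_trans h; apply: near_eq_cvg; near=> n.
  rewrite Gammaf_prod// /u; field.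
  rewrite gt_eqF ?powR_gt0 ?ltr0n//= ?gt_eqF ?ltr0n ?fact_gt0//.
  by near: n; exists 1%N.
(* Non-vanishing is read off from the limit: otherwise a sequence tending to 1 would be constantly
   0. *)
have G0 : Gammaf (1 + a) != 0 :> R.
  apply/eqP => E; move: hu; rewrite E; under eq_fun do rewrite mul0r.
  by move=> /(cvg_unique _ (cvg_cst _)) => /(_ (@Rhausdorff R)) /eqP; rewrite eq_sym oner_eq0.
rewrite [X in X @ _](_ : _ = fun n => (Gammaf (1 + a))^-1 * (Gammaf (1 + a) * u n)); last first.
  by apply/funext => n; rewrite mulrA mulVf// mul1r.
rewrite -[X in _ --> X]mulr1.
exact: cvgMl_tmp.
Unshelve. all: end_near. Qed.

End gamma.

(** * The Mittag-Leffler function as a limit of exponential mixtures *)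

Section rising.
Variable R : realType.
Implicit Types x y a : R.

(* The n-th Taylor coefficient of [(1 - z)^(-x)]. *)
Definition rising n x : R := \prod_(j < n) ((x + j%:R) / j.+1%:R).

Lemma rising0 x : rising 0 x = 1. Proof. exact: big_ord0. Qed.

Lemma risingS n x : n.+1%:R * rising n.+1 x = (x + n%:R) * rising n x.
Proof. by rewrite /rising big_ord_recr /=; field; rewrite ?natr1 ?nat1r pnatr_eq0. Qed.

(** Chu-Vandermonde, the coefficient form of [(1-z)^(-x) (1-z)^(-y) = (1-z)^(-x-y)]. The recurrence
    [risingS] is applied to each factor, and the weight n + 1 is recovered as k + (n + 1 - k). *)
Lemma rising_vandermonde n x y :
  rising n (x + y) = \sum_(k < n.+1) rising k x * rising (n - k) y.
Proof.
elim: n => [|n ih]; first by rewrite big_ord1 !rising0 mulr1.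
apply: (@mulfI _ n.+1%:R); first by rewrite pnatr_eq0.
rewrite risingS ih mulr_sumr.
pose G k := rising k x * rising (n.+1 - k) y.
transitivity (\sum_(k < n.+1) (k.+1%:R * G k.+1 + (n.+1 - k)%:R * G k)).
  apply: eq_bigr => k _; rewrite /G subSS subSn; last by rewrite -ltnS.
  rewrite (mulrA k.+1%:R) risingS (mulrCA (n - k).+1%:R) risingS natrB; last by rewrite -ltnS.
  ring.
rewrite big_split /=.
have -> : \sum_(k < n.+1) k.+1%:R * G k.+1 = \sum_(k < n.+2) k%:R * G k.
  by rewrite [RHS]big_ord_recl mul0r add0r.
have -> : \sum_(k < n.+1) (n.+1 - k)%:R * G k = \sum_(k < n.+2) (n.+1 - k)%:R * G k.
  by rewrite [RHS]big_ord_recr /= subnn mul0r addr0.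
rewrite -big_split mulr_sumr; apply: eq_bigr => k _ /=.
by rewrite -mulrDl -natrD subnKC// -ltnS.
Qed.

Lemma rising_gauss n a : rising n (1 + a) = \prod_(j < n) (1 + a / j.+1%:R).
Proof.
apply: eq_bigr => j _; rewrite -natr1; field.
by rewrite natr1 pnatr_eq0.
Qed.

Lemma rising_ge0 n x : 0 <= x -> 0 <= rising n x.
Proof. by move=> x0; apply: prodr_ge0 => j _; rewrite divr_ge0// addr_ge0. Qed.

(** Only the first factor, -a, is nonpositive; the others contain j + 1 - a. In other words
    [(1-z)^a] is 1 minus a series with nonnegative coefficients, the source of all positivity
    below. *)
Lemma risingN_le0 n a : 0 <= a <= 1 -> rising n.+1 (- a) <= 0.
Proof.
move=> /andP[a0 a1]; rewrite /rising big_ord_recl /=.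
rewrite addr0 divr1 mulr_le0_ge0 ?oppr_le0//.
apply: prodr_ge0 => j _; rewrite divr_ge0// addrC subr_ge0 (le_trans a1)//.
by rewrite ler1n.
Qed.

End rising.

(** * Passing to the limit in series with geometric domination *)

Section tannery.
Variable R : realType.

Lemma cvg_sum_ord (T : Type) (F : set_system T) {FF : Filter F} n
    (f : 'I_n -> T -> R) (l : 'I_n -> R) :
  (forall k, f k x @[x --> F] --> l k) ->
  \sum_(k < n) f k x @[x --> F] --> \sum_(k < n) l k.
Proof.
elim: n f l => [|n ih] f l h.
  by under eq_fun do rewrite big_ord0; rewrite big_ord0; exact: cvg_cst.
under eq_fun do rewrite big_ord_recl; rewrite big_ord_recl.
by apply: cvgD; [exact: h|exact: ih].
Qed.

(** Write the ratio as [exp(-2c)]: one half of the decay absorbs the polynomial, through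
    [y^n <= n! exp(y)] at [y = c (k + 1)], and the other half remains as the ratio r. *)
Lemma expn_mul_exp_le (x : R) n : 0 <= x < 1 ->
  exists C r : R, [/\ 0 <= C, 0 <= r < 1 &
    forall k : nat, x ^+ k * k.+1%:R ^+ n <= C * r ^+ k].
Proof.
move=> /andP[x0 x1].
(* The maximum with 1/2 covers x = 0, where a logarithm could not be taken. *)
pose y := Num.max x 2^-1.
have xy : x <= y by rewrite le_max lexx.
have y0 : 0 < y by rewrite lt_max invr_gt0 ltr0n orbT.
have y1 : y < 1 by rewrite gt_max x1 invf_lt1// ltr1n.
pose c := - ln y / 2.
have c0 : 0 < c by rewrite divr_gt0// oppr_gt0 ln_lt0// y0.
have yE : y = expR (- (c + c)).
  by rewrite (_ : - (c + c) = ln y) ?lnK ?posrE//; rewrite /c; field.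
exists (n`!%:R / c ^+ n * expR c), (expR (- c)); split.
- by rewrite !mulr_ge0 ?expR_ge0 ?invr_ge0 ?exprn_ge0// ltW.
- by rewrite expR_ge0 expR_lt1 oppr_lt0.
- move=> k.
  have h : k.+1%:R ^+ n <= n`!%:R / c ^+ n * expR (c * k.+1%:R).
    have := @expR_ge1Dxn R (c * k.+1%:R) n.-1.
    case: n => [|n] /=.
      move=> _; rewrite !expr0 divr1 mul1r -expR0 ler_expR mulr_ge0// ltW//.
    rewrite mulr_ge0 ?(ltW c0)// => /(_ isT) h.
    rewrite mulrAC ler_pdivlMr ?exprn_gt0// mulrC -exprMn.
    rewrite -ler_pdivrMl ?ltr0n ?fact_gt0// mulrC; apply: le_trans h.
    by rewrite lerDr.
  apply: (@le_trans _ _ (y ^+ k * (n`!%:R / c ^+ n * expR (c * k.+1%:R)))).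
    by apply: ler_pM => //; rewrite ?exprn_ge0// lerXn2r ?nnegrE// ltW.
  rewrite yE -!expRM_natl -natr1 (_ : c * (k%:R + 1) = c * k%:R + c); last by ring.
  rewrite expRD.
  have -> : expR (k%:R * - (c + c)) = expR (k%:R * - c) * expR (k%:R * - c).
    by rewrite -expRD; congr expR; ring.
  have -> : expR (c * k%:R) = (expR (k%:R * - c))^-1.
    by rewrite -expRN; congr expR; ring.
  rewrite le_eqVlt; apply/orP; left; apply/eqP; field.
  by rewrite !gt_eqF ?exprn_gt0 ?expR_gt0.
Qed.

Lemma geometric_tail (t : nat -> R) (C r : R) : 0 <= r < 1 ->
  (forall k, `|t k| <= C * r ^+ k) ->
  exists2 S, (fun K => \sum_(k < K) t k) @ \oo --> S &
    forall K, `|S - \sum_(k < K) t k| <= C * r ^+ K / (1 - r).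
Proof.
move=> /andP[r0 r1] ht.
have r1' : 0 < 1 - r by lra.
have hs K m : `|\sum_(k < m + K) t k - \sum_(k < K) t k| <= C * r ^+ K / (1 - r).
  elim: m K => [|m ih] K.
    rewrite subrr normr0 divr_ge0 ?(ltW r1')//.
    by apply: le_trans (ht K).
  rewrite addSnnS (_ : _ - _ = (\sum_(k < m + K.+1) t k - \sum_(k < K.+1) t k) + t K); last first.
    by rewrite [in RHS]big_ord_recr /=; ring.
  apply: (le_trans (ler_normD _ _)); apply: (le_trans (lerD (ih _) (ht _))).
  rewrite exprS le_eqVlt; apply/orP; left; apply/eqP; field.
  by rewrite gt_eqF.
have cs : cvgn (fun K => \sum_(k < K) t k).
  rewrite (_ : (fun _ => _) = series t); last by apply/funext => n; rewrite /series /= big_mkord.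
  apply: normed_cvg.
  apply: (@series_le_cvg _ _ (geometric C r)) => //.
    by move=> k; rewrite /= normr_ge0.
    by move=> k; rewrite (le_trans _ (ht k)).
  by apply: is_cvg_geometric_series; rewrite ger0_norm.
exists (limn (fun K => \sum_(k < K) t k)) => // K.
have h : (fun m => `|\sum_(k < m + K) t k - \sum_(k < K) t k|) @ \oo -->
    `|limn (fun K => \sum_(k < K) t k) - \sum_(k < K) t k|.
  apply: cvg_norm; apply: cvgB; last exact: cvg_cst.
  by have := cs; rewrite -(cvg_shiftn K).
apply: (cvgr_to_le h).
by apply: nearW => m; exact: hs.
Qed.

(** A three-epsilon argument: both tails beyond a fixed K are below [C r^K / (1-r)], uniformly in n,
    and the first K terms converge. The limit is written with [limn] to match [mittag_leffler]. *)
Lemma tannery (T : nat -> nat -> R) (T' S : nat -> R) (C r : R) : 0 <= r < 1 ->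
  (\forall n \near \oo, forall k, `|T n k| <= C * r ^+ k) ->
  (forall k, T n k @[n --> \oo] --> T' k) ->
  (\forall n \near \oo, (fun K => \sum_(k < K) T n k) @ \oo --> S n) ->
  S n @[n --> \oo] --> limn (fun K => \sum_(k < K) T' k).
Proof.
move=> r01 hT hT' hS; have /andP[r0 r1] := r01.
have hT'b k : `|T' k| <= C * r ^+ k.
  have h : `|T n k| @[n --> \oo] --> `|T' k| by apply: cvg_norm.
  apply: (cvgr_to_le h).
  by apply: filterS hT => n; apply.
have [S' cS' hS'] := geometric_tail r01 hT'b.
rewrite (cvg_lim _ cS')//.
have hr : (fun K => C * r ^+ K / (1 - r)) @ \oo --> (0 : R).
  rewrite -(mul0r (1 - r)^-1) -(mulr0 C); apply: cvgMr_tmp; apply: cvgMl_tmp.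
  by apply: cvg_expr; rewrite ger0_norm.
apply/cvgrPdist_le => e e0.
have e3 : 0 < e / 3 by rewrite divr_gt0.
have [K _ hK] := (cvgrPdist_le _ _).1 hr _ e3.
have {}hK := hK K (leqnn K); rewrite sub0r normrN in hK.
have hsum : \sum_(k < K) T n k @[n --> \oo] --> \sum_(k < K) T' k.
  by apply: cvg_sum_ord => k; exact: hT'.
near=> n.
have hn : `|S n - \sum_(k < K) T n k| <= e / 3.
  have hTn : forall k, `|T n k| <= C * r ^+ k by near: n.
  have [Sn cSn hSn] := geometric_tail r01 hTn.
  have -> : S n = Sn.
    apply: (cvg_unique _ _ cSn) => //; near: n; exact: hS.
  exact: (le_trans (hSn K) (le_trans (ler_norm _) hK)).
have h2 : `|\sum_(k < K) T' k - \sum_(k < K) T n k| <= e / 3.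
  by near: n; move/cvgrPdist_le : hsum; apply.
have h1 : `|S' - \sum_(k < K) T' k| <= e / 3.
  exact: (le_trans (hS' K) (le_trans (ler_norm _) hK)).
rewrite (_ : S' - S n = (S' - \sum_(k < K) T' k) +
  (\sum_(k < K) T' k - \sum_(k < K) T n k) - (S n - \sum_(k < K) T n k)); last by ring.
apply: (le_trans (ler_normB _ _)); apply: (le_trans (lerD (ler_normD _ _) (lexx _))).
lra.
Unshelve. all: end_near. Qed.

End tannery.

(** * Positivity of the resolvent coefficients and the exponential mixtures *)

Section resolvent.
Variable R : realType.

Lemma rising_le (a : R) n k : 0 <= a <= 1 ->
  rising n (1 + k%:R * a) <= k.+1%:R ^+ n.
Proof.
move=> /andP[a0 a1]; rewrite rising_gauss.
have -> : k.+1%:R ^+ n = \prod_(j < n) k.+1%:R :> R by rewrite prodr_const card_ord.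
apply: ler_prod => j _; rewrite addr_ge0 ?divr_ge0 ?mulr_ge0//=.
rewrite -[leRHS]natr1 [leRHS]addrC lerD2l ler_pdivrMr ?ltr0n//.
by apply: ler_pM => //; rewrite (le_trans a1)// ler1n.
Qed.

(* The sum is the [n]-th Taylor coefficient of [(1 - z)^(a - 1) / ((1 - z)^a + l)], expanded in [l]. *)
Lemma resolvent_poly (a : R) n : 0 <= a <= 1 ->
  exists P : {poly R}, [/\ forall i, 0 <= P`_i, P.[1] = 1 &
    forall l, 0 <= l < 1 ->
    (fun K => \sum_(k < K) (- l) ^+ k * rising n (1 + k%:R * a)) @ \oo
      --> P.[(1 + l)^-1]].
Proof.
move=> a01; have /andP[a0 a1] := a01.
elim/ltn_ind: n => n ih.
have /choice[P hP] : forall m : 'I_n, exists P : {poly R}, [/\ forall i, 0 <= P`_i, P.[1] = 1 &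
    forall l, 0 <= l < 1 ->
    (fun K => \sum_(k < K) (- l) ^+ k * rising m (1 + k%:R * a)) @ \oo
      --> P.[(1 + l)^-1]].
  by move=> m; exact: ih.
have rising1 m : rising m (1 : R) = 1.
  rewrite /rising big1// => j _; rewrite addrC natr1 divff//.
(* Comparing n-th coefficients in [U(z) ((1-z)^a + l) = (1-z)^(a-1)] gives (1 + l) times the n-th
   coefficient of [U] in terms of the earlier ones. The indeterminate stands for 1/(1+l), and
   [rev_ord j] is n - 1 - j. *)
exists ('X * ((rising n (1 - a))%:P + \sum_(j < n) (- rising j.+1 (- a)) *: P (rev_ord j))).
split.
- move=> i; rewrite coefXM; case: ifP => // _.
  rewrite coefD coefC coef_sum addr_ge0//.
    by case: ifP => // _; rewrite rising_ge0// subr_ge0.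
  apply: sumr_ge0 => j _; rewrite coefZ mulr_ge0 ?oppr_ge0 ?risingN_le0//.
  by have [] := hP (rev_ord j).
(* The value 1 of the indeterminate corresponds to l = 0, where [U(z) = 1/(1-z)] has all
   coefficients 1; the check is Vandermonde for [(1-z)^a] and [(1-z)^(-1)]. *)
- rewrite hornerM hornerX mul1r hornerD hornerC horner_sum.
  have P1 m : (P m).[1] = 1 by have [] := hP m.
  under eq_bigr do rewrite hornerZ P1 mulr1.
  rewrite addrC [1 - a]addrC rising_vandermonde big_ord_recl rising0 rising1.
  rewrite [X in _ + (_ + X)](_ : _ = \sum_(i < n) rising i.+1 (- a)); last first.
    by apply: eq_bigr => j _; rewrite rising1 mulr1.
  rewrite mulr1 addrCA -big_split big1 ?addr0// => j _ /=.
  by rewrite addNr.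
- move=> l /andP[l0 l1].
  pose U m K := \sum_(k < K) (- l) ^+ k * rising m (1 + k%:R * a).
  (* Truncated at K, the power series in l satisfies the recursion up to its last term, which tends
     to 0 because l < 1 beats polynomial growth in K. *)
  have E K : (1 + l) * U n K.+1 = rising n (1 - a) +
      \sum_(j < n) (- rising j.+1 (- a)) * U (rev_ord j) K.+1 +
      l * ((- l) ^+ K * rising n (1 + K%:R * a)).
    have E1 : \sum_(j < n.+1) rising j (- a) * U (n - j)%N K.+1 =
        rising n (1 - a) - l * U n K.
      transitivity (\sum_(k < K.+1) (- l) ^+ k * rising n (1 + k%:R * a - a)).
        under eq_bigr do rewrite mulr_sumr.
        rewrite exchange_big /=; apply: eq_bigr => k _.
        rewrite [_ - a]addrC rising_vandermonde mulr_sumr.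
        by apply: eq_bigr => j _; rewrite mulrCA.
      rewrite big_ord_recl /= expr0 mul1r mul0r addr0; congr (_ + _).
      rewrite /U mulr_sumr -sumrN; apply: eq_bigr => k _.
      rewrite exprS /bump /= add1n -natr1.
      rewrite (_ : 1 + (k%:R + 1) * a - a = 1 + k%:R * a); last by ring.
      by ring.
    have E2 : \sum_(j < n.+1) rising j (- a) * U (n - j)%N K.+1 =
        U n K.+1 - \sum_(j < n) (- rising j.+1 (- a)) * U (rev_ord j) K.+1.
      rewrite big_ord_recl rising0 mul1r subn0; congr (_ + _).
      by rewrite -sumrN; apply: eq_bigr => j _; rewrite mulNr opprK.
    have E3 : U n K.+1 = U n K + (- l) ^+ K * rising n (1 + K%:R * a).
      by rewrite /U big_ord_recr.
    move: E1; rewrite E2 => /eqP; rewrite subr_eq => /eqP E1.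
    by rewrite mulrDl mul1r [X in X + _]E1 [X in _ + l * X]E3; ring.
  have b0 : (fun K => l * ((- l) ^+ K * rising n (1 + K%:R * a))) @ \oo --> (0 : R).
    have l01 : 0 <= l < 1 by rewrite l0.
    have [C [r [C0 /andP[r0 r1] h]]] := expn_mul_exp_le n l01.
    rewrite -(mulr0 l); apply: cvgMl_tmp; apply/norm_cvg0P.
    apply: (@squeeze_cvgr _ _ _ _ (cst 0) (fun K => C * r ^+ K)).
    + apply: nearW => K; rewrite normr_ge0/= normrM normrX normrN.
      rewrite (ger0_norm l0) ger0_norm; last by rewrite rising_ge0// addr_ge0// mulr_ge0.
      by apply: le_trans (h K); rewrite ler_wpM2l ?exprn_ge0// rising_le.
    + exact: cvg_cst.
    + rewrite -(mulr0 C); apply: cvgMl_tmp; apply: cvg_expr.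
      by rewrite ger0_norm.
  have l10 : 1 + l != 0 by rewrite gt_eqF// ltr_pwDl.
  rewrite -(cvg_shiftS (U n)).
  rewrite (_ : (fun K => U n K.+1) = fun K => (1 + l)^-1 * (rising n (1 - a) +
      \sum_(j < n) (- rising j.+1 (- a)) * U (rev_ord j) K.+1 +
      l * ((- l) ^+ K * rising n (1 + K%:R * a)))); last first.
    by apply/funext => K; rewrite -E mulKf.
  rewrite hornerM hornerX hornerD hornerC horner_sum.
  apply: cvgMl_tmp; rewrite -[X in _ --> X]addr0; apply: cvgD => //.
  apply: cvgD; first exact: cvg_cst.
  apply: cvg_sum_ord => j; rewrite hornerZ; apply: cvgMl_tmp.
  have [_ _ h] := hP (rev_ord j).
  by have := h l ltac:(by rewrite l0 l1); rewrite -(cvg_shiftS (U (rev_ord j))).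
Qed.

(** The ratio of consecutive terms is at most 1 since [1 + a/(n+1) <= exp(a/(n+1))] and
    [1/(n+1) <= ln((n+1)/n)]. Monotonicity turns a bound at one index into a bound for all later
    ones. *)
Lemma gauss_term_nonincreasing (a : R) n : 0 <= a -> (0 < n)%N ->
  rising n.+1 (1 + a) / n.+1%:R `^ a <= rising n (1 + a) / n%:R `^ a.
Proof.
move=> a0 n0; rewrite !rising_gauss big_ord_recr /=.
have n_gt0 : 0 < n%:R :> R by rewrite ltr0n.
have n1_gt0 : 0 < n.+1%:R :> R by rewrite ltr0n.
rewrite -mulrA ler_wpM2l//.
  by rewrite -rising_gauss rising_ge0// addr_ge0.
rewrite ler_pdivrMr ?powR_gt0// ler_pdivlMl ?powR_gt0//.
rewrite (_ : n.+1%:R `^ a = (n%:R * (n.+1%:R / n%:R)) `^ a); last first.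
  by congr (_ `^ a); field; rewrite gt_eqF.
rewrite powRM ?divr_ge0// ler_wpM2l ?powR_ge0//.
rewrite /powR gt_eqF ?divr_gt0//.
apply: le_trans (expR_ge1Dx _); rewrite lerD2l.
rewrite ler_wpM2l//.
have n1V : n.+1%:R^-1 < 1 :> R by rewrite invf_lt1// ltr1n.
have := @le_ln1Dx R (- n.+1%:R^-1); rewrite ltrN2 => /(_ n1V).
rewrite (_ : 1 - _ = (n.+1%:R / n%:R)^-1); last first.
  by rewrite -!natr1; field; rewrite natr1 !gt_eqF.
by rewrite lnV ?posrE ?divr_gt0// lerN2.
Qed.

(** By Gauss's product the k-th term of the resolvent series behaves like
    [(-l n^a)^k / Gamma(1 + k a)], and [l n^a] tends to s. The weights [P n] and the rates [h n] do
    not depend on s, so the mixture can later be integrated in w with [s = |w|^2]. *)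
Lemma mittag_leffler_exp_mixture (a : R) : 0 < a < 1 ->
  exists (P : nat -> {poly R}) (h : nat -> R),
    [/\ forall n i, 0 <= (P n)`_i, forall n, (P n).[1] = 1,
      forall n, 0 <= h n &
      forall s, 0 <= s ->
        (P n).[expR (- (h n * s))] @[n --> \oo] --> mittag_leffler a (- s)].
Proof.
move=> /andP[a0 a1].
have a01 : 0 <= a <= 1 by rewrite !ltW.
have /choice[P hP] := fun n => resolvent_poly n a01.
pose h n : R := (n%:R `^ a)^-1.
have h0 n : 0 <= h n by rewrite invr_ge0 powR_ge0.
exists P, h; split => //; [by move=> n; have [] := hP n|by move=> n; have [] := hP n|].
move=> s s0.
pose l n := expR (h n * s) - 1.
have l_ge0 n : 0 <= l n by rewrite subr_ge0 -expR0 ler_expR mulr_ge0.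
have cvgh : h n @[n --> \oo] --> 0.
  apply/gtr0_cvgV0; first by near=> n; rewrite powR_gt0// ltr0n; near: n; exists 1%N.
  apply/cvgryPge => A; near=> n.
  have [A0|A0] := leP A 0; first by rewrite (le_trans A0)// powR_ge0.
  have -> : A = (A `^ a^-1) `^ a by rewrite -powRrM mulVf ?gt_eqF// powRr1 ?ltW.
  rewrite ge0_ler_powR ?nnegrE ?powR_ge0// ?ltW//.
  near: n; exact: nbhs_infty_gtr.
have cvge : expR (h n * s) @[n --> \oo] --> (1 : R).
  have -> : (1 : R) = expR (0 * s) by rewrite mul0r expR0.
  apply: (@cvg_comp _ _ _ (fun n => h n * s) (@expR R) _ (nbhs (0 * s))).
    exact: cvgMr_tmp.
  exact: continuous_expR.
have lh n : (0 < n)%N -> s <= l n * n%:R `^ a <= s * expR (h n * s).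
  move=> n0; have p0 : 0 < n%:R `^ a by apply: powR_gt0; rewrite ltr0n.
  have sE : s = h n * s * n%:R `^ a by rewrite mulrAC mulVf ?mul1r// gt_eqF.
  apply/andP; split.
    rewrite [leLHS]sE ler_wpM2r ?(ltW p0)// lerBrDl; exact: expR_ge1Dx.
  rewrite [X in X * expR _]sE mulrAC ler_wpM2r ?(ltW p0)// lerBlDr.
  have : (1 - h n * s) * expR (h n * s) <= 1.
    by rewrite -ler_pdivlMr ?expR_gt0// div1r -expRN; exact: expR_ge1Dx.
  by rewrite mulrBl mul1r lerBlDr addrC.
have cvgl : l n * n%:R `^ a @[n --> \oo] --> s.
  apply: (@squeeze_cvgr _ _ _ _ (cst s) (fun n => s * expR (h n * s))).
  - by near=> n; apply: lh; near: n; exists 1%N.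
  - exact: cvg_cst.
  - by rewrite -[X in _ --> X]mulr1; exact: cvgMl_tmp.
have hcvg : 2 * s * h n @[n --> \oo] --> (0 : R).
  by rewrite -(mulr0 (2 * s)); exact: cvgMl_tmp.
(* Source of the uniform domination: for large n one has [l n * n^a <= 2 s], and the Gauss terms
   decrease from J on. The k-th term is then at most [(2 s h J)^k (k+1)^J], a ratio below 1 against
   a polynomial of fixed degree J. *)
have [J J0 hJ] : exists2 J, (0 < J)%N & 2 * s * h J < 1.
  suff [J [J0 hJ]] : exists J, (0 < J)%N /\ 2 * s * h J < 1 by exists J.
  near \oo => J; exists J; split; first by near: J; exists 1%N.
  by near: J; apply: (cvgr_lt 0).
have x01 : 0 <= 2 * s * h J < 1 by rewrite hJ andbT mulr_ge0// mulr_ge0.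
have [C [r [C0 r01 hC]]] := expn_mul_exp_le J x01.
have hpow n k : (0 < n)%N -> n%:R `^ (k%:R * a) = (n%:R `^ a) ^+ k :> R.
  by move=> n0; rewrite mulrC powRrM powR_mulrn// powR_ge0.
have Tsplit n k : (0 < n)%N -> (- l n) ^+ k * rising n (1 + k%:R * a) =
    (- (l n * n%:R `^ a)) ^+ k * (rising n (1 + k%:R * a) / n%:R `^ (k%:R * a)).
  move=> n0; have p0 : 0 < n%:R `^ a by apply: powR_gt0; rewrite ltr0n.
  rewrite hpow// -mulNr exprMn; field.
  by rewrite expf_neq0// gt_eqF.
have ka0 k : 0 <= k%:R * a by rewrite mulr_ge0// ltW.
rewrite /mittag_leffler.
apply: (@tannery R (fun n k => (- l n) ^+ k * rising n (1 + k%:R * a))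
  (fun k => (- s) ^+ k / Gammaf (1 + k%:R * a))
  (fun n => (P n).[expR (- (h n * s))]) C r r01).
- near=> n => k.
  have n0 : (0 < n)%N by near: n; exists 1%N.
  have nJ : (J <= n)%N by near: n; exists J.
  rewrite Tsplit// normrM normrX normrN.
  have hmono : rising n (1 + k%:R * a) / n%:R `^ (k%:R * a) <=
      rising J (1 + k%:R * a) / J%:R `^ (k%:R * a).
    rewrite -(subnK nJ); elim: (n - J)%N => [|m ih]; first by rewrite add0n.
    apply: le_trans ih; rewrite addSn.
    by apply: gauss_term_nonincreasing; rewrite // ltn_addl.
  rewrite (@ger0_norm _ (_ / _)); last first.
    by rewrite divr_ge0 ?powR_ge0// rising_ge0// addr_ge0.
  apply: (@le_trans _ _ ((2 * s) ^+ k * (rising J (1 + k%:R * a) / J%:R `^ (k%:R * a)))).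
    apply: ler_pM => //.
      by rewrite divr_ge0 ?powR_ge0// rising_ge0// addr_ge0.
    rewrite lerXn2r ?nnegrE ?normr_ge0 ?mulr_ge0//.
    rewrite ger0_norm ?mulr_ge0 ?powR_ge0//.
    have /andP[_] := lh n n0; move=> /le_trans; apply.
    rewrite mulrC ler_wpM2r//; near: n.
    by apply: (cvgr_le 1) => //; rewrite ltr1n.
  rewrite hpow//; apply: le_trans (hC k).
  rewrite [(_ * h J) ^+ k]exprMn [h J ^+ k](exprVn (J%:R `^ a) k) -mulrA.
  rewrite ler_wpM2l ?exprn_ge0 ?mulr_ge0//.
  rewrite mulrC ler_wpM2l ?invr_ge0 ?exprn_ge0 ?powR_ge0//.
  exact: rising_le.
- move=> k.
  have hg := cvg_gauss_product (ka0 k).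
  have h1 : (- (l n * n%:R `^ a)) ^+ k @[n --> \oo] --> (- s) ^+ k.
    apply: (@cvg_comp _ _ _ (fun n => - (l n * n%:R `^ a)) (fun x : R => x ^+ k) _ (nbhs (- s))).
      exact: cvgN.
    exact: exprn_continuous.
  apply: cvg_trans (cvgM h1 hg); apply: near_eq_cvg; near=> n.
  rewrite Tsplit; last by near: n; exists 1%N.
  by rewrite /= rising_gauss.
(* The expansion in l requires l < 1, that is [exp(h n * s) < 2], which holds for large n. *)
- near=> n; have [_ _] := hP n; move=> /(_ (l n)).
  rewrite (_ : (1 + l n)^-1 = expR (- (h n * s))); last first.
    by rewrite /l addrC subrK expRN.
  apply; rewrite l_ge0 /= /l ltrBlDr.
  by near: n; apply: (cvgr_lt 1) => //; rewrite ltrDl.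
Unshelve. all: end_near. Qed.

End resolvent.

(** * Fourier transforms of Gaussians *)

Section gaussian.
Variable R : realType.
Local Notation leb := (@lebesgue_measure R).

Definition gaussian (s w : R) : R := expR (- (s * w ^+ 2)).

Lemma gaussian_ge0 s w : 0 <= gaussian s w. Proof. exact: expR_ge0. Qed.

Lemma measurable_gaussian s : measurable_fun [set: R] (gaussian s).
Proof.
apply: measurableT_comp => //; apply: measurableT_comp => //.
by apply: measurable_funM => //; exact: measurable_funX.
Qed.

Lemma gaussian_normal (s : R) : 0 < s -> exists2 sg : R, sg != 0 &
  gaussian s = (fun w => Num.sqrt (pi / s) * normal_pdf 0 sg w).
Proof.
move=> s0; pose sg := Num.sqrt ((2 * s)^-1).
have p0 : 0 < (2 * s)^-1 by rewrite invr_gt0 mulr_gt0.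
have sg0 : sg != 0 by rewrite gt_eqF// sqrtr_gt0.
have sg2 : sg ^+ 2 = (2 * s)^-1 by rewrite sqr_sqrtr// ltW.
exists sg => //; apply/funext => w.
rewrite normal_pdfE// /normal_peak /normal_fun sg2 subr0.
have -> : (2 * s)^-1 * pi *+ 2 = pi / s.
  by rewrite -mulr_natr; field; rewrite gt_eqF.
rewrite mulrA divff ?mul1r; last by rewrite gt_eqF// sqrtr_gt0 divr_gt0// pi_gt0.
by rewrite /gaussian; congr expR; rewrite -mulr_natr; field; rewrite gt_eqF.
Qed.

Lemma integrable_gaussian (s : R) : 0 < s -> leb.-integrable setT (EFin \o gaussian s).
Proof.
move=> /gaussian_normal[sg sg0 ->].
have := integrableZl measurableT (Num.sqrt (pi / s)) (@integrable_normal_pdf R 0 sg).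
exact.
Qed.

Lemma integral_gaussian (s : R) : 0 < s ->
  (\int[leb]_w (gaussian s w)%:E = (Num.sqrt (pi / s))%:E)%E.
Proof.
move=> /gaussian_normal[sg sg0 ->].
under eq_integral do rewrite EFinM.
rewrite integralZl//; last exact: integrable_normal_pdf.
by rewrite integral_normal_pdf mule1.
Qed.

Lemma norm_mul_gaussian_le (s w : R) : 0 < s ->
  `|w| * gaussian s w <= (1 + 2 / s) * gaussian (s / 2) w.
Proof.
move=> s0.
have -> : gaussian s w = gaussian (s / 2) w * gaussian (s / 2) w.
  by rewrite /gaussian -expRD; congr expR; field.
rewrite mulrA ler_wpM2r ?gaussian_ge0//.
rewrite /gaussian expRN ler_pdivrMr ?expR_gt0//.
have h := expR_ge1Dx (s / 2 * w ^+ 2).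
apply: (@le_trans _ _ ((1 + 2 / s) * (1 + s / 2 * w ^+ 2))); last first.
  by rewrite ler_wpM2l// addr_ge0// divr_ge0// ltW.
have -> : (1 + 2 / s) * (1 + s / 2 * w ^+ 2) =
    1 + w ^+ 2 + (s / 2 * w ^+ 2 + 2 / s) by field; rewrite gt_eqF.
apply: (@le_trans _ _ (1 + w ^+ 2)); last first.
  have s1 : 0 <= s / 2 * w ^+ 2 by rewrite mulr_ge0 ?sqr_ge0// divr_ge0// ltW.
  have s2 : 0 <= 2 / s by rewrite divr_ge0// ltW.
  by rewrite lerDl addr_ge0.
rewrite -(real_normK (num_real w)); have := normr_ge0 w; nra.
Qed.

Lemma integrable_gaussian_mul (s : R) (f : R -> R) (C D : R) : 0 < s ->
  measurable_fun [set: R] f -> (forall w, `|f w| <= C + D * `|w|) -> 0 <= C -> 0 <= D ->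
  leb.-integrable setT (EFin \o (fun w => gaussian s w * f w)).
Proof.
move=> s0 mf fb C0 D0.
have s20 : 0 < s / 2 by rewrite divr_gt0.
have i1 := integrableZl measurableT C (integrable_gaussian s0).
have i2 := integrableZl measurableT (D * (1 + 2 / s)) (integrable_gaussian s20).
apply: le_integrable (integrableD _ i1 i2) => //.
  by apply/measurable_EFinP; apply: measurable_funM => //; exact: measurable_gaussian.
move=> w _; rewrite [X in (_ <= `|X|)%E](_ : _ =
  (C * gaussian s w + D * (1 + 2 / s) * gaussian (s / 2) w)%:E)//= lee_fin.
have g0 := gaussian_ge0 s w.
rewrite normrM (ger0_norm g0).
apply: le_trans (ler_norm _).
apply: (@le_trans _ _ (gaussian s w * (C + D * `|w|))); first by rewrite ler_wpM2l.
rewrite mulrDr mulrC lerD2l mulrCA -mulrA ler_wpM2l// mulrC.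
exact: norm_mul_gaussian_le.
Qed.

Lemma FTC_T (f F : R -> R) : continuous f ->
  (forall x : R, is_derive x 1 F (f x)) ->
  F n.+1%:R @[n --> \oo] --> (0 : R) -> F (- n.+1%:R) @[n --> \oo] --> (0 : R) ->
  leb.-integrable setT (EFin \o f) -> (\int[leb]_x (f x)%:E = 0)%E.
Proof.
move=> cf dF Fb Fa intf.
rewrite (@FTC_exhaustion R setT (fun n => - n.+1%:R) (fun n => n.+1%:R) f F 0 0) ?subrr//.
- by move=> n; rewrite (@lt_trans _ _ 0)// oppr_lt0.
- move=> x _; near=> n.
  rewrite -ler_norml; near: n.
  have : (n.+1%:R : R) @[n --> \oo] --> +oo.
    by have := @cvgr_idn R; rewrite -(cvg_shiftS).
  by move=> /cvgryPge; exact.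
- by move=> x _; exact: cf.
- exact: continuous_measurable_fun.
Unshelve. all: end_near. Qed.

Variable s : R.
Hypothesis s0 : 0 < s.

Lemma gaussian_bounded_vanish (f : R -> R) (a : nat -> R) :
  (forall x, `|f x| <= 1) -> (forall n, n.+1%:R <= `|a n|) ->
  gaussian s (a n) * f (a n) @[n --> \oo] --> (0 : R).
Proof.
move=> f1 an; apply/norm_cvg0P.
apply: (@squeeze_cvgr _ _ _ _ (cst 0) (fun n => s^-1 * n.+1%:R^-1)).
- apply: nearW => n; rewrite normr_ge0/= normrM ger0_norm ?gaussian_ge0//.
  apply: (@le_trans _ _ (gaussian s (a n))); first by rewrite ler_piMr ?gaussian_ge0.
  rewrite /gaussian expRN -invfM lef_pV2 ?posrE ?expR_gt0 ?mulr_gt0//.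
  apply: le_trans (le_trans _ (expR_ge1Dx _)); last by [].
  apply: (@le_trans _ _ (s * a n ^+ 2)); last by rewrite lerDr.
  rewrite ler_wpM2l ?(ltW s0)//; apply: (le_trans (an n)).
  rewrite -(real_normK (num_real (a n))) expr2 ler_peMl//.
  by apply: le_trans (an n); rewrite ler1n.
- exact: cvg_cst.
- rewrite -(mulr0 s^-1); apply: cvgMl_tmp; exact: cvg_harmonic.
Qed.

Let I (th x : R) := (\int[leb]_w (gaussian s w * cos (w * x + th)))%R.

Let affine_measurable (x th : R) (h : R -> R) : continuous h ->
  measurable_fun [set: R] (fun w : R => h (w * x + th)).
Proof.
move=> ch; apply: measurableT_comp; first exact: continuous_measurable_fun.
by apply: measurable_funD => //; apply: measurable_funM.
Qed.

Lemma integrable_gaussian_cos (x th : R) :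
  leb.-integrable setT (EFin \o (fun w => gaussian s w * cos (w * x + th))).
Proof.
apply: (@integrable_gaussian_mul s _ 1 0) => //.
- by apply: affine_measurable; exact: continuous_cos.
- by move=> w; rewrite mul0r addr0 cos_max.
Qed.

Lemma integrable_gaussian_mul_sin (x th : R) :
  leb.-integrable setT (EFin \o (fun w => gaussian s w * (w * sin (w * x + th)))).
Proof.
apply: (@integrable_gaussian_mul s _ 0 1) => //.
- apply: measurable_funM => //; apply: affine_measurable; exact: continuous_sin.
- by move=> w; rewrite add0r mul1r normrM ler_piMr// sin_max.
Qed.

(** The derivative in w of [gaussian s w * sin (w * x + th)] integrates to 0 over the line. *)
Lemma gaussian_parts (x th : R) :
  (\int[leb]_w (gaussian s w * (w * sin (w * x + th))) =
   x / (2 * s) * \int[leb]_w (gaussian s w * cos (w * x + th)))%R.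
Proof.
have i1 := integrable_gaussian_mul_sin x th.
have i2 := integrable_gaussian_cos x th.
pose f w := x * (gaussian s w * cos (w * x + th)) - 2 * s * (gaussian s w * (w * sin (w * x + th))).
have cont_aff (h : R -> R) : continuous h -> continuous (fun w : R => h (w * x + th)).
  move=> ch w; apply: continuous_comp; last exact: ch.
  by apply: continuousD; [apply: continuousM => //; exact: cst_continuous|exact: cst_continuous].
have cg : continuous (gaussian s).
  move=> w; apply: continuous_comp; last exact: continuous_expR.
  apply: continuousN; apply: continuousM; first exact: cst_continuous.
  exact: exprn_continuous.
have cf w : {for w, continuous f}.
  apply: continuousB; apply: continuousM; try exact: cst_continuous.
    by apply: continuousM; [exact: cg|apply: cont_aff; exact: continuous_cos].
  apply: continuousM; first exact: cg.
  by apply: continuousM => //; apply: cont_aff; exact: continuous_sin.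
have i1' := integrableZl measurableT (2 * s) i1.
have i2' := integrableZl measurableT x i2.
have h : (\int[leb]_w (f w)%:E = 0)%E.
  apply: (@FTC_T f (fun w => gaussian s w * sin (w * x + th))).
  - by move=> w; exact: cf.
  - move=> w; rewrite /gaussian; apply: is_derive_eq.
    by rewrite /GRing.scale /= /f /gaussian; ring.
  - apply: (@gaussian_bounded_vanish (fun w => sin (w * x + th)) (fun n => n.+1%:R)).
      by move=> w; exact: sin_max.
    by move=> n; rewrite ler_norm.
  - apply: (@gaussian_bounded_vanish (fun w => sin (w * x + th)) (fun n => - n.+1%:R)).
      by move=> w; exact: sin_max.
    by move=> n; rewrite normrN ler_norm.
  - exact: (integrableB measurableT i2' i1').
have h2 : (\int[leb]_w f w)%R = 0 by rewrite /Rintegral h.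
move: h2; rewrite /f RintegralB; [|exact: measurableT|exact: i2'|exact: i1'].
rewrite !RintegralZl// => /eqP; rewrite subr_eq0 => /eqP h2.
apply: (@mulfI _ (2 * s)); first by rewrite mulf_neq0// gt_eqF.
by rewrite -h2; field; rewrite gt_eqF.
Qed.

(** Differentiation under the integral, dominated by [|w|] times the Gaussian; the resulting sine
    integral goes back to [I] by parts. *)
Let dI (th x : R) : is_derive x 1 (I th) (- (x / (2 * s)) * I th x).
Proof.
pose f (x w : R) := gaussian s w * cos (w * x + th).
have dfx (y w : R) : is_derive y 1 (f^~ w) (- (gaussian s w * (w * sin (w * y + th)))).
  by apply: is_derive_eq; rewrite /GRing.scale /=; ring.
have Ix : x \in `]x - 1, x + 1[ by rewrite in_itv/=; apply/andP; split; lra.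
have p1E y w : partial1of2 f y w = - (gaussian s w * (w * sin (w * y + th))).
  by rewrite partial1of2E; have := dfx y w => /@derive_val.
pose Gw w : R := `|w| * gaussian s w.
have G0 w : 0 <= Gw w by rewrite mulr_ge0 ?gaussian_ge0.
have iG : leb.-integrable setT (EFin \o Gw).
  rewrite /Gw; under eq_fun do rewrite mulrC.
  apply: (@integrable_gaussian_mul s _ 0 1) => //.
  by move=> w; rewrite normr_id add0r mul1r.
have int_f y : `]x - 1, x + 1[%classic y -> leb.-integrable setT (EFin \o f y).
  by move=> _; exact: integrable_gaussian_cos.
have der1 y w : `]x - 1, x + 1[%classic y -> setT w -> derivable (f^~ w) y 1.
  by move=> _ _; have := dfx y w.
have Gub y w : `]x - 1, x + 1[%classic y -> setT w -> `|partial1of2 f y w| <= Gw w.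
  move=> _ _; rewrite p1E normrN !normrM (ger0_norm (gaussian_ge0 _ _)) /Gw mulrC.
  by rewrite ler_wpM2r ?gaussian_ge0// ler_piMr// sin_max.
have D := @derivable_under_integral R _ _ leb f setT measurableT x (x - 1) (x + 1)
  Ix int_f der1 Gw G0 iG Gub.
have E := @differentiation_under_integral R _ _ leb f setT measurableT x (x - 1) (x + 1)
  Ix int_f der1 Gw G0 iG Gub.
apply: DeriveDef; first exact: D.
rewrite -derive1E E.
under eq_Rintegral do rewrite p1E.
rewrite -mulN1r.
under eq_Rintegral do rewrite -mulN1r.
rewrite RintegralZl//; last exact: integrable_gaussian_mul_sin.
by rewrite gaussian_parts mulrA !mulN1r.
Qed.

(** By [dI], the function [I th x * exp(x^2 / (4 s))] is constant in x, and its value is found at x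
    = 0. The phase th is kept because it lets the transform be iterated over coordinates with real
    cosines only. *)
Lemma gaussian_cos_transform (th x : R) :
  (\int[leb]_w (gaussian s w * cos (w * x + th))%:E =
   (Num.sqrt (pi / s) * expR (- (x ^+ 2 / (4 * s))) * cos th)%:E)%E.
Proof.
have fn : (\int[leb]_w (gaussian s w * cos (w * x + th))%:E)%E \is a fin_num.
  exact: (integrable_fin_num _ (integrable_gaussian_cos x th)).
rewrite -(fineK fn) -/(Rintegral _ _ _) -/(I th x); congr EFin.
pose H x := I th x * expR (x ^+ 2 / (4 * s)).
have dH (y : R) : is_derive y 1 H 0.
  have := dI th y => dIy; apply: is_derive_eq.
  by rewrite /GRing.scale /=; field; rewrite gt_eqF.
have := @is_derive_0_is_cst R H x 0 dH.
rewrite /H expr0n /= mul0r expR0 mulr1.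
have -> : I th 0 = Num.sqrt (pi / s) * cos th.
  rewrite /I; under eq_Rintegral do rewrite mulr0 add0r.
  rewrite RintegralZr//; last exact: integrable_gaussian.
  by rewrite /Rintegral integral_gaussian.
move=> E; rewrite mulrAC -E expRN mulfK//.
by rewrite gt_eqF// expR_gt0.
Qed.

End gaussian.

Section gaussian_tuple.
Variable R : realType.
Local Notation leb := (@lebesgue_measure R).
Local Notation muN := (@muN R).

Lemma integral_muN0 (f : 0.-tuple R -> \bar R) :
  measurable_fun [set: 0.-tuple R] f -> (\int[muN 0]_z f z = f [tuple])%E.
Proof. by move=> mf; rewrite /= integral_dirac// diracT mul1e. Qed.

Lemma tdot_cons n (x y : R) (t u : n.-tuple R) :
  tdot [tuple of x :: t] [tuple of y :: u] = x * y + tdot t u.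
Proof.
rewrite /tdot big_ord_recl !tnth0; congr (_ + _).
by apply: eq_bigr => i _; rewrite !tnthS.
Qed.

Lemma tdot_ge0 n (x : n.-tuple R) : 0 <= tdot x x.
Proof. by apply: sumr_ge0 => i _; rewrite -expr2 sqr_ge0. Qed.

Lemma tnorm_ge0 n (x : n.-tuple R) : 0 <= tnorm x.
Proof. exact: sqrtr_ge0. Qed.

Lemma sqr_tnorm n (x : n.-tuple R) : tnorm x ^+ 2 = tdot x x.
Proof. by rewrite sqr_sqrtr// tdot_ge0. Qed.

Lemma measurable_tdot n (x : n.-tuple R) :
  measurable_fun [set: n.-tuple R] (fun w => tdot w x).
Proof.
apply: measurable_sum => i; apply: measurable_funM => //.
exact: measurable_tnth.
Qed.

Lemma measurable_tdotxx n : measurable_fun [set: n.-tuple R] (fun w : n.-tuple R => tdot w w).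
Proof.
by apply: measurable_sum => i; apply: measurable_funM; exact: measurable_tnth.
Qed.

Lemma measurable_tnorm n : measurable_fun [set: n.-tuple R] (@tnorm R n).
Proof.
apply: (@measurableT_comp _ _ _ _ _ _ (@Num.sqrt R)); last exact: measurable_tdotxx.
by apply: continuous_measurable_fun; exact: sqrt_continuous.
Qed.

Definition gaussianN n (s : R) (w : n.-tuple R) : R := expR (- (s * tdot w w)).

Lemma gaussianN_ge0 n s (w : n.-tuple R) : 0 <= gaussianN s w.
Proof. exact: expR_ge0. Qed.

Lemma gaussianN_prod n s (w : n.-tuple R) :
  gaussianN s w = \prod_(i < n) gaussian s (tnth w i).
Proof.
rewrite /gaussianN /tdot mulr_sumr -sumrN expR_sum.
by apply: eq_bigr => i _; rewrite /gaussian expr2.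
Qed.

Lemma gaussianN_cons n s (x : R) (t : n.-tuple R) :
  gaussianN s [tuple of x :: t] = gaussian s x * gaussianN s t.
Proof. by rewrite /gaussianN tdot_cons mulrDr opprD expRD /gaussian expr2. Qed.

Lemma measurable_gaussianN n s : measurable_fun [set: n.-tuple R] (@gaussianN n s).
Proof.
apply: measurableT_comp => //; apply: measurableT_comp => //.
by apply: measurable_funM => //; exact: measurable_tdotxx.
Qed.

Variable s : R.
Hypothesis s0 : 0 < s.

Lemma integrable_gaussianN n (f : n.-tuple R -> R) :
  measurable_fun [set: n.-tuple R] f -> (forall w, `|f w| <= 1) ->
  (muN n).-integrable setT (EFin \o (fun w => gaussianN s w * f w)).
Proof.
move=> mf f1; apply/integrableP; split.
  by apply/measurable_EFinP; apply: measurable_funM => //; exact: measurable_gaussianN.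
apply: (@le_lt_trans _ _ (\int[muN n]_w (gaussianN s w)%:E)%E).
  apply: ge0_le_integral => //.
  - apply: measurableT_comp => //; apply/measurable_EFinP.
    by apply: measurable_funM => //; exact: measurable_gaussianN.
  - by apply/measurable_EFinP; exact: measurable_gaussianN.
  - move=> w _ /=; rewrite lee_fin normrM ger0_norm ?gaussianN_ge0//.
    by rewrite ler_piMr ?gaussianN_ge0.
under eq_integral do rewrite gaussianN_prod.
rewrite (@ge0_integral_muN_prod R n (fun=> gaussian s) (fun=> Num.sqrt (pi / s))) ?ltry//.
- by move=> _; exact: measurable_gaussian.
- by move=> _ x; exact: gaussian_ge0.
- by move=> _; exact: integral_gaussian.
Qed.

Lemma gaussianN_cos_transform n (x : n.-tuple R) (th : R) :
  (\int[muN n]_w (gaussianN s w * cos (tdot w x + th))%:E =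
   (Num.sqrt (pi / s) ^+ n * expR (- (tdot x x / (4 * s))) * cos th)%:E)%E.
Proof.
have mcos m (y : m.-tuple R) t :
    measurable_fun [set: m.-tuple R] (fun w => cos (tdot w y + t)).
  apply: (@measurableT_comp _ _ _ _ _ _ (@cos R)).
    by apply: continuous_measurable_fun; exact: continuous_cos.
  by apply: measurable_funD => //; exact: measurable_tdot.
elim: n x th => [|n ih] x th.
  rewrite integral_muN0; last first.
    by apply/measurable_EFinP; apply: measurable_funM; [exact: measurable_gaussianN|exact: mcos].
  rewrite /gaussianN /tdot !big_ord0.
  by rewrite mulr0 mul0r oppr0 expR0 expr0 !mul1r add0r.
case/tupleP: x => x1 x.
rewrite integrable_muNS; last first.
  by apply: integrable_gaussianN => // w; exact: cos_max.
pose K := Num.sqrt (pi / s) ^+ n * expR (- (tdot x x / (4 * s))).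
(* For the inner integral the contribution [w * x1] of the first coordinate is just part of the
   phase, so the induction hypothesis applies with phase [w * x1 + th]. *)
transitivity (\int[leb]_w (K%:E * (gaussian s w * cos (w * x1 + th))%:E))%E.
  apply: eq_integral => w _.
  transitivity (\int[muN n]_t ((gaussian s w)%:E * (gaussianN s t * cos (tdot t x + (w * x1 + th)))%:E))%E.
    apply: eq_integral => t _; rewrite gaussianN_cons tdot_cons -EFinM -mulrA.
    by congr (_ * (_ * cos _))%:E; ring.
  rewrite integralZl//; last first.
    by apply: integrable_gaussianN => // t; exact: cos_max.
  by rewrite ih -/K -!EFinM; congr EFin; ring.
rewrite integralZl//; last exact: integrable_gaussian_cos.
rewrite gaussian_cos_transform// -EFinM; congr EFin.
have -> : - (tdot [tuple of x1 :: x] [tuple of x1 :: x] / (4 * s)) =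
    - (x1 ^+ 2 / (4 * s)) - tdot x x / (4 * s).
  by rewrite tdot_cons mulrDl opprD expr2.
rewrite expRD [_ ^+ n.+1]exprS /K.
by move: (Num.sqrt _) (expR (- (x1 ^+ 2 / _))) (expR _) (cos th) => c a b d; ring.
Qed.

End gaussian_tuple.

Section heat_kernel_bound.
Variable R : realType.

(** The heat kernel at time s multiplied by [(2 pi)^n], a normalization that makes it exactly the
    Fourier transform of [gaussianN s]. *)
Definition heat_kernel n (s : R) (x : n.-tuple R) : R :=
  Num.sqrt (pi / s) ^+ n * expR (- (tdot x x / (4 * s))).

(** With [y = |x|^2 / (4 s)] the kernel is [(4 pi)^(n/2) y^(n/2) exp(-y) |x|^(-n)], and
    [y^(n/2) exp(-y)] is bounded. The uniformity in s is what lets the bound pass to mixtures. *)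
Lemma heat_kernel_le n : exists2 C : R, 0 < C &
  forall (s : R) (x : n.-tuple R), 0 < s -> 0 < tnorm x ->
    heat_kernel s x <= C / tnorm x ^+ n.
Proof.
have C0 : 0 < n`!%:R * expR 1 :> R by rewrite mulr_gt0 ?expR_gt0// ltr0n fact_gt0.
have C1 : 0 < Num.sqrt (4 * pi) ^+ n :> R.
  by apply: exprn_gt0; rewrite sqrtr_gt0 mulr_gt0// pi_gt0.
exists (Num.sqrt (4 * pi) ^+ n * (n`!%:R * expR 1)); first exact: mulr_gt0.
move=> s x s0 x0; rewrite /heat_kernel -sqr_tnorm.
set r := tnorm x in x0 *.
pose y := r ^+ 2 / (4 * s).
have y0 : 0 <= y by rewrite divr_ge0 ?sqr_ge0// mulr_ge0// ltW.
have -> : Num.sqrt (pi / s) = Num.sqrt (4 * pi) * (Num.sqrt y / r).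
  have rE : r = Num.sqrt (r ^+ 2) by rewrite sqrtr_sqr ger0_norm ?ltW.
  have s4 : 0 <= (4 * s)^-1 by rewrite invr_ge0 mulr_ge0// ltW.
  rewrite {1}rE -sqrtrV ?sqr_ge0// -!sqrtrM ?mulr_ge0 ?pi_ge0 ?(ltW x0)//.
  by congr Num.sqrt; rewrite /y; field; rewrite !gt_eqF.
rewrite exprMn expr_div_n -/y -!mulrA ler_wpM2l ?exprn_ge0//.
rewrite mulrCA [leRHS]mulrA [leRHS]mulrC ler_wpM2l ?invr_ge0 ?exprn_ge0 ?(ltW x0)//.
rewrite expRN ler_pdivrMr ?expR_gt0// -mulrA -expRD.
apply: (@le_trans _ _ ((1 + y) ^+ n)).
  apply: lerXn2r; rewrite ?nnegrE ?sqrtr_ge0 ?addr_ge0//.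
  have := sqr_sqrtr y0; have := sqrtr_ge0 y; nra.
have := @expR_ge1Dxn R (1 + y) n.-1.
case: n {C0 C1 x r x0 y y0} => [|n] in C0 C1 x r x0 y y0 *.
  by move=> _; rewrite expr0 fact0 mul1r -expR0 ler_expR addr_ge0.
rewrite addr_ge0//= => /(_ isT) h.
rewrite -ler_pdivrMl ?ltr0n ?fact_gt0// mulrC; apply: le_trans h.
by rewrite lerDr.
Qed.

End heat_kernel_bound.

(** * The pointwise bound on the profile *)

Section tuple_measure_facts.
Variable R : realType.
Local Notation leb := (@lebesgue_measure R).
Local Notation muN := (@muN R).

Lemma measurable_set1_tuple n (a : n.-tuple R) : measurable [set a].
Proof.
rewrite (_ : [set a] = \bigcap_(i in [set: 'I_n]) ((fun z : n.-tuple R => tnth z i) @^-1` [set tnth a i])).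
  apply: fin_bigcap_measurable; first exact: finite_finset.
  move=> i _; rewrite -[X in measurable X]setTI.
  exact: measurable_tnth.
apply/seteqP; split => [z ->//|z h].
by apply: eq_from_tnth => i; exact: h.
Qed.

Lemma muN_set1 n (a : n.+1.-tuple R) : muN n.+1 [set a] = 0%E.
Proof.
have -> : muN n.+1 [set a] = (\int[muN n.+1]_(z in [set a]) 1)%E.
  by rewrite integral_cst ?mul1e//; exact: measurable_set1_tuple.
rewrite integral_mkcond.
transitivity (\int[muN n.+1]_z (\prod_(i < n.+1) \1_[set tnth a i] (tnth z i))%:E)%E.
  apply: eq_integral => z _; rewrite patchE; case: ifPn => [/set_mem ->|].
    by rewrite big1// => i _; rewrite indicE mem_set.
  move=> za; apply/esym/eqP; rewrite eqe; apply/prodf_eq0.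
  have : exists i, tnth z i != tnth a i.
    apply: contrapT => h; move/negP : za; apply; apply/mem_set/eq_from_tnth => i.
    by apply/eqP/negPn/negP => zi; apply: h; exists i.
  by move=> [i zi]; exists i => //; rewrite indicE memNset//; exact/eqP.
rewrite (@ge0_integral_muN_prod R n.+1 (fun i => \1_[set tnth a i]) (fun=> 0)).
- by rewrite big_ord_recl mul0r.
- by move=> i; exact: measurable_indic.
- by move=> i x; rewrite indicE.
- by move=> i; rewrite integral_indic// setIT; exact: lebesgue_measure_set1.
Qed.

(** Points are null in positive dimension. This allows replacing the profile, whose sign at the
    origin is unknown, by its positive part. *)
Lemma eq_integral_off1 n (a : n.+1.-tuple R) (f g : n.+1.-tuple R -> \bar R) :
  measurable_fun [set: n.+1.-tuple R] f -> measurable_fun [set: n.+1.-tuple R] g ->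
  (forall x, x != a -> f x = g x) -> (\int[muN n.+1]_x f x = \int[muN n.+1]_x g x)%E.
Proof.
move=> mf mg fg; apply: ae_eq_integral => //.
exists [set a]; split; [exact: measurable_set1_tuple|exact: muN_set1|].
move=> x /= h; apply: contrapT => xa; apply: h => _; apply: fg; exact/eqP.
Qed.

Lemma RintN_integral n (f : n.-tuple R -> R) :
  (muN n).-integrable setT (EFin \o f) -> (RintN f)%:E = (\int[muN n]_x (f x)%:E)%E.
Proof.
move=> fi; have mf := measurable_int _ fi.
have mf' : measurable_fun [set: n.-tuple R] f by exact/measurable_EFinP.
rewrite /RintN intN_integral; last 2 first.
- by apply/measurable_EFinP; exact: measurable_maxr.
- by move=> x; rewrite lee_fin le_max lexx orbT.
rewrite intN_integral; last 2 first.
- by apply/measurable_EFinP; apply: measurable_maxr => //; exact: measurableT_comp.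
- by move=> x; rewrite lee_fin le_max lexx orbT.
rewrite [RHS]integralE EFinB.
have ip := integrable_fin_num measurableT (integrable_funepos measurableT fi).
have im := integrable_fin_num measurableT (integrable_funeneg measurableT fi).
have Ep : (\int[muN n]_x (Num.max (f x) 0)%:E = \int[muN n]_x ((EFin \o f)^\+ x))%E.
  by apply: eq_integral => x _; rewrite funeposE /= -EFin_max.
have Em : (\int[muN n]_x (Num.max (- f x) 0)%:E = \int[muN n]_x ((EFin \o f)^\- x))%E.
  by apply: eq_integral => x _; rewrite funenegE /= -EFin_max.
by rewrite Ep Em !fineK.
Qed.

Lemma tdot_tsub n (w x y : n.-tuple R) : tdot w (tsub x y) = tdot w x - tdot w y.
Proof.
rewrite /tdot -sumrB; apply: eq_bigr => i _.
by rewrite tnth_mktuple mulrBr.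
Qed.

Lemma tnorm_eq0 n (x : n.-tuple R) : (tnorm x == 0) = (x == [tuple of nseq n 0]).
Proof.
rewrite sqrtr_eq0 le_eqVlt ltNge tdot_ge0 orbF.
apply/eqP/eqP => [/eqP|->].
  rewrite psumr_eq0 => [/allP h|i _]; last by rewrite -expr2 sqr_ge0.
  apply: eq_from_tnth => i; have := h i (mem_index_enum _).
  rewrite /= mulf_eq0 orbb => /eqP ->.
  by rewrite (tnth_nth 0) /= nth_nseq ltn_ord.
rewrite /tdot big1// => i _.
by rewrite (tnth_nth 0) /= nth_nseq ltn_ord mul0r.
Qed.

Lemma tnorm_gt0 n (x : n.-tuple R) : (0 < tnorm x) = (x != [tuple of nseq n 0]).
Proof. by rewrite lt0r tnorm_ge0 andbT tnorm_eq0. Qed.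

Lemma tnth_tnorm n (x : n.-tuple R) i : `|tnth x i| <= tnorm x.
Proof.
rewrite -sqrtr_sqr ler_wsqrtr// /tdot (bigD1 i)//= expr2 lerDl.
by apply: sumr_ge0 => j _; rewrite -expr2 sqr_ge0.
Qed.

Lemma tdotxx_le n (x : n.-tuple R) d : (forall i, `|tnth x i| <= d) ->
  tdot x x <= n%:R * d ^+ 2.
Proof.
move=> h; apply: (@le_trans _ _ (\sum_(i < n) d ^+ 2)).
  apply: ler_sum => i _; rewrite -expr2 -(real_normK (num_real (tnth x i))).
  by rewrite lerXn2r ?nnegrE// (le_trans _ (h i)).
by rewrite sumr_const card_ord mulr_natl.
Qed.

Lemma measurable_tdot2 n :
  measurable_fun [set: n.-tuple R * n.-tuple R] (fun z => tdot z.1 z.2).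
Proof.
apply: measurable_sum => i; apply: measurable_funM.
  by apply: (measurableT_comp (measurable_tnth i)).
by apply: (measurableT_comp (measurable_tnth i)).
Qed.

End tuple_measure_facts.

(** * Pairing a function with a heat kernel on the Fourier side *)

Section multiplication_formula.
Variables (R : realType) (n : nat) (F : n.-tuple R -> R) (E : n.-tuple R -> R).
Local Notation mu := (@muN R n).
Hypothesis iF : mu.-integrable setT (EFin \o F).
Hypothesis FTc : forall w, (\int[mu]_x (F x * cos (tdot w x))%:E = (E w)%:E)%E.
Hypothesis FTs : forall w, (\int[mu]_x (F x * sin (tdot w x))%:E = 0)%E.

Let mF : measurable_fun [set: n.-tuple R] F.
Proof. by apply/measurable_EFinP; exact: measurable_int iF. Qed.

Let integrable_Fb (h : n.-tuple R -> R) : measurable_fun [set: n.-tuple R] h ->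
  (forall x, `|h x| <= 1) -> mu.-integrable setT (EFin \o (fun x => F x * h x)).
Proof.
move=> mh h1; apply: le_integrable iF => //.
  by apply/measurable_EFinP; exact: measurable_funM.
by move=> x _ /=; rewrite lee_fin normrM ler_piMr.
Qed.

Let mtrig (h : R -> R) w : continuous h ->
  measurable_fun [set: n.-tuple R] (fun x => h (tdot w x)).
Proof.
move=> ch; apply: (@measurableT_comp _ _ _ _ _ _ h).
  exact: continuous_measurable_fun.
rewrite (_ : tdot w = fun x => tdot x w); first exact: measurable_tdot.
by apply/funext => x; apply: eq_bigr => i _; rewrite mulrC.
Qed.

(** Fubini for [F x * gaussianN s w * cos <w, x - x0>]: integrating in w first gives the heat kernel
    centred at x0, integrating in x first gives the transform of F. The sine half of the addition
    formula drops out by [FTs]. *)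
Lemma multiplication_formula (s : R) (x0 : n.-tuple R) : 0 < s ->
  (\int[mu]_x (F x * heat_kernel s (tsub x x0))%:E =
   \int[mu]_w (gaussianN s w * (E w * cos (tdot w x0)))%:E)%E.
Proof.
move=> s0.
pose f (z : n.-tuple R * n.-tuple R) : \bar R :=
  (F z.1 * (gaussianN s z.2 * cos (tdot z.2 (tsub z.1 x0))))%:E.
have mf : measurable_fun [set: n.-tuple R * n.-tuple R] f.
  apply/measurable_EFinP; apply: measurable_funM.
    exact: measurableT_comp.
  apply: measurable_funM.
    by apply: (measurableT_comp (measurable_gaussianN _)).
  apply: (@measurableT_comp _ _ _ _ _ _ (@cos R)).
    by apply: continuous_measurable_fun; exact: continuous_cos.
  under eq_fun do rewrite tdot_tsub.
  apply: measurable_funB.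
    rewrite (_ : (fun x => _) = fun z => tdot z.1 z.2); first exact: measurable_tdot2.
    by apply/funext => z; apply: eq_bigr => i _; rewrite mulrC.
  exact: (measurableT_comp (measurable_tdot x0)).
have gi : mu.-integrable setT (EFin \o gaussianN s).
  have : mu.-integrable setT (EFin \o (fun w => gaussianN s w * 1)).
    by apply: integrable_gaussianN => // _; rewrite normr1.
  by under eq_fun do rewrite mulr1.
have gfin := integrable_fin_num measurableT gi.
have fi : (mu \x mu)%E.-integrable setT f.
  apply: (proj2 (@integrable12ltyP _ _ _ _ R mu mu f mf)).
  apply: (@le_lt_trans _ _ (\int[mu]_x (`|(F x)%:E| * \int[mu]_w (gaussianN s w)%:E))%E).
    apply: ge0_le_integral => //.
    - by move=> x _; exact: integral_ge0.
    - apply: (measurable_fun_fubini_tonelli_F (fun z => `|f z|%E)) => //.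
      exact: measurableT_comp.
    - apply: emeasurable_funM => //; apply: measurableT_comp => //.
      exact/measurable_EFinP.
    - move=> x _; rewrite -ge0_integralZl//; last 2 first.
      + by apply/measurable_EFinP; exact: measurable_gaussianN.
      + by move=> w _; rewrite lee_fin gaussianN_ge0.
      apply: ge0_le_integral => //.
      + apply: measurableT_comp => //.
        exact: (measurableT_comp mf (measurable_pair1 x)).
      + apply: emeasurable_funM => //; apply/measurable_EFinP; exact: measurable_gaussianN.
      + move=> w _; rewrite /f /= lee_fin !normrM ler_wpM2l//.
        by rewrite (ger0_norm (gaussianN_ge0 _ _)) ler_piMr ?gaussianN_ge0// cos_max.
  rewrite ge0_integralZr//; last 2 first.
  - by apply: measurableT_comp => //; exact/measurable_EFinP.
  - by apply: integral_ge0 => w _; rewrite lee_fin gaussianN_ge0.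
  have /integrableP[_ h] := iF; apply: lte_mul_pinfty.
  - exact: integral_ge0.
  - by rewrite ge0_fin_numE// integral_ge0.
  - by rewrite ltey_eq gfin.
have := Fubini fi; rewrite /f /=.
rewrite (_ : (\int[mu]_x \int[mu]_y _)%E = (\int[mu]_x (F x * heat_kernel s (tsub x x0))%:E)%E); last first.
  apply: eq_integral => x _; under eq_integral do rewrite EFinM.
  rewrite integralZl//; last first.
    apply: integrable_gaussianN => //; last by move=> w; exact: cos_max.
    apply: (@measurableT_comp _ _ _ _ _ _ (@cos R)).
      by apply: continuous_measurable_fun; exact: continuous_cos.
    exact: measurable_tdot.
  under eq_integral do rewrite -[tdot _ _]addr0.
  by rewrite gaussianN_cos_transform// cos0 mulr1.
move=> ->; apply: eq_integral => w _.
have mc := mtrig w (@continuous_cos R).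
have ms := mtrig w (@continuous_sin R).
have ic := integrable_Fb mc (fun x => cos_max _).
have is_ := integrable_Fb ms (fun x => sin_max _).
transitivity (\int[mu]_x ((gaussianN s w * cos (tdot w x0))%:E * (F x * cos (tdot w x))%:E +
  (gaussianN s w * sin (tdot w x0))%:E * (F x * sin (tdot w x))%:E))%E.
  apply: eq_integral => x _; rewrite -!EFinM -EFinD; congr EFin.
  by rewrite tdot_tsub cosB; ring.
rewrite integralD//; [|exact: integrableZl|exact: integrableZl].
rewrite !integralZl// FTc FTs mule0 adde0 -EFinM; congr EFin; ring.
Qed.

End multiplication_formula.

Section profile_bound.
Variables (R : realType) (n : nat) (F : n.+1.-tuple R -> R) (alpha : R).
Local Notation N := n.+1.
Local Notation mu := (@muN R N).
Local Notation leb := (@lebesgue_measure R).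
Hypothesis alpha01 : 0 < alpha < 1.
Hypothesis mF : measurable_fun [set: N.-tuple R] F.
Hypothesis F_gt0 : forall x, x != [tuple of nseq N 0] -> 0 < F x.
Hypothesis F_cont : forall x, x != [tuple of nseq N 0] -> forall e, 0 < e ->
     exists2 d, 0 < d & forall y, tnorm (tsub y x) < d -> `|F y - F x| < e.
Hypothesis F1 : RintN F = 1.
Hypothesis FT : forall w : N.-tuple R,
  RintN (fun x => F x * cos (tdot w x)) = mittag_leffler alpha (- (tnorm w ^+ 2)) /\
  RintN (fun x => F x * sin (tdot w x)) = 0.

Let Fp x := Num.max (F x) 0.
Let mFp : measurable_fun [set: N.-tuple R] Fp.
Proof. exact: measurable_maxr. Qed.
Let Fp_ge0 x : 0 <= Fp x. Proof. by rewrite le_max lexx orbT. Qed.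
Let FpE x : x != [tuple of nseq N 0] -> F x = Fp x.
Proof. by move=> /F_gt0 Fx; rewrite /Fp max_l// ltW. Qed.

(** Integrability is hidden in [RintN F = 1]: if the positive part had infinite integral, [fine]
    would send it to 0 and [RintN F] would be at most 0. Off the origin F is its own positive
    part. *)
Lemma integrable_profile : mu.-integrable setT (EFin \o F).
Proof.
have mFE : measurable_fun [set: N.-tuple R] (EFin \o F) by exact/measurable_EFinP.
apply/integrableP; split => //.
rewrite (@eq_integral_off1 R n [tuple of nseq N 0] _ (EFin \o Fp)); last 3 first.
- exact: measurableT_comp.
- exact/measurable_EFinP.
- by move=> x x0; rewrite /= (FpE x0) ger0_norm.
rewrite ltey; apply/eqP => Eoo.
move: F1; rewrite /RintN.
have -> : intN (fun x => (Num.max (F x) 0)%:E) = +oo%E.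
  rewrite intN_integral; [exact: Eoo|exact/measurable_EFinP|].
  by move=> x; rewrite lee_fin; exact: Fp_ge0.
rewrite (_ : fine +oo%E = 0)// sub0r => /eqP; rewrite eq_sym -subr_eq0 opprK gt_eqF//.
apply: ltr_pwDl => //; rewrite fine_ge0// intN_integral.
- by apply: integral_ge0 => x _; rewrite lee_fin le_max lexx orbT.
- by apply/measurable_EFinP; apply: measurable_maxr => //; exact: measurableT_comp.
- by move=> x; rewrite lee_fin le_max lexx orbT.
Qed.

Let iFb (h : N.-tuple R -> R) : measurable_fun [set: N.-tuple R] h ->
  (forall x, `|h x| <= 1) -> mu.-integrable setT (EFin \o (fun x => F x * h x)).
Proof.
move=> mh h1; apply: le_integrable integrable_profile => //.
  by apply/measurable_EFinP; exact: measurable_funM.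
by move=> x _ /=; rewrite lee_fin normrM ler_piMr.
Qed.

(** On the Fourier side the i-th power of [exp(-h |w|^2)] only lengthens the Gaussian time from s to
    s + i h. An approximating mixture thus yields an average of heat kernels at x0 with total weight
    [P(1) = 1], and the uniform heat kernel bound survives both the average and the limit. *)
Lemma profile_gaussian_le : exists2 C, 0 < C & forall (s : R) (x0 : N.-tuple R),
  0 < s -> 0 < tnorm x0 ->
  (\int[mu]_x (F x * heat_kernel s (tsub x x0))%:E <= (C / tnorm x0 ^+ N)%:E)%E.
Proof.
have [C C0 hC] := heat_kernel_le R N.
exists C => // s x0 s0 x00.
have mtrig (h : R -> R) (w : N.-tuple R) : continuous h ->
    measurable_fun [set: N.-tuple R] (fun x => h (tdot w x)).
  move=> ch; apply: (@measurableT_comp _ _ _ _ _ _ h).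
    exact: continuous_measurable_fun.
  rewrite (_ : tdot w = fun x => tdot x w); first exact: measurable_tdot.
  by apply/funext => x; apply: eq_bigr => i _; rewrite mulrC.
rewrite (multiplication_formula (E := fun w => mittag_leffler alpha (- (tnorm w ^+ 2))))//; last 3 first.
- exact: integrable_profile.
- move=> w; have [<- _] := FT w; rewrite RintN_integral//.
  by apply: iFb; [apply: mtrig; exact: continuous_cos|move=> x; exact: cos_max].
- move=> w; have [_ E] := FT w; rewrite -[RHS]/(0%:E) -E RintN_integral//.
  by apply: iFb; [apply: mtrig; exact: continuous_sin|move=> x; exact: sin_max].
have [P [h [P0 P1 h0 hP]]] := mittag_leffler_exp_mixture alpha01.
have mc : measurable_fun [set: N.-tuple R] (fun w => cos (tdot w x0)).
  apply: (@measurableT_comp _ _ _ _ _ _ (@cos R)).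
    by apply: continuous_measurable_fun; exact: continuous_cos.
  exact: measurable_tdot.
pose q k (w : N.-tuple R) : R := expR (- (h k * tnorm w ^+ 2)).
have q01 k (w : N.-tuple R) : 0 <= q k w <= 1.
  by rewrite expR_ge0 -expR0 ler_expR oppr_le0 mulr_ge0// sqr_ge0.
have mq k : measurable_fun [set: N.-tuple R] (q k).
  apply: measurableT_comp => //; apply: measurableT_comp => //.
  by apply: measurable_funM => //; apply: measurable_funX; exact: measurable_tnorm.
(* Nonnegative coefficients summing to 1, evaluated inside [0, 1]: this supplies the Gaussian as
   dominating function for the limit in k. *)
have Pq01 k (w : N.-tuple R) : 0 <= (P k).[q k w] <= 1.
  have /andP[q0 q1] := q01 k w; rewrite horner_coef; apply/andP; split.
    by apply: sumr_ge0 => i _; rewrite mulr_ge0 ?exprn_ge0.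
  rewrite -(P1 k) [leRHS]horner_coef; apply: ler_sum => i _.
  by rewrite expr1n mulr1 ler_piMr// exprn_ile1.
have step k : (\int[mu]_w (gaussianN s w * ((P k).[q k w] * cos (tdot w x0)))%:E <=
    (C / tnorm x0 ^+ N)%:E)%E.
  have E : (\int[mu]_w (gaussianN s w * ((P k).[q k w] * cos (tdot w x0)))%:E =
      (\sum_(i < size (P k)) (P k)`_i * heat_kernel (s + i%:R * h k) x0)%:E)%E.
    have si i : 0 < s + i%:R * h k by rewrite ltr_pwDl// mulr_ge0.
    transitivity (\int[mu]_w (\sum_(i < size (P k))
        ((P k)`_i)%:E * (gaussianN (s + i%:R * h k) w * cos (tdot w x0 + 0))%:E))%E.
      apply: eq_integral => w _; rewrite addr0 horner_coef.
      under [RHS]eq_bigr do rewrite -EFinM.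
      rewrite sumEFin; congr EFin; rewrite mulr_suml mulr_sumr; apply: eq_bigr => i _.
      rewrite /q -expRM_natl /gaussianN -sqr_tnorm.
      rewrite (_ : - ((s + i%:R * h k) * tnorm w ^+ 2) =
        - (s * tnorm w ^+ 2) + i%:R * - (h k * tnorm w ^+ 2)); last by ring.
      by rewrite expRD; ring.
    rewrite integral_sum//; last first.
      move=> i; apply: integrableZl => //.
      apply: integrable_gaussianN => //; last by move=> w; exact: cos_max.
      by under eq_fun do rewrite addr0.
    rewrite -sumEFin; apply: eq_bigr => i _.
    rewrite integralZl//; last first.
      apply: integrable_gaussianN => //; last by move=> w; exact: cos_max.
      by under eq_fun do rewrite addr0.
    by rewrite gaussianN_cos_transform// cos0 mulr1 -EFinM.
  rewrite E lee_fin.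
  apply: (@le_trans _ _ (\sum_(i < size (P k)) (P k)`_i * (C / tnorm x0 ^+ N))).
    apply: ler_sum => i _; rewrite ler_wpM2l// hC//.
    by rewrite ltr_pwDl// mulr_ge0.
  rewrite -mulr_suml; have := P1 k; rewrite horner_coef.
  by under eq_bigr do rewrite expr1n mulr1; move=> ->; rewrite mul1r.
have gi : mu.-integrable setT (EFin \o gaussianN s).
  have : mu.-integrable setT (EFin \o (fun w => gaussianN s w * 1)).
    by apply: integrable_gaussianN => // _; rewrite normr1.
  by under eq_fun do rewrite mulr1.
have lim : (fun k => \int[mu]_w (gaussianN s w * ((P k).[q k w] * cos (tdot w x0)))%:E)%E @ \oo -->
   (\int[mu]_w (gaussianN s w * (mittag_leffler alpha (- (tnorm w ^+ 2)) * cos (tdot w x0)))%:E)%E.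
  apply: (@dominated_cvg_on _ _ _ mu setT
    (fun k w => (gaussianN s w * ((P k).[q k w] * cos (tdot w x0)))%:E) _ (EFin \o gaussianN s)) => //.
  - move=> k; apply/measurable_EFinP; apply: measurable_funM; first exact: measurable_gaussianN.
    apply: measurable_funM => //.
    under eq_fun do rewrite horner_coef.
    apply: measurable_sum => i; apply: measurable_funM => //.
    exact: measurable_funX.
  - move=> w _; apply: cvg_EFin; first exact: nearW.
    apply: cvgMl_tmp; apply: cvgMr_tmp; apply: hP; exact: sqr_ge0.
  - move=> k w _ /=; rewrite lee_fin normrM ger0_norm ?gaussianN_ge0//.
    rewrite ler_piMr ?gaussianN_ge0// normrM mulr_ile1 ?cos_max//.
    by have /andP[? ?] := Pq01 k w; rewrite ger0_norm.
by apply: (cvge_to_le lim); apply: nearW => k; exact: step.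
Qed.

(** Removal of the Gaussian: on a cube of half-side r about x0, F is at least half its value at x0
    and the heat kernel at time [r^2/4] is of order [r^(-N)]. The volume [(2r)^N] cancels r, so the
    loss is the factor c, independent of x0. *)
Lemma profile_le : exists2 C, 0 < C &
  forall x, 0 < tnorm x -> F x <= C / tnorm x ^+ N.
Proof.
have [C C0 hC] := profile_gaussian_le.
pose c : R := (2 * Num.sqrt (4 * pi)) ^+ N * expR (- N%:R).
have c0 : 0 < c.
  by rewrite mulr_gt0 ?expR_gt0// exprn_gt0// mulr_gt0// sqrtr_gt0 mulr_gt0// pi_gt0.
exists (2 * C / c); first by rewrite divr_gt0// mulr_gt0.
move=> x0 x00.
have x0n : x0 != [tuple of nseq N 0] by rewrite -tnorm_gt0.
have Fx0 := F_gt0 x0n.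
have [d d0 hd] := F_cont x0n (divr_gt0 Fx0 (ltr0n R 2)).
(* The diagonal half-length of the cube is at most [sqrt(N) r], which is below [(N + 1) r = d], so
   the cube lies in the ball of continuity. *)
have [r r0 dE] : exists2 r, 0 < r & d = r * N.+1%:R.
  by exists (d / N.+1%:R); rewrite ?divr_gt0// mulfVK// pnatr_eq0.
(* With [4 s = r^2] the Gaussian exponent on the cube is at least -N, and [sqrt(pi / s) * 2 r] is
   the pure constant [2 sqrt(4 pi)]. *)
pose s := r ^+ 2 / 4.
have s0 : 0 < s by rewrite divr_gt0// exprn_gt0.
have := hC s x0 s0 x00.
pose J i : R -> R := \1_(`]tnth x0 i - r, tnth x0 i + r[%classic).
pose K0 := Num.sqrt (pi / s) ^+ N * expR (- N%:R).
have K00 : 0 <= K0 by rewrite mulr_ge0 ?exprn_ge0 ?expR_ge0.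
have cube (y : N.-tuple R) : (forall i, `|tnth y i - tnth x0 i| < r) ->
    F x0 / 2 <= Fp y /\ K0 <= heat_kernel s (tsub y x0).
  move=> hy.
  have hdot : tdot (tsub y x0) (tsub y x0) <= N%:R * r ^+ 2.
    by apply: tdotxx_le => i; rewrite tnth_mktuple ltW.
  split.
    have : tnorm (tsub y x0) < d.
      rewrite -(ltr_pXn2r (n := 2)) ?nnegrE ?tnorm_ge0 ?(ltW d0)// sqr_tnorm.
      apply: (le_lt_trans hdot).
      rewrite dE.
      have hN : N%:R < N.+1%:R ^+ 2 :> R.
        by rewrite -natrX ltr_nat (leq_trans (ltnSn _))// -[X in (X <= _)%N]expn1 leq_exp2l.
      have r20 : 0 < r ^+ 2 by rewrite exprn_gt0.
      by rewrite exprMn (mulrC (r ^+ 2)) (ltr_pM2r r20).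
    move=> /hd /ltW; rewrite ler_distl => /andP[h _].
    by rewrite le_max; apply/orP; left; lra.
  rewrite /heat_kernel ler_wpM2l ?exprn_ge0// ler_expR lerN2.
  rewrite ler_pdivrMr ?mulr_gt0//; apply: (le_trans hdot).
  by rewrite /s le_eqVlt; apply/orP; left; apply/eqP; field.
have h1 : ((F x0 / 2 * K0 * (2 * r) ^+ N)%:E <=
    \int[mu]_x (F x * heat_kernel s (tsub x x0))%:E)%E.
  have mJ i : measurable_fun [set: R] (J i) by exact: measurable_indic.
  have mH : measurable_fun [set: N.-tuple R] (fun x => heat_kernel s (tsub x x0)).
    rewrite /heat_kernel; apply: measurable_funM => //.
    apply: measurableT_comp => //; apply: measurableT_comp => //.
    apply: measurable_funM => //; apply: measurable_sum => i.
    under eq_fun do rewrite tnth_mktuple.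
    by apply: measurable_funM; apply: measurable_funB => //; exact: measurable_tnth.
  have H0 x : 0 <= heat_kernel s (tsub x x0).
    by rewrite mulr_ge0 ?exprn_ge0 ?expR_ge0.
  rewrite (@eq_integral_off1 R n [tuple of nseq N 0] _ (fun x => (Fp x * heat_kernel s (tsub x x0))%:E)); last 3 first.
  - by apply/measurable_EFinP; exact: measurable_funM.
  - by apply/measurable_EFinP; exact: measurable_funM.
  - by move=> x x0'; rewrite (FpE x0').
  have -> : ((F x0 / 2 * K0 * (2 * r) ^+ N)%:E =
      \int[mu]_z ((F x0 / 2 * K0)%:E * (\prod_(i < N) J i (tnth z i))%:E))%E.
    rewrite ge0_integralZl//; last 3 first.
    - apply/measurable_EFinP; apply: measurable_prod => i _.
      by apply: measurableT_comp => //; exact: measurable_tnth.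
    - by move=> z _; rewrite lee_fin prodr_ge0// => i _; rewrite /J indicE.
    - by rewrite lee_fin mulr_ge0// divr_ge0// ltW.
    rewrite (@ge0_integral_muN_prod R N J (fun=> 2 * r))//.
    - by rewrite -EFinM prodr_const card_ord.
    - move=> i; rewrite /J integral_indic// setIT [LHS]lebesgue_measure_itv/= lte_fin.
      rewrite ltrD2l (lt_trans (y := 0)) ?oppr_lt0// -EFinD.
      by congr EFin; ring.
  apply: ge0_le_integral => //.
  - move=> z _; rewrite -EFinM lee_fin mulr_ge0//; first by rewrite mulr_ge0// divr_ge0// ltW.
    by rewrite prodr_ge0// => i _; rewrite /J indicE.
  - apply: emeasurable_funM => //; apply/measurable_EFinP; apply: measurable_prod => i _.
    by apply: measurableT_comp => //; exact: measurable_tnth.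
  - by apply/measurable_EFinP; exact: measurable_funM.
  - move=> z _; rewrite -EFinM lee_fin.
    have [hz|] := pselect (forall i, `|tnth z i - tnth x0 i| < r).
      have [h2 h3] := cube z hz.
      rewrite big1 ?mulr1; last first.
        move=> i _; rewrite /J indicE mem_set//= in_itv/=.
        by have := hz i; rewrite ltr_distl.
      by apply: ler_pM => //; rewrite divr_ge0// ltW.
    move=> /existsNP[i hi].
    rewrite (bigD1 i)//= /J indicE memNset ?mul0r ?mulr0 ?mulr_ge0//.
    by rewrite /= in_itv/= -ltr_distl.
move=> /(le_trans h1); rewrite lee_fin.
have -> : F x0 / 2 * K0 * (2 * r) ^+ N = F x0 / 2 * c.
  rewrite /K0 /c -!mulrA; congr (_ * (_ * _)).
  have -> : pi / s = 4 * pi / r ^+ 2 by rewrite /s; field; rewrite gt_eqF.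
  rewrite sqrtrM ?mulr_ge0 ?pi_ge0// sqrtrV ?sqr_ge0// sqrtr_sqr ger0_norm ?(ltW r0)//.
  have -> : 2 * Num.sqrt (4 * pi) = Num.sqrt (4 * pi) / r * (2 * r).
    by field; rewrite gt_eqF.
  by rewrite [in RHS]exprMn -mulrA [expR _ * _]mulrC.
move=> h2; rewrite -(ler_pM2r c0).
have -> : 2 * C / c / tnorm x0 ^+ N * c = 2 * (C / tnorm x0 ^+ N).
  by field; rewrite (gt_eqF c0) expf_neq0// gt_eqF.
lra.
Qed.

End profile_bound.

(** * The Newtonian kernel *)

Section euclidean.
Variables (R : realType) (n : nat).
Implicit Types x y : n.-tuple R.

Lemma tnth_nseq0 i : tnth [tuple of nseq n (0 : R)] i = 0.
Proof. by rewrite (tnth_nth 0) /= nth_nseq ltn_ord. Qed.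

Lemma tdotC x y : tdot x y = tdot y x.
Proof. by apply: eq_bigr => i _; rewrite mulrC. Qed.

(** For e = 1 and e = -1 the squares [(|y| x_i + e |x| y_i)^2] sum to
    [2 |x| |y| (|x| |y| + e <x, y>)]. *)
Lemma cauchy_schwarz x y : `|tdot x y| <= tnorm x * tnorm y.
Proof.
have a0 := tnorm_ge0 x; have b0 := tnorm_ge0 y.
have [ab0|ab0] := eqVneq (tnorm x * tnorm y) 0.
  have zero (u v : n.-tuple R) : tnorm u = 0 -> tdot u v = 0.
    move=> /eqP; rewrite tnorm_eq0 => /eqP ->; rewrite /tdot big1// => i _.
    by rewrite (tnth_nth 0) /= nth_nseq ltn_ord mul0r.
  have -> : tdot x y = 0.
    move/eqP : ab0; rewrite mulf_eq0 => /orP[/eqP /zero ->//|/eqP /zero h].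
    by rewrite tdotC h.
  by rewrite normr0 mulr_ge0.
have ab : 0 < tnorm x * tnorm y by rewrite lt0r ab0 mulr_ge0.
have key e : e ^+ 2 = 1 -> 0 <= 2 * (tnorm x * tnorm y) * (tnorm x * tnorm y + e * tdot x y).
  move=> e2.
  have : 0 <= \sum_(i < n) (tnorm y * tnth x i + e * tnorm x * tnth y i) ^+ 2.
    by apply: sumr_ge0 => i _; exact: sqr_ge0.
  suff -> : \sum_(i < n) (tnorm y * tnth x i + e * tnorm x * tnth y i) ^+ 2 =
    2 * (tnorm x * tnorm y) * (tnorm x * tnorm y + e * tdot x y) by [].
  transitivity (tnorm y ^+ 2 * tdot x x + e ^+ 2 * tnorm x ^+ 2 * tdot y y +
      2 * e * tnorm x * tnorm y * tdot x y).
    rewrite /tdot !mulr_sumr -!big_split; apply: eq_bigr => i _ /=; ring.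
  rewrite e2 -!sqr_tnorm; ring.
have h1 := key 1 (expr1n _ _).
have h2 := key (-1) ltac:(by rewrite sqrrN expr1n).
have P : 0 < 2 * (tnorm x * tnorm y) by rewrite mulr_gt0.
rewrite (pmulr_rge0 _ P) in h1; rewrite (pmulr_rge0 _ P) in h2.
rewrite ler_norml; apply/andP; split; lra.
Qed.

Lemma sqr_tnorm_tsub x y :
  tnorm (tsub x y) ^+ 2 = tnorm x ^+ 2 + tnorm y ^+ 2 - 2 * tdot x y.
Proof.
rewrite !sqr_tnorm /tdot mulr_sumr -sumrN -!big_split; apply: eq_bigr => i _ /=.
by rewrite tnth_mktuple; ring.
Qed.

Lemma tnorm_tsub_le x y : tnorm (tsub x y) <= tnorm x + tnorm y.
Proof.
have := tnorm_ge0 x; have := tnorm_ge0 y => b0 a0.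
rewrite -(ler_pXn2r (n := 2)) ?nnegrE ?addr_ge0 ?tnorm_ge0// sqr_tnorm_tsub.
have := cauchy_schwarz x y; rewrite ler_norml => /andP[h _].
rewrite sqrrD -[X in _ <= _ + X + _]mulr_natl; lra.
Qed.

Lemma tnorm_tsubC x y : tnorm (tsub x y) = tnorm (tsub y x).
Proof.
rewrite /tnorm; congr Num.sqrt; apply: eq_bigr => i _.
by rewrite !tnth_mktuple -mulrNN !opprB.
Qed.

Lemma tnorm_le_tsub x y : tnorm x <= tnorm (tsub x y) + tnorm y.
Proof.
have a0 := tnorm_ge0 x; have b0 := tnorm_ge0 y; have c0 := tnorm_ge0 (tsub x y).
rewrite -(ler_pXn2r (n := 2)) ?nnegrE ?addr_ge0 ?tnorm_ge0//.
have := cauchy_schwarz (tsub x y) y; rewrite ler_norml => /andP[_ h].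
have E := sqr_tnorm_tsub x y.
have h2 : tdot (tsub x y) y = tdot x y - tnorm y ^+ 2.
  by rewrite tdotC tdot_tsub tdotC sqr_tnorm.
rewrite h2 in h; rewrite sqrrD -[X in _ <= _ + X + _]mulr_natl; lra.
Qed.

Lemma tnorm_tscale (c : R) x : 0 <= c -> tnorm (tscale c x) = c * tnorm x.
Proof.
move=> c0; rewrite /tnorm.
have -> : tdot (tscale c x) (tscale c x) = c ^+ 2 * tdot x x.
  by rewrite /tdot mulr_sumr; apply: eq_bigr => i _; rewrite tnth_mktuple; ring.
by rewrite sqrtrM ?sqr_ge0// sqrtr_sqr ger0_norm.
Qed.

Lemma measurable_tsub2 : measurable_fun [set: n.-tuple R * n.-tuple R]
  (fun z => tsub z.1 z.2).
Proof.
apply/measurable_fun_tnthP => i.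
rewrite (_ : _ \o _ = fun z : n.-tuple R * n.-tuple R => tnth z.1 i - tnth z.2 i); last first.
  by apply/funext => z; rewrite /= tnth_mktuple.
apply: measurable_funB.
  by apply: (measurableT_comp (measurable_tnth i)).
by apply: (measurableT_comp (measurable_tnth i)).
Qed.

Lemma measurable_tsubl x : measurable_fun [set: n.-tuple R] (fun y => tsub x y).
Proof. exact: (measurableT_comp measurable_tsub2 (measurable_pair1 x)). Qed.

Lemma measurable_tsubr y : measurable_fun [set: n.-tuple R] (fun x => tsub x y).
Proof. exact: (measurableT_comp measurable_tsub2 (measurable_pair2 y)). Qed.

Lemma measurable_tscale (c : R) : measurable_fun [set: n.-tuple R] (tscale c).
Proof.
apply/measurable_fun_tnthP => i.
rewrite (_ : _ \o _ = fun z : n.-tuple R => c * tnth z i); last first.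
  by apply/funext => z; rewrite /= tnth_mktuple.
by apply: measurable_funM => //; exact: measurable_tnth.
Qed.

End euclidean.

Section off_point.
Variable R : realType.
Local Notation leb := (@lebesgue_measure R).
Local Notation muN := (@muN R).

(** Every slice whose first coordinate differs from that of a is a slice of g. The one exceptional
    slice may have any inner integral, since it is a single point for the outer one. *)
Lemma intN_off1 n (a : n.+1.-tuple R) (f g : n.+1.-tuple R -> \bar R) :
  measurable_fun [set: n.+1.-tuple R] g -> (forall x, 0 <= g x)%E ->
  (forall x, x != a -> f x = g x) -> intN f = (\int[muN n.+1]_x g x)%E.
Proof.
case/tupleP: a => a1 a mg g0 fg.
rewrite ge0_integral_muNS//=.
pose G x := (\int[muN n]_t g [tuple of x :: t])%E.
have mG : measurable_fun [set: measurableTypeR R] G by exact: measurable_integral_cons.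
have FG x : x != a1 -> intN (fun t : n.-tuple R => f [tuple of x :: t]) = G x.
  move=> xa; rewrite /G -intN_integral//; last exact: measurable_cons_slice.
  congr intN; apply/funext => t; apply: fg.
  by apply: contra xa => /eqP/(congr1 (@thead _ _)); rewrite !theadE => ->.
apply: ae_eq_integral => //.
  rewrite -(setUv [set a1]).
  have m1 : measurable [set a1] by [].
  apply/(measurable_funU _ m1 (measurableC m1)); split; first exact: measurable_fun_set1.
  apply: (eq_measurable_fun G); last exact: measurable_funTS.
  by move=> x /set_mem /eqP xa; rewrite FG.
exists [set a1]; split => //; first exact: lebesgue_measure_set1.
move=> x /= h; apply: contrapT => xa; apply: h => _; apply: FG; exact/eqP.
Qed.

End off_point.

(** * Local integrability of powers of the Newtonian kernel *)

Section kernel_integral.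
Variables (R : realType) (n : nat).
Local Notation N := n.+3.
Local Notation leb := (@lebesgue_measure R).
Local Notation mu := (@muN R N).

Lemma ball_volume_le (y : N.-tuple R) (rho : R) : 0 <= rho ->
  (\int[mu]_x (\1_[set x | (tnorm (tsub x y) < rho)%R] x)%:E <= ((2 * rho) ^+ N)%:E)%E.
Proof.
move=> r0.
pose J i : R -> R := \1_(`]tnth y i - rho, tnth y i + rho[%classic).
have mJ i : measurable_fun [set: R] (J i) by exact: measurable_indic.
have E : (\int[mu]_z (\prod_(i < N) J i (tnth z i))%:E = ((2 * rho) ^+ N)%:E)%E.
  rewrite (@ge0_integral_muN_prod R N J (fun=> 2 * rho))//.
  - by rewrite prodr_const card_ord.
  - move=> i; rewrite /J integral_indic// setIT [LHS]lebesgue_measure_itv/= lte_fin.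
    move: r0; rewrite le_eqVlt => /predU1P[<-|r0].
      by rewrite subr0 addr0 ltxx mulr0.
    rewrite ltrD2l (lt_trans (y := 0)) ?oppr_lt0// -EFinD.
    by congr EFin; ring.
rewrite -E; apply: ge0_le_integral => //.
- apply/measurable_EFinP; apply: measurable_indic.
  rewrite -[X in measurable X]setTI.
  have m1 : measurable_fun [set: N.-tuple R] (fun x => tnorm (tsub x y)).
    exact: (measurableT_comp (@measurable_tnorm R N) (measurable_tsubr y)).
  have := m1 measurableT _ (measurable_itv `]-oo, rho[).
  by congr measurable; apply/seteqP; split => x; rewrite /= in_itv.
- apply/measurable_EFinP; apply: measurable_prod => i _.
  by apply: measurableT_comp => //; exact: measurable_tnth.
- move=> x _; rewrite lee_fin indicE; case: (boolP (x \in _)) => [/set_mem /= h|_].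
    rewrite big1// => i _; rewrite /J indicE mem_set//= in_itv/= -ltr_distl.
    by apply: le_lt_trans h; have := tnth_tnorm (tsub x y) i; rewrite tnth_mktuple.
  by apply: prodr_ge0 => i _; rewrite /J indicE.
Qed.

(** The sign e = 1 or e = -1 lets one primitive serve both sides of the kink of [|w - y|]. *)
Lemma integral_powR_affine (e b c l u : R) : e ^+ 2 = 1 -> c < 1 -> l < u ->
  (forall w, l <= w <= u -> 0 < e * w + b) ->
  (\int[leb]_(w in `[l, u]) ((e * w + b) `^ (- c))%:E =
   (e * (1 - c)^-1 * (e * u + b) `^ (1 - c) - e * (1 - c)^-1 * (e * l + b) `^ (1 - c))%:E)%E.
Proof.
move=> e2 c1 lu pos.
have dF (w : R) : 0 < e * w + b -> is_derive w 1
    (fun w => e * (1 - c)^-1 * (e * w + b) `^ (1 - c)) ((e * w + b) `^ (- c)).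
  move=> wb; have h := is_derive1_powR (1 - c) wb.
  have h2 : is_derive w 1 (fun w => e * w + b) e.
    by apply: is_derive_eq; rewrite /GRing.scale /=; ring.
  have h3 := @is_derive1_comp R (@powR R ^~ (1 - c)) (fun w => e * w + b) w _ _ h h2.
  have h4 := @is_deriveZ R R R _ (e * (1 - c)^-1) w 1 _ h3.
  apply: (is_derive_eq h4); rewrite /GRing.scale /=.
  have -> : 1 - c - 1 = - c by ring.
  transitivity (e ^+ 2 * ((1 - c)^-1 * (1 - c)) * (e * w + b) `^ (- c)); first by ring.
  by rewrite e2 mulVf ?mul1r// gt_eqF// subr_gt0.
have cF (w : R) : 0 < e * w + b ->
    {for w, continuous (fun w => e * (1 - c)^-1 * (e * w + b) `^ (1 - c))}.
  move=> /dF h; apply: differentiable_continuous; apply/derivable1_diffP.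
  by have := h.
rewrite EFinB.
apply: (@continuous_FTC2 R _ (fun w => e * (1 - c)^-1 * (e * w + b) `^ (1 - c))) => //.
- apply: continuous_in_subspaceT => w; rewrite inE/= in_itv/= => /pos wb.
  apply: (@continuous_comp _ _ _ (fun w => e * w + b) (@powR R ^~ (- c))).
    apply: continuousD; last exact: cst_continuous.
    by apply: continuousM => //; exact: cst_continuous.
  exact: continuous_powR.
- split.
  + move=> w; rewrite in_itv/= => /andP[lw wu].
    by have := dF w (pos w ltac:(by rewrite !ltW)).
  + by apply: cvg_at_right_filter; apply: cF; apply: pos; rewrite lexx ltW.
  + by apply: cvg_at_left_filter; apply: cF; apply: pos; rewrite lexx ltW.
- move=> w; rewrite in_itv/= => /andP[lw wu].
  have := dF w (pos w ltac:(by rewrite !ltW)).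
  by move=> /@derive_val h; rewrite derive1E.
Qed.

(** The shift d keeps the base positive at w = y, so that the primitive is smooth up to there. The
    bound does not involve d, as [rho + d <= 2 rho], and so survives d tending to 0. *)
Lemma integral_powR_shift (c d rho y : R) : 0 <= c < 1 -> 0 < d <= rho ->
  (\int[leb]_w (\1_(`]y - rho, y + rho[%classic) w * (`|w - y| + d) `^ (- c))%:E <=
    (2 * (1 - c)^-1 * (2 * rho) `^ (1 - c))%:E)%E.
Proof.
move=> /andP[c0 c1] /andP[d0 drho].
have rho0 : 0 < rho by apply: lt_le_trans drho.
have c1' : 0 < 1 - c by rewrite subr_gt0.
have mf (e b : R) : measurable_fun [set: R] (fun w => (e * w + b) `^ (- c)).
  apply: (measurableT_comp (measurable_powR (- c))).
  by apply: measurable_funD => //; exact: measurable_funM.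
pose f1 w : \bar R := ((fun w => ((1 * w + (d - y)) `^ (- c))%:E) \_ `[y, y + rho]) w.
pose f2 w : \bar R := ((fun w => ((-1 * w + (d + y)) `^ (- c))%:E) \_ `[y - rho, y]) w.
have m1 : measurable_fun [set: R] f1.
  apply/(measurable_restrictT _ (measurable_itv _)).
  by apply: measurable_funTS; apply/measurable_EFinP; exact: mf.
have m2 : measurable_fun [set: R] f2.
  apply/(measurable_restrictT _ (measurable_itv _)).
  by apply: measurable_funTS; apply/measurable_EFinP; exact: mf.
have f10 w : (0 <= f1 w)%E by rewrite /f1 patchE; case: ifP => // _; rewrite lee_fin powR_ge0.
have f20 w : (0 <= f2 w)%E by rewrite /f2 patchE; case: ifP => // _; rewrite lee_fin powR_ge0.
apply: (@le_trans _ _ (\int[leb]_w (f1 w + f2 w))%E).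
  apply: ge0_le_integral => //.
  - by move=> w _; rewrite lee_fin mulr_ge0 ?powR_ge0.
  - apply/measurable_EFinP; apply: measurable_funM; first exact: measurable_indic.
    apply: (measurableT_comp (measurable_powR (- c))).
    apply: measurable_funD => //; apply: measurableT_comp => //.
    exact: measurable_funB.
  - exact: emeasurable_funD.
  - move=> w _; rewrite indicE; case: (boolP (w \in _)) => [|_]; last first.
      by rewrite mul0r adde_ge0.
    rewrite inE/= in_itv/= => /andP[w1 w2]; rewrite mul1r.
    have [yw|wy] := leP y w.
      apply: (@le_trans _ _ (f1 w)); last by rewrite leeDl.
      rewrite /f1 patchE mem_set; last by rewrite /= in_itv/= yw ltW.
      rewrite ger0_norm ?subr_ge0// lee_fin le_eqVlt; apply/orP; left; apply/eqP.
      by congr (_ `^ _); ring.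
    apply: (@le_trans _ _ (f2 w)); last by rewrite leeDr.
    rewrite /f2 patchE mem_set; last by rewrite /= in_itv/= !ltW.
    rewrite ltr0_norm ?subr_lt0// lee_fin le_eqVlt; apply/orP; left; apply/eqP.
    by congr (_ `^ _); ring.
rewrite ge0_integralD// -!integral_mkcond.
rewrite integral_powR_affine ?expr1n ?ltrDl//; last by move=> w /andP[? _]; lra.
rewrite integral_powR_affine ?sqrrN ?expr1n ?gtrBl//; last by move=> w /andP[_ ?]; lra.
rewrite -EFinD lee_fin.
have -> : 1 * (y + rho) + (d - y) = rho + d by ring.
have -> : 1 * y + (d - y) = d by ring.
have -> : -1 * y + (d + y) = d by ring.
have -> : -1 * (y - rho) + (d + y) = rho + d by ring.
have h : (rho + d) `^ (1 - c) <= (2 * rho) `^ (1 - c).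
  by apply: ge0_ler_powR; rewrite ?nnegrE; lra.
have h2 : 0 <= d `^ (1 - c) by exact: powR_ge0.
have -> : 1 * (1 - c)^-1 * (rho + d) `^ (1 - c) - 1 * (1 - c)^-1 * d `^ (1 - c) +
   (-1 * (1 - c)^-1 * d `^ (1 - c) - -1 * (1 - c)^-1 * (rho + d) `^ (1 - c)) =
   2 * (1 - c)^-1 * ((rho + d) `^ (1 - c) - d `^ (1 - c)) by ring.
rewrite ler_wpM2l ?mulr_ge0 ?invr_ge0 ?(ltW c1')//; lra.
Qed.

(** The exponent [n.+1] is N - 2. At the origin the value is 0, because the inverse of 0 is 0. *)
Definition newton (z : N.-tuple R) : R := (tnorm z ^+ n.+1)^-1.

Lemma newton_ge0 z : 0 <= newton z.
Proof. by rewrite invr_ge0 exprn_ge0// tnorm_ge0. Qed.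

Lemma measurable_newton : measurable_fun [set: N.-tuple R] newton.
Proof.
rewrite /newton (_ : (fun z => _) = fun z : N.-tuple R => (tnorm z ^+ n.+1) `^ (-1)).
  apply: (measurableT_comp (measurable_powR (-1))).
  by apply: measurable_funX; exact: measurable_tnorm.
by apply/funext => z; rewrite powR_inv1// exprn_ge0// tnorm_ge0.
Qed.

Lemma newton_powR z r : 0 < tnorm z -> newton z `^ r = tnorm z `^ (- (n.+1%:R * r)).
Proof.
move=> z0; rewrite /newton -powR_mulrn ?(ltW z0)//.
by rewrite -powRN -powRrM mulNr.
Qed.

Lemma ball_measurable (y : N.-tuple R) rho :
  measurable [set x : N.-tuple R | tnorm (tsub x y) < rho].
Proof.
have m1 : measurable_fun [set: N.-tuple R] (fun x => tnorm (tsub x y)).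
  exact: (measurableT_comp (@measurable_tnorm R N) (measurable_tsubr y)).
have := m1 measurableT _ (measurable_itv `]-oo, rho[).
by rewrite setTI; congr measurable; apply/seteqP; split => x; rewrite /= in_itv.
Qed.

(** A substitute for polar coordinates: since [|z_i| <= |z|], the power [|z|^(-th)] is at most the
    product of the [|z_i|^(-th/N)], and each factor is integrable on a line because th < N. *)
Lemma newton_ball_integral (r : R) : 0 < r -> n.+1%:R * r < N%:R ->
  exists2 C : R, 0 <= C & forall (y : N.-tuple R) rho, 0 < rho ->
  (\int[mu]_x (\1_[set x | (tnorm (tsub x y) < rho)%R] x * newton (tsub x y) `^ r)%:E <=
    (C * rho `^ (N%:R - n.+1%:R * r))%:E)%E.
Proof.
move=> r0 thN; set th := n.+1%:R * r.
have th0 : 0 < th by rewrite mulr_gt0.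
pose c := th / N%:R.
have c01 : 0 <= c < 1 by rewrite divr_ge0 ?(ltW th0)//= ltr_pdivrMr// mul1r.
have c1' : 0 < 1 - c by case/andP : c01 => _; rewrite subr_gt0.
exists ((2 * (1 - c)^-1 * 2 `^ (1 - c)) ^+ N).
  by rewrite exprn_ge0// mulr_ge0 ?powR_ge0// mulr_ge0// invr_ge0 ltW.
move=> y rho rho0.
(* Regularization by a shift decreasing to 0; the singular integral is recovered by monotone
   convergence. *)
pose d k : R := rho / k.+1%:R.
have d0 k : 0 < d k by rewrite divr_gt0.
have drho k : d k <= rho by rewrite ler_pdivrMr// ler_peMr ?(ltW rho0)// ler1n.
pose dist x := tnorm (tsub x y).
have mdist : measurable_fun [set: N.-tuple R] dist.
  exact: (measurableT_comp (@measurable_tnorm R N) (measurable_tsubr y)).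
pose B := [set x : N.-tuple R | dist x < rho] `&` ~` [set y].
have mB : measurable B.
  apply: measurableI; first exact: ball_measurable.
  by apply: measurableC; exact: measurable_set1_tuple.
pose K k x : \bar R := (\1_B x * (dist x + d k) `^ (- th))%:E.
have mK k : measurable_fun [set: N.-tuple R] (K k).
  apply/measurable_EFinP; apply: measurable_funM; first exact: measurable_indic.
  apply: (measurableT_comp (measurable_powR (- th))).
  exact: measurable_funD.
have K0 k x : (0 <= K k x)%E by rewrite lee_fin mulr_ge0 ?powR_ge0.
have dist_pos x : B x -> 0 < dist x.
  move=> [_ /= /eqP xy]; rewrite /dist lt0r tnorm_ge0 andbT tnorm_eq0.
  apply/eqP => h; move/negP: xy; apply; apply/eqP/eq_from_tnth => i.
  have := congr1 (fun t => tnth t i) h.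
  rewrite tnth_mktuple tnth_nseq0 => /eqP.
  by rewrite subr_eq0 => /eqP.
have Kle k : (\int[mu]_x K k x <= ((2 * (1 - c)^-1 * 2 `^ (1 - c)) ^+ N * rho `^ (N%:R - th))%:E)%E.
  pose h i w : R := \1_(`]tnth y i - rho, tnth y i + rho[%classic) w * (`|w - tnth y i| + d k) `^ (- c).
  have h0 i w : 0 <= h i w by rewrite mulr_ge0 ?powR_ge0.
  have mh i : measurable_fun [set: R] (h i).
    apply: measurable_funM; first exact: measurable_indic.
    apply: (measurableT_comp (measurable_powR (- c))).
    apply: measurable_funD => //; apply: measurableT_comp => //.
    exact: measurable_funB.
  pose I0 := 2 * (1 - c)^-1 * (2 * rho) `^ (1 - c).
  have hI i : (\int[leb]_w (h i w)%:E <= I0%:E)%E.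
    by apply: integral_powR_shift => //; rewrite d0 drho.
  have hpos i : (0 <= \int[leb]_w (h i w)%:E)%E by apply: integral_ge0 => w _; rewrite lee_fin.
  have hfin i : (\int[leb]_w (h i w)%:E)%E \is a fin_num.
    by rewrite ge0_fin_numE//; apply: le_lt_trans (hI i) (ltry _).
  pose I i := fine (\int[leb]_w (h i w)%:E)%E.
  have IE i : (\int[leb]_w (h i w)%:E = (I i)%:E)%E by rewrite /I fineK.
  apply: (@le_trans _ _ (\int[mu]_x (\prod_(i < N) h i (tnth x i))%:E)%E).
    apply: ge0_le_integral => //.
    - apply/measurable_EFinP; apply: measurable_prod => i _.
      by apply: measurableT_comp => //; exact: measurable_tnth.
    - move=> x _; rewrite lee_fin indicE; case: (boolP (x \in B)) => [/set_mem Bx|_]; last first.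
        by rewrite mul0r; exact: prodr_ge0.
      have dx := dist_pos x Bx; have [/= xrho _] := Bx.
      have dd : 0 < dist x + d k by rewrite addr_gt0.
      have -> : (dist x + d k) `^ (- th) = \prod_(i < N) (dist x + d k) `^ (- c).
        rewrite prodr_const card_ord -powR_mulrn ?powR_ge0// -powRrM.
        by congr (_ `^ _); rewrite /c mulNr mulfVK// pnatr_eq0.
      rewrite mul1r; apply: ler_prod => i _; rewrite powR_ge0/= /h indicE mem_set; last first.
        rewrite /= in_itv/= -ltr_distl; apply: le_lt_trans xrho.
        by have := tnth_tnorm (tsub x y) i; rewrite tnth_mktuple.
      have wd : 0 < `|tnth x i - tnth y i| + d k by rewrite ltr_wpDl.
      rewrite mul1r !powRN lef_pV2 ?posrE ?powR_gt0//.
      apply: ge0_ler_powR; rewrite ?nnegrE ?(ltW wd) ?(ltW dd)//.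
        by case/andP : c01.
      by rewrite lerD2r; have := tnth_tnorm (tsub x y) i; rewrite tnth_mktuple.
  rewrite (ge0_integral_muN_prod mh h0 IE) lee_fin.
  apply: (@le_trans _ _ (\prod_(i < N) I0)).
    apply: ler_prod => i _; rewrite /I fine_ge0//= -lee_fin fineK//.
  rewrite prodr_const card_ord /I0 powRM// ?(ltW rho0)// mulrA exprMn.
  rewrite -(powR_mulrn N (powR_ge0 rho _)) -powRrM.
  rewrite (_ : (1 - c) * N%:R = N%:R - th)//.
  by rewrite mulrBl mul1r /c mulfVK// pnatr_eq0.
have KE x : K ^~ x @ \oo --> (\1_[set x | (tnorm (tsub x y) < rho)%R] x * newton (tsub x y) `^ r)%:E.
  apply: cvg_EFin; first exact: nearW.
  have [Bx|nBx] := pselect (B x); last first.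
    apply: cvg_near_cst; apply: nearW => k /=; rewrite [in LHS]indicE memNset// mul0r.
    (* At the pole the regularized integrands vanish by the choice of [B], and the limit agrees
       because [newton] is 0 there and r is positive. *)
    have [->|xy] := pselect (x = y).
      have -> : newton (tsub y y) = 0.
        have -> : tsub y y = [tuple of nseq N 0].
          by apply: eq_from_tnth => i; rewrite tnth_mktuple subrr tnth_nseq0.
        rewrite /newton (_ : tnorm _ = 0) ?expr0n ?invr0//.
        by apply/eqP; rewrite tnorm_eq0.
      by rewrite powR0 ?mulr0// gt_eqF.
    by rewrite indicE memNset ?mul0r// => /= h; apply: nBx.
  have [/= xrho _] := Bx; have dx := dist_pos x Bx.
  rewrite newton_powR// [in X in _ --> X]indicE mem_set// mul1r.
  have -> : fine \o K^~ x = fun k => (dist x + d k) `^ (- th).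
    by apply/funext => k; rewrite /= indicE mem_set// mul1r.
  have cd : dist x + d k @[k --> \oo] --> dist x.
    rewrite -[X in _ --> X]addr0; apply: cvgD; first exact: cvg_cst.
    rewrite -(mulr0 rho); apply: cvgMl_tmp; exact: cvg_harmonic.
  apply: (@cvg_comp _ _ _ (fun k => dist x + d k) (@powR R ^~ (- th)) _ (nbhs (dist x))) => //.
  exact: continuous_powR.
have ndK x : {homo K^~ x : a b / (a <= b)%N >-> (a <= b)%E}.
  move=> i j ij; rewrite lee_fin.
  rewrite [in leLHS]indicE [in leRHS]indicE; case: (boolP (x \in B)) => [/set_mem Bx|_]; last by rewrite !mul0r.
  have dx := dist_pos x Bx.
  rewrite !mul1r !powRN lef_pV2 ?posrE ?powR_gt0 ?addr_gt0//.
  apply: ge0_ler_powR; rewrite ?nnegrE ?(ltW th0) ?addr_ge0 ?(ltW dx) ?(ltW (d0 _))//.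
  by rewrite lerD2l ler_wpM2l ?(ltW rho0)// lef_pV2 ?posrE// ler_nat ltnS.
have lim := @cvg_monotone_convergence _ _ _ mu setT measurableT K mK
  (fun k x _ => K0 k x) (fun x _ => @ndK x).
have {}lim : (\int[mu]_x K k x)%E @[k --> \oo] -->
    (\int[mu]_x (\1_[set x | (tnorm (tsub x y) < rho)%R] x * newton (tsub x y) `^ r)%:E)%E.
  rewrite (_ : (\int[mu]_x (\1_[set x | (tnorm (tsub x y) < rho)%R] x * newton (tsub x y) `^ r)%:E)%E =
     (\int[mu]_x limn (K ^~ x))%E)//.
  by apply: eq_integral => x _; apply/esym/cvg_lim => //; exact: KE.
by apply: (cvge_to_le lim); apply: nearW.
Qed.

End kernel_integral.

(** * Newtonian potentials of the far part of the datum *)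

Section potential.
Variables (R : realType) (n : nat).
Local Notation N := n.+3.
Local Notation mu := (@muN R N).
Variable u0 : N.-tuple R -> R.
Hypothesis mu0 : measurable_fun [set: N.-tuple R] u0.
Hypothesis u0_ge0 : forall x, 0 <= u0 x.
Hypothesis u0_fin : (\int[mu]_y (u0 y)%:E < +oo)%E.

Definition far (rho : R) (y : N.-tuple R) : R := \1_[set z : N.-tuple R | rho <= tnorm z] y.

Definition tail (rho : R) : \bar R := (\int[mu]_y (far rho y * u0 y)%:E)%E.

(** The Newtonian potential of the far part is the case r = 1; other powers of the kernel arise when
    Jensen's inequality moves the exponent of the norm inside. *)
Definition potential (rho r : R) (x : N.-tuple R) : \bar R :=
  (\int[mu]_y (far rho y * newton (tsub x y) `^ r * u0 y)%:E)%E.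

Lemma farE rho y : far rho y = (rho <= tnorm y)%R%:R.
Proof.
rewrite /far indicE; congr (_%:R); congr nat_of_bool.
by apply/idP/idP => [/set_mem//|h]; exact/mem_set.
Qed.

Lemma far_ge0 rho y : 0 <= far rho y. Proof. by rewrite farE. Qed.

Lemma measurable_far rho : measurable_fun [set: N.-tuple R] (far rho).
Proof.
apply: measurable_indic.
have := @measurable_tnorm R N measurableT _ (measurable_itv `[rho, +oo[).
by rewrite setTI; congr measurable; apply/seteqP; split => x; rewrite /= in_itv/= andbT.
Qed.

Lemma tail_ge0 rho : (0 <= tail rho)%E.
Proof. by apply: integral_ge0 => y _; rewrite lee_fin mulr_ge0 ?far_ge0. Qed.

Lemma potential_ge0 rho r x : (0 <= potential rho r x)%E.
Proof.
by apply: integral_ge0 => y _; rewrite lee_fin !mulr_ge0 ?far_ge0 ?powR_ge0.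
Qed.

Lemma measurable_potential_integrand rho r :
  measurable_fun [set: N.-tuple R * N.-tuple R]
   (fun z => (far rho z.2 * newton (tsub z.1 z.2) `^ r * u0 z.2)%:E).
Proof.
apply/measurable_EFinP; apply: measurable_funM; last by apply: (measurableT_comp mu0).
apply: measurable_funM; first by apply: (measurableT_comp (measurable_far rho)).
apply: (measurableT_comp (measurable_powR r)).
exact: (measurableT_comp (@measurable_newton R n) (@measurable_tsub2 R N)).
Qed.

Lemma measurable_potential rho r : measurable_fun [set: N.-tuple R] (potential rho r).
Proof.
apply: (@measurable_fun_fubini_tonelli_F _ _ _ _ R mu
  (fun z => (far rho z.2 * newton (tsub z.1 z.2) `^ r * u0 z.2)%:E)).
  exact: measurable_potential_integrand.
by move=> z; rewrite lee_fin !mulr_ge0 ?far_ge0 ?powR_ge0.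
Qed.

Lemma measurable_potential_slice rho r x : measurable_fun [set: N.-tuple R]
   (fun y => (far rho y * newton (tsub x y) `^ r * u0 y)%:E).
Proof. exact: (measurableT_comp (measurable_potential_integrand rho r) (measurable_pair1 x)). Qed.

Lemma measurable_tail_integrand rho :
  measurable_fun [set: N.-tuple R] (fun y => (far rho y * u0 y)%:E).
Proof. by apply/measurable_EFinP; apply: measurable_funM => //; exact: measurable_far. Qed.

Lemma tail_antitone rho rho' : rho <= rho' -> (tail rho' <= tail rho)%E.
Proof.
move=> h; apply: ge0_le_integral => //.
- by move=> y _; rewrite lee_fin mulr_ge0 ?far_ge0.
- exact: measurable_tail_integrand.
- exact: measurable_tail_integrand.
- move=> y _; rewrite lee_fin ler_wpM2r// !farE ler_nat.
  by case: (boolP (rho' <= tnorm y)) => // h'; rewrite (le_trans h h').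
Qed.

Lemma tail_small (e : R) : 0 < e ->
  exists2 rho0 : R, 0 < rho0 & forall rho, rho0 <= rho -> (tail rho <= e%:E)%E.
Proof.
move=> e0.
have iu : mu.-integrable setT (EFin \o u0).
  apply/integrableP; split; first exact/measurable_EFinP.
  by under eq_integral do rewrite /= ger0_norm//.
have lim : (fun k => tail k%:R) @ \oo --> (\int[mu]_y 0)%E.
  apply: (@dominated_cvg_on _ _ _ mu setT
    (fun k y => (far k%:R y * u0 y)%:E) (fun=> 0%E) (EFin \o u0)) => //.
  - by move=> k; exact: measurable_tail_integrand.
  - move=> y _; apply: cvg_near_cst; near=> k.
    rewrite farE leNgt (_ : tnorm y < k%:R) ?mul0r//.
    by near: k; exact: nbhs_infty_gtr.
  - move=> k y _; rewrite /= lee_fin ger0_norm ?mulr_ge0 ?far_ge0//.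
    by rewrite farE ler_piMl// lern1 leq_b1.
rewrite integral0 in lim.
have : \forall k \near \oo, (tail k%:R < e%:E)%E.
  move/fine_cvgP : lim => [hfin] /cvgrPdist_lt /(_ _ e0) hd.
  near=> k; have hk : tail k%:R \is a fin_num by near: k.
  rewrite -(fineK hk) lte_fin.
  have : `|0 - fine (tail k%:R)| < e by near: k.
  by rewrite sub0r normrN ger0_norm// fine_ge0// tail_ge0.
move=> [k _ hk]; exists k.+1%:R => // rho hrho.
apply/ltW; apply: le_lt_trans (hk k.+1 (leqnSn k)).
exact: tail_antitone.
Unshelve. all: end_near. Qed.

(** Split at distance [sig * g] from x. Inside, the decay of the datum gives [u0 <= C1 (gam g)^(-N)]
    and the kernel integrates to [Ck (sig g)^2]; outside, the kernel is at most [(sig g)^(2-N)] and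
    the mass at most tau. Both parts scale as [g^(2-N)]. *)
Lemma potential_sup_le (C1 R0 g gam sig : R) (x : N.-tuple R) :
  (forall y, R0 < tnorm y -> tnorm y ^+ N * u0 y <= C1) -> 0 <= C1 ->
  0 < g -> 0 < gam -> 0 < sig -> R0 < gam * g ->
  forall Ck tau : R, 0 <= Ck -> 0 <= tau ->
  (forall rho : R, 0 < rho -> (\int[mu]_y (\1_[set z | (tnorm (tsub z x) < rho)%R] y * newton (tsub y x) `^ 1)%:E <= (Ck * rho ^+ 2)%:E)%E) ->
  (tail (gam * g) <= tau%:E)%E ->
  (potential (gam * g) 1 x <=
    ((C1 / gam ^+ N * Ck * sig ^+ 2 + tau / sig ^+ n.+1) / g ^+ n.+1)%:E)%E.
Proof.
move=> hC1 C10 g0 gam0 sig0 hR Ck tau Ck0 tau0 hk ht.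
have gg0 : 0 < gam * g by rewrite mulr_gt0.
have sg0 : 0 < sig * g by rewrite mulr_gt0.
pose a := C1 / (gam * g) ^+ N.
pose b := ((sig * g) ^+ n.+1)^-1.
have a0 : 0 <= a by rewrite divr_ge0 ?exprn_ge0 ?(ltW gg0).
have b0 : 0 <= b by rewrite invr_ge0 exprn_ge0 ?(ltW sg0).
pose k y : R := \1_[set z | (tnorm (tsub z x) < sig * g)%R] y * newton (tsub y x) `^ 1.
have k0 y : 0 <= k y by rewrite mulr_ge0 ?powR_ge0.
have mk : measurable_fun [set: N.-tuple R] k.
  apply: measurable_funM; first by apply: measurable_indic; exact: ball_measurable.
  apply: (measurableT_comp (measurable_powR 1)).
  exact: (measurableT_comp (@measurable_newton R n) (measurable_tsubr x)).
apply: (@le_trans _ _ (\int[mu]_y (a%:E * (k y)%:E + b%:E * (far (gam * g) y * u0 y)%:E))%E).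
  apply: ge0_le_integral => //.
  - by move=> y _; rewrite lee_fin !mulr_ge0 ?far_ge0 ?powR_ge0.
  - exact: measurable_potential_slice.
  - apply: emeasurable_funD; apply: emeasurable_funM => //.
      exact/measurable_EFinP.
    exact: measurable_tail_integrand.
  - move=> y _; rewrite -!EFinM -EFinD lee_fin farE.
    have [far_y|_] := leP (gam * g) (tnorm y); last first.
      by rewrite !mul0r mulr0 addr0 mulr_ge0.
    rewrite !mul1r /k indicE.
    have -> : newton (tsub x y) = newton (tsub y x) by rewrite /newton tnorm_tsubC.
    case: (boolP (y \in _)) => [_|/negP hy].
      rewrite mul1r mulrC; apply: (@le_trans _ _ (a * newton (tsub y x) `^ 1)).
        rewrite ler_wpM2r ?powR_ge0// /a ler_pdivlMr ?exprn_gt0//.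
        rewrite mulrC; apply: le_trans (hC1 y (lt_le_trans hR far_y)).
        rewrite ler_wpM2r// lerXn2r ?nnegrE ?tnorm_ge0// ltW//.
      by rewrite lerDl mulr_ge0.
    rewrite mul0r mulr0 add0r ler_wpM2r// powRr1 ?newton_ge0//.
    have hs : sig * g <= tnorm (tsub y x).
      by rewrite leNgt; apply/negP => h; apply: hy; apply/mem_set.
    rewrite /newton /b lef_pV2 ?posrE ?exprn_gt0//; last exact: lt_le_trans hs.
    by apply: lerXn2r; rewrite ?nnegrE ?tnorm_ge0 ?(ltW sg0).
rewrite ge0_integralD//; last 4 first.
- by move=> y _; rewrite -EFinM lee_fin mulr_ge0.
- by apply: emeasurable_funM => //; exact/measurable_EFinP.
- by move=> y _; rewrite -EFinM lee_fin !mulr_ge0 ?far_ge0.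
- by apply: emeasurable_funM => //; exact: measurable_tail_integrand.
rewrite !ge0_integralZl//; last 4 first.
- exact: measurable_tail_integrand.
- by move=> y _; rewrite lee_fin mulr_ge0 ?far_ge0.
- exact/measurable_EFinP.
- by move=> y _; rewrite lee_fin.
apply: (@le_trans _ _ (a%:E * (Ck * (sig * g) ^+ 2)%:E + b%:E * tau%:E)%E).
  by apply: leeD; apply: lee_wpmul2l; rewrite ?lee_fin//; exact: hk.
rewrite -!EFinM -EFinD lee_fin le_eqVlt; apply/orP; left; apply/eqP.
have gN : g ^+ N = g ^+ n.+1 * g ^+ 2 by rewrite -exprD addn2.
rewrite /a /b !exprMn gN.
have := exprn_gt0 N gam0; have := exprn_gt0 n.+1 sig0; have := exprn_gt0 n.+1 g0.
move: (gam ^+ N) (sig ^+ n.+1) (g ^+ n.+1) => ga sg gg gg1 sg1 ga1.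
by field; rewrite !gt_eqF.
Qed.

(** The graph of the r-th power lies above its tangent at c; derived from Young's inequality with
    exponents r and r/(r-1). *)
Lemma young_tangent (r c k : R) : 1 <= r -> 0 < c -> 0 <= k ->
  r * c `^ (r - 1) * k <= k `^ r + (r - 1) * c `^ r.
Proof.
move=> r1 c0 k0; have r0 : 0 < r by lra.
have [->|rn1] := eqVneq r 1.
  by rewrite subrr powRr0 mul0r addr0 !mul1r powRr1.
have r10 : 0 < r - 1 by rewrite subr_gt0 lt_neqAle eq_sym rn1.
have := @conjugate_powR R k (c `^ (r - 1)) r (r / (r - 1)) k0 (powR_ge0 _ _) r0 (divr_gt0 r0 r10).
have -> : r^-1 + (r / (r - 1))^-1 = 1 by field; rewrite !gt_eqF.
move=> /(_ erefl).
have -> : (c `^ (r - 1)) `^ (r / (r - 1)) = c `^ r.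
  by rewrite -powRrM; congr (_ `^ _); field; rewrite gt_eqF.
move=> h; have := ler_wpM2l (ltW r0) h.
have -> : r * (k `^ r / r + c `^ r / (r / (r - 1))) = k `^ r + (r - 1) * c `^ r.
  by field; rewrite !gt_eqF.
by rewrite -mulrA (mulrC k).
Qed.

(* Jensen's inequality for the finite measure [far rho * u0]. *)
Lemma potential_jensen (rho r tau : R) x : 1 <= r -> 0 < tau ->
  (tail rho <= tau%:E)%E -> (potential rho r x < +oo)%E ->
  (potential rho 1 x < +oo)%E /\
  fine (potential rho 1 x) `^ r <= tau `^ (r - 1) * fine (potential rho r x).
Proof.
move=> r1 tau0 ht Vfin; have r0 : 0 < r by lra.
have key c : 0 < c -> ((r * c `^ (r - 1))%:E * potential rho 1 x <=
    potential rho r x + ((r - 1) * c `^ r * tau)%:E)%E.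
  move=> c0.
  have c1 : 0 <= r * c `^ (r - 1) by rewrite mulr_ge0 ?powR_ge0// ltW.
  have c2 : 0 <= (r - 1) * c `^ r by rewrite mulr_ge0 ?powR_ge0// subr_ge0.
  rewrite -ge0_integralZl//; last 2 first.
  - exact: measurable_potential_slice.
  - by move=> y _; rewrite lee_fin !mulr_ge0 ?far_ge0 ?powR_ge0.
  apply: (@le_trans _ _ (\int[mu]_y ((far rho y * newton (tsub x y) `^ r * u0 y)%:E +
      ((r - 1) * c `^ r)%:E * (far rho y * u0 y)%:E))%E).
    apply: ge0_le_integral => //.
    - by move=> y _; rewrite -EFinM lee_fin !mulr_ge0 ?far_ge0 ?powR_ge0// ltW.
    - by apply: emeasurable_funM => //; exact: measurable_potential_slice.
    - apply: emeasurable_funD; first exact: measurable_potential_slice.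
      by apply: emeasurable_funM => //; exact: measurable_tail_integrand.
    - move=> y _; rewrite -!EFinM -EFinD lee_fin powRr1 ?newton_ge0//.
      have fu : 0 <= far rho y * u0 y by rewrite mulr_ge0 ?far_ge0.
      have h := ler_wpM2r fu (young_tangent r1 c0 (newton_ge0 (tsub x y))).
      apply: le_trans (le_trans _ h) _; rewrite le_eqVlt; apply/orP; left; apply/eqP; ring.
  rewrite ge0_integralD//; last 4 first.
  - by move=> y _; rewrite lee_fin !mulr_ge0 ?far_ge0 ?powR_ge0.
  - exact: measurable_potential_slice.
  - by move=> y _; rewrite -EFinM lee_fin !mulr_ge0 ?far_ge0 ?powR_ge0// subr_ge0.
  - by apply: emeasurable_funM => //; exact: measurable_tail_integrand.
  rewrite leeD2l// ge0_integralZl//; last 2 first.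
  - exact: measurable_tail_integrand.
  - by move=> y _; rewrite lee_fin mulr_ge0 ?far_ge0.
  by rewrite (EFinM _ tau); apply: lee_wpmul2l => //; rewrite lee_fin.
have Vf : potential rho r x \is a fin_num by rewrite ge0_fin_numE// potential_ge0.
(* Any tangent point gives finiteness; c = 1 is the simplest. *)
have Wfin : (potential rho 1 x < +oo)%E.
  have := key 1 ltr01; rewrite !powR1 !mulr1 => h.
  rewrite ltey; apply/eqP => E; move: h; rewrite E gt0_muley ?lte_fin//.
  by rewrite leye_eq -(fineK Vf) -EFinD.
split => //.
have Wf : potential rho 1 x \is a fin_num by rewrite ge0_fin_numE// potential_ge0.
have W0 : 0 <= fine (potential rho 1 x) by rewrite fine_ge0// potential_ge0.
have V0 : 0 <= fine (potential rho r x) by rewrite fine_ge0// potential_ge0.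
set W := fine (potential rho 1 x) in W0 *; set V := fine (potential rho r x) in V0 *.
have [W00|Wn0] := eqVneq W 0.
  by rewrite W00 powR0 ?mulr_ge0 ?powR_ge0// gt_eqF.
have Wp : 0 < W by rewrite lt0r Wn0.
(* The optimal tangent point, namely the mean of the kernel when the mass is counted as tau. *)
pose c := W / tau.
have c0 : 0 < c by rewrite divr_gt0.
have := key c c0; rewrite -(fineK Wf) -(fineK Vf) -/W -/V -EFinM -EFinD lee_fin.
have -> : r * c `^ (r - 1) * W = r * (c `^ r * tau).
  rewrite -(mulr_powRB1 (ltW c0) r0) {2}/c; field; by rewrite gt_eqF.
move=> h; have {}h : c `^ r * tau <= V.
  have -> : c `^ r * tau = r * (c `^ r * tau) - (r - 1) * c `^ r * tau by ring.
  by rewrite lerBlDr.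
have -> : W = c * tau by rewrite /c mulfVK// gt_eqF.
rewrite powRM ?(ltW c0) ?(ltW tau0)// -(mulr_powRB1 (ltW tau0) r0) mulrA mulrC.
by rewrite ler_wpM2l ?powR_ge0.
Qed.

(** Tonelli reduces this to a bound uniform in the pole y: points within rho of y are handled by
    [newton_ball_integral], at the others the kernel is at most its value at distance rho, times the
    volume of the ball. *)
Lemma potential_ball_integral (r : R) : 0 < r -> n.+1%:R * r < N%:R ->
  exists2 C : R, 0 <= C & forall gam rho, 0 < rho ->
  (\int[mu]_x ((\1_[set x | (tnorm x < rho)%R] x)%:E * potential gam r x) <=
    (C * rho `^ (N%:R - n.+1%:R * r))%:E * tail gam)%E.
Proof.
move=> r0 thN; have [Ck Ck0 hk] := newton_ball_integral r0 thN.
exists (Ck + 2 ^+ N); first by rewrite addr_ge0// exprn_ge0.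
move=> gam rho rho0.
have mball : measurable [set x : N.-tuple R | tnorm x < rho].
  have := @measurable_tnorm R N measurableT _ (measurable_itv `]-oo, rho[).
  by rewrite setTI; congr measurable; apply/seteqP; split => x; rewrite /= in_itv.
pose f (z : N.-tuple R * N.-tuple R) : \bar R :=
  (\1_[set x : N.-tuple R | (tnorm x < rho)%R] z.1 *
    (far gam z.2 * newton (tsub z.1 z.2) `^ r * u0 z.2))%:E.
have f0 z : (0 <= f z)%E by rewrite lee_fin !mulr_ge0 ?far_ge0 ?powR_ge0.
have mf : measurable_fun [set: N.-tuple R * N.-tuple R] f.
  apply/measurable_EFinP; apply: measurable_funM.
    by apply: (measurableT_comp (measurable_indic mball)).
  by apply/measurable_EFinP; exact: measurable_potential_integrand.
have -> : (\int[mu]_x ((\1_[set x | (tnorm x < rho)%R] x)%:E * potential gam r x) =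
    \int[mu]_x \int[mu]_y f (x, y))%E.
  apply: eq_integral => x _; rewrite -ge0_integralZl//.
  - exact: measurable_potential_slice.
  - by move=> y _; rewrite lee_fin !mulr_ge0 ?far_ge0 ?powR_ge0.
rewrite (fubini_tonelli f)//.
have -> : ((( Ck + 2 ^+ N) * rho `^ (N%:R - n.+1%:R * r))%:E * tail gam =
  \int[mu]_y (((Ck + 2 ^+ N) * rho `^ (N%:R - n.+1%:R * r))%:E * (far gam y * u0 y)%:E))%E.
  rewrite ge0_integralZl//.
  - exact: measurable_tail_integrand.
  - by move=> y _; rewrite lee_fin mulr_ge0 ?far_ge0.
  - by rewrite lee_fin mulr_ge0 ?powR_ge0// addr_ge0// exprn_ge0.
apply: ge0_le_integral => //.
- by move=> y _; exact: integral_ge0.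
- exact: measurable_fun_fubini_tonelli_G.
- by apply: emeasurable_funM => //; exact: measurable_tail_integrand.
move=> y _.
pose k1 x : R := \1_[set z | (tnorm (tsub z y) < rho)%R] x * newton (tsub x y) `^ r.
pose k2 x : R := \1_[set x : N.-tuple R | (tnorm x < rho)%R] x.
pose c := rho `^ (- (n.+1%:R * r)).
have mk1 : measurable_fun [set: N.-tuple R] k1.
  apply: measurable_funM; first by apply: measurable_indic; exact: ball_measurable.
  apply: (measurableT_comp (measurable_powR r)).
  exact: (measurableT_comp (@measurable_newton R n) (measurable_tsubr y)).
have mk2 : measurable_fun [set: N.-tuple R] k2 by exact: measurable_indic.
have k10 x : 0 <= k1 x by rewrite mulr_ge0 ?powR_ge0.
have k20 x : 0 <= k2 x by rewrite /k2 indicE.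
have fu : 0 <= far gam y * u0 y by rewrite mulr_ge0 ?far_ge0.
apply: (@le_trans _ _ (\int[mu]_x ((far gam y * u0 y)%:E * ((k1 x)%:E + c%:E * (k2 x)%:E)))%E).
  apply: ge0_le_integral => //.
  - exact: (measurableT_comp mf (measurable_pair2 y)).
  - apply: emeasurable_funM => //; apply: emeasurable_funD; first exact/measurable_EFinP.
    by apply: emeasurable_funM => //; exact/measurable_EFinP.
  - move=> x _; rewrite [leRHS](_ : _ = (far gam y * u0 y * (k1 x + c * k2 x))%:E)//.
    rewrite /f lee_fin /=.
    rewrite (_ : _ * (_ * _ * u0 y) = far gam y * u0 y * (k2 x * newton (tsub x y) `^ r)); last first.
      by rewrite /k2; ring.
    rewrite ler_wpM2l//.
    rewrite /k1 indicE; case: (boolP (x \in _)) => [_|/negP h].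
      rewrite mul1r; apply: (@le_trans _ _ (newton (tsub x y) `^ r)).
        by rewrite ler_piMl ?powR_ge0// /k2 indicE lern1 leq_b1.
      by rewrite lerDl mulr_ge0 ?powR_ge0.
    rewrite mul0r add0r mulrC ler_wpM2r//.
    have hs : rho <= tnorm (tsub x y).
      by rewrite leNgt; apply/negP => h'; apply: h; apply/mem_set.
    rewrite newton_powR; last exact: lt_le_trans hs.
    rewrite /c !powRN lef_pV2 ?posrE ?powR_gt0//; last exact: lt_le_trans hs.
    apply: ge0_ler_powR; rewrite ?nnegrE ?tnorm_ge0 ?(ltW rho0)//.
    by rewrite mulr_ge0// ltW.
rewrite ge0_integralZl//; last 2 first.
- apply: emeasurable_funD; first exact/measurable_EFinP.
  by apply: emeasurable_funM => //; exact/measurable_EFinP.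
- by move=> x _; rewrite -EFinM -EFinD lee_fin addr_ge0// mulr_ge0 ?powR_ge0.
rewrite muleC lee_wpmul2r// ?lee_fin//.
rewrite ge0_integralD//; last 4 first.
- by move=> x _; rewrite lee_fin.
- exact/measurable_EFinP.
- by move=> x _; rewrite -EFinM lee_fin mulr_ge0 ?powR_ge0.
- by apply: emeasurable_funM => //; exact/measurable_EFinP.
rewrite mulrDl EFinD; apply: leeD; first exact: hk.
rewrite ge0_integralZl//; last 3 first.
- exact/measurable_EFinP.
- by move=> x _; rewrite lee_fin.
- by rewrite lee_fin powR_ge0.
have hv : (\int[mu]_x (k2 x)%:E <= ((2 * rho) ^+ N)%:E)%E.
  have := ball_volume_le [tuple of nseq N (0 : R)] (ltW rho0).
  congr (_ <= _)%E; apply: eq_integral => x _; congr EFin; congr (\1_ _ _).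
  apply/funext => z; rewrite /mkset (_ : tsub z _ = z)//.
  by apply: eq_from_tnth => i; rewrite tnth_mktuple tnth_nseq0 subr0.
apply: (le_trans (lee_wpmul2l _ hv)); first by rewrite lee_fin powR_ge0.
rewrite -EFinM lee_fin exprMn mulrCA ler_wpM2l ?exprn_ge0//.
rewrite -powR_mulrn ?(ltW rho0)// -powRD; last by rewrite (gt_eqF rho0) implybT.
by rewrite addrC.
Qed.

End potential.

(** * Pointwise estimates on the annulus *)

Lemma pow_diff_le (R : realType) (A B K : R) m : 0 <= A <= K -> 0 <= B <= K ->
  `|A ^+ m.+1 - B ^+ m.+1| <= m.+1%:R * K ^+ m * `|A - B|.
Proof.
move=> /andP[A0 AK] /andP[B0 BK].
rewrite subrXX normrM mulrC ler_wpM2r//.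
apply: (le_trans (ler_norm_sum _ _ _)).
apply: (@le_trans _ _ (\sum_(i < m.+1) K ^+ m)); last first.
  by rewrite sumr_const card_ord mulr_natl.
apply: ler_sum => i _; rewrite normrM !normrX (ger0_norm A0) (ger0_norm B0).
have -> : K ^+ m = K ^+ (m.+1.-1 - i) * K ^+ i by rewrite -exprD subnK// -ltnS.
apply: ler_pM; rewrite ?exprn_ge0//.
  by apply: lerXn2r; rewrite ?nnegrE// (le_trans A0).
by apply: lerXn2r; rewrite ?nnegrE// (le_trans B0).
Qed.

Section pointwise.
Variables (R : realType) (n : nat).
Local Notation N := n.+3.
Local Notation mu := (@muN R N).
Variable u0 : N.-tuple R -> R.
Hypothesis mu0 : measurable_fun [set: N.-tuple R] u0.
Hypothesis u0_ge0 : forall x, 0 <= u0 x.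
Hypothesis u0_fin : (\int[mu]_y (u0 y)%:E < +oo)%E.
Local Notation M := (fine (\int[mu]_y (u0 y)%:E)).

Variables (nu m_ kappa C0 : R).
Hypothesis nu0 : 0 < nu.
Hypothesis numu : nu < m_.
Hypothesis kappa0 : 0 < kappa.
Hypothesis C0_gt0 : 0 < C0.

Variable K : R.
Hypothesis K0 : 0 < K.
Hypothesis nuK : nu / 2 = K^-1.

Lemma M_ge0 : 0 <= M.
Proof. by rewrite fine_ge0// integral_ge0// => y _; rewrite lee_fin. Qed.

Section fixed_time.
Variables (q : N.-tuple R -> R) (g gam eps tau : R).
Hypothesis mq : measurable_fun [set: N.-tuple R] q.
Hypothesis q0 : forall z, 0 <= q z.
Hypothesis qC : forall z, q z <= C0 * newton z.
Hypothesis g0 : 0 < g.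
Hypothesis gam0 : 0 < gam.
Hypothesis gam_le : gam <= nu / 2.
Hypothesis eps0 : 0 <= eps.
Hypothesis q_near : forall z, tnorm z < (m_ + gam) * g ->
  `|q z - kappa * newton z| <= eps * newton z.
Hypothesis tau0 : 0 <= tau.
Hypothesis tail_tau : (tail u0 (gam * g) <= tau%:E)%E.

(** The first term pays for replacing q by [kappa * newton], the second for moving the pole from y
    to the origin. Here K = 2/nu, so that [K / g] bounds the inverse norm at distance at least
    [nu g / 2]. *)
Definition near_coef : R := eps * K ^+ n.+1 + kappa * (n.+1%:R * K ^+ n.+2 * gam).

Lemma near_coef_ge0 : 0 <= near_coef.
Proof.
have Kp i : 0 <= K ^+ i := exprn_ge0 i (ltW K0).
have h := mulr_ge0 (mulr_ge0 (ler0n R n.+1) (Kp n.+2)) (ltW gam0).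
exact: addr_ge0 (mulr_ge0 eps0 (Kp _)) (mulr_ge0 (ltW kappa0) h).
Qed.

Lemma newton_annulus_le (z : N.-tuple R) : nu / 2 * g <= tnorm z ->
  (tnorm z)^-1 <= K / g /\ newton z <= K ^+ n.+1 / g ^+ n.+1.
Proof.
move=> hz; have p : 0 < nu / 2 * g by rewrite mulr_gt0// divr_gt0.
have z0 : 0 < tnorm z by apply: lt_le_trans hz.
have h : (tnorm z)^-1 <= K / g.
  have -> : K / g = (nu / 2 * g)^-1 by rewrite nuK invfM invrK.
  by rewrite lef_pV2.
split => //; rewrite /newton -exprVn -expr_div_n.
by apply: lerXn2r => //; rewrite nnegrE ?invr_ge0 ?divr_ge0// ltW.
Qed.

(** If [|y| < gam g], then [gam <= nu/2] keeps both x and x - y at distance at least [nu g / 2] from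
    the origin, where the kernel is regular. If y is far, the two kernels are bounded separately. *)
Lemma kernel_diff_le (x y : N.-tuple R) : nu * g < tnorm x < m_ * g ->
  `|q (tsub x y) - kappa * newton x| <= near_coef / g ^+ n.+1 +
    far (gam * g) y * (C0 * newton (tsub x y) + kappa * (K ^+ n.+1 / g ^+ n.+1)).
Proof.
move=> /andP[hx1 hx2].
have nug : nu / 2 * g <= tnorm x.
  have : nu * g = nu / 2 * g + nu / 2 * g by field.
  have : 0 < nu / 2 * g by rewrite mulr_gt0// divr_gt0.
  lra.
have [ix nx] := newton_annulus_le nug.
rewrite farE; have [fary|neary] := leP (gam * g) (tnorm y).
  rewrite mul1r; apply: (le_trans (ler_normB _ _)).
  rewrite !ger0_norm ?mulr_ge0 ?newton_ge0 ?(ltW kappa0)//.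
  rewrite ler_wpDl ?divr_ge0 ?near_coef_ge0 ?exprn_ge0 ?(ltW g0)//.
  by apply: lerD; rewrite ?qC// ler_wpM2l// ltW.
rewrite mul0r addr0.
have t1 := tnorm_le_tsub x y; have t2 := tnorm_tsub_le x y.
have hb : nu / 2 * g <= tnorm (tsub x y).
  have : gam * g <= nu / 2 * g by rewrite ler_wpM2r// ltW.
  have : nu * g = nu / 2 * g + nu / 2 * g by field.
  lra.
have hb2 : tnorm (tsub x y) < (m_ + gam) * g by rewrite mulrDl; lra.
have [iz nz] := newton_annulus_le hb.
have h1 := q_near hb2.
have p : 0 < nu / 2 * g by rewrite mulr_gt0// divr_gt0.
have x0 : 0 < tnorm x by apply: lt_le_trans nug.
have z0 : 0 < tnorm (tsub x y) by apply: lt_le_trans hb.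
have Kg : 0 <= K / g by rewrite divr_ge0// ltW.
(* A mean value estimate for the power N - 2 of the inverse norms, which lie below [K / g] and
   differ by at most [gam g (K / g)^2]. *)
have h2 : `|newton (tsub x y) - newton x| <= n.+1%:R * K ^+ n.+2 * gam / g ^+ n.+1.
  rewrite /newton -[(tnorm (tsub x y) ^+ _)^-1]exprVn -[(tnorm x ^+ _)^-1]exprVn.
  have zi : 0 <= (tnorm (tsub x y))^-1 <= K / g by rewrite invr_ge0 ltW.
  have xi : 0 <= (tnorm x)^-1 <= K / g by rewrite invr_ge0 ltW.
  apply: (le_trans (pow_diff_le _ zi xi)).
  have h3 : `|(tnorm (tsub x y))^-1 - (tnorm x)^-1| <= gam * g * (K / g) ^+ 2.
    have -> : (tnorm (tsub x y))^-1 - (tnorm x)^-1 =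
        (tnorm x - tnorm (tsub x y)) * ((tnorm (tsub x y))^-1 * (tnorm x)^-1).
      by field; rewrite !gt_eqF.
    rewrite normrM (@ger0_norm _ (_ * _)); last by rewrite mulr_ge0// invr_ge0 ltW.
    apply: ler_pM => //; first by rewrite mulr_ge0// invr_ge0 ltW.
      rewrite ler_norml; apply/andP; split; lra.
    by rewrite expr2; apply: ler_pM => //; rewrite invr_ge0 ltW.
  apply: (@le_trans _ _ (n.+1%:R * (K / g) ^+ n * (gam * g * (K / g) ^+ 2))).
    by rewrite ler_wpM2l// mulr_ge0// exprn_ge0.
  have -> : K ^+ n.+2 = K ^+ n * K ^+ 2 by rewrite -exprD addn2.
  have -> : g ^+ n.+1 = g ^+ n * g by rewrite exprSr.
  rewrite !expr_div_n le_eqVlt; apply/orP; left; apply/eqP.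
  have := exprn_gt0 n g0; move: (g ^+ n) (K ^+ n) => gn Kn gn0.
  by field; rewrite !gt_eqF.
rewrite (_ : q _ - _ = (q (tsub x y) - kappa * newton (tsub x y)) +
   kappa * (newton (tsub x y) - newton x)); last by ring.
apply: (le_trans (ler_normD _ _)).
rewrite /near_coef mulrDl; apply: lerD.
  by apply: (le_trans h1); rewrite -mulrA ler_wpM2l.
by rewrite normrM (gtr0_norm kappa0) -mulrA ler_wpM2l// ltW.
Qed.

(** [kernel_diff_le] integrated against the datum. Two one-sided inequalities between nonnegative
    integrals are proved first; finiteness of [U] follows from one of them, and only then are real
    values subtracted. *)
Lemma pointwise_potential_le (x : N.-tuple R) : nu * g < tnorm x < m_ * g ->
  (`|fine (\int[mu]_y (q (tsub x y) * u0 y)%:E) - M * kappa * newton x|%:E <=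
   ((M * near_coef + kappa * K ^+ n.+1 * tau) / g ^+ n.+1)%:E +
     C0%:E * potential u0 (gam * g) 1 x)%E.
Proof.
move=> hx.
(* An infinite potential makes the bound trivial, and a finite one makes [U] finite, so [fine] is
   harmless in both cases. *)
have [Wfin|Woo] := ltP (potential u0 (gam * g) 1 x) +oo%E; last first.
  have -> : potential u0 (gam * g) 1 x = +oo%E by apply/eqP; rewrite -leye_eq.
  by rewrite gt0_muley ?lte_fin// addey// leey.
have W0 := potential_ge0 u0_ge0 (gam * g) 1 x.
have Wf : potential u0 (gam * g) 1 x \is a fin_num by rewrite ge0_fin_numE.
have m0 : (0 <= \int[mu]_y (u0 y)%:E)%E by apply: integral_ge0 => y _; rewrite lee_fin.
have mf : (\int[mu]_y (u0 y)%:E)%E \is a fin_num by rewrite ge0_fin_numE.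
have mqu : measurable_fun [set: N.-tuple R] (fun y => (q (tsub x y) * u0 y)%:E).
  apply/measurable_EFinP; apply: measurable_funM => //.
  exact: (measurableT_comp mq (measurable_tsubl x)).
have qu0 y : (0 <= (q (tsub x y) * u0 y)%:E)%E by rewrite lee_fin mulr_ge0.
have mu0E : measurable_fun [set: N.-tuple R] (EFin \o u0) by exact/measurable_EFinP.
have gn0 : 0 <= (g ^+ n.+1)^-1 by rewrite invr_ge0 exprn_ge0// ltW.
have [c1 c10 c1E] : exists2 c1, 0 <= c1 & c1 = near_coef / g ^+ n.+1.
  by eexists; last reflexivity; rewrite mulr_ge0// near_coef_ge0.
have [c2 c20 c2E] : exists2 c2, 0 <= c2 & c2 = kappa * (K ^+ n.+1 / g ^+ n.+1).
  by eexists; last reflexivity; exact: mulr_ge0 (ltW kappa0) (mulr_ge0 (exprn_ge0 _ (ltW K0)) gn0).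
have fu y : 0 <= far (gam * g) y * u0 y by rewrite mulr_ge0 ?far_ge0.
have fnu y : 0 <= far (gam * g) y * newton (tsub x y) `^ 1 * u0 y.
  by rewrite !mulr_ge0 ?far_ge0 ?powR_ge0.
have D1 y : 0 <= C0 * (far (gam * g) y * newton (tsub x y) `^ 1 * u0 y) +
    c2 * (far (gam * g) y * u0 y).
  by rewrite addr_ge0// mulr_ge0// ltW.
pose D y : \bar R := (c1%:E * (u0 y)%:E + (C0%:E * (far (gam * g) y * newton (tsub x y) `^ 1 * u0 y)%:E +
  c2%:E * (far (gam * g) y * u0 y)%:E))%E.
have D0 y : (0 <= D y)%E.
  rewrite [D y](_ : _ = (c1 * u0 y + (C0 * (far (gam * g) y * newton (tsub x y) `^ 1 * u0 y) +
    c2 * (far (gam * g) y * u0 y)))%:E)// lee_fin.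
  by rewrite addr_ge0// mulr_ge0.
have mpot := measurable_potential_slice mu0 (gam * g) 1 x.
have mtail := measurable_tail_integrand mu0 (gam * g).
have mD : measurable_fun [set: N.-tuple R] D.
  apply: emeasurable_funD; first exact: emeasurable_funM.
  by apply: emeasurable_funD; exact: emeasurable_funM.
have ID : (\int[mu]_y D y = c1%:E * \int[mu]_y (u0 y)%:E +
    (C0%:E * potential u0 (gam * g) 1 x + c2%:E * tail u0 (gam * g)))%E.
  rewrite ge0_integralD//; last 4 first.
  - by move=> y _; rewrite mule_ge0 ?lee_fin.
  - exact: emeasurable_funM.
  - by move=> y _; rewrite -!EFinM -EFinD lee_fin.
  - by apply: emeasurable_funD; exact: emeasurable_funM.
  rewrite ge0_integralZl//; last by move=> y _; rewrite lee_fin.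
  rewrite ge0_integralD//; last 4 first.
  - by move=> y _; rewrite -EFinM lee_fin mulr_ge0// ltW.
  - exact: emeasurable_funM.
  - by move=> y _; rewrite -EFinM lee_fin mulr_ge0.
  - exact: emeasurable_funM.
  rewrite ge0_integralZl//; last 2 first.
  - by move=> y _; rewrite lee_fin !mulr_ge0 ?far_ge0 ?powR_ge0.
  - by rewrite lee_fin ltW.
  by rewrite ge0_integralZl// => y _; rewrite lee_fin mulr_ge0 ?far_ge0.
have tf : tail u0 (gam * g) \is a fin_num.
  by rewrite ge0_fin_numE ?tail_ge0//; apply: le_lt_trans tail_tau (ltry _).
have IDf : (\int[mu]_y D y)%E \is a fin_num.
  by rewrite ID !fin_numD !fin_numM.
have pw y : `|q (tsub x y) - kappa * newton x| * u0 y <= fine (D y).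
  apply: (le_trans (ler_wpM2r (u0_ge0 y) (kernel_diff_le y hx))).
  rewrite /D /= powRr1 ?newton_ge0// c1E c2E.
  by rewrite le_eqVlt; apply/orP; left; apply/eqP; ring.
have DE y : D y = (fine (D y))%:E by [].
pose U := (\int[mu]_y (q (tsub x y) * u0 y)%:E)%E.
have kn : 0 <= kappa * newton x by rewrite mulr_ge0 ?newton_ge0// ltW.
have le1 : (U <= (kappa * newton x)%:E * \int[mu]_y (u0 y)%:E + \int[mu]_y D y)%E.
  rewrite -ge0_integralZl//; last by move=> y _; rewrite lee_fin.
  rewrite -ge0_integralD//; last 2 first.
  - by move=> y _; rewrite mule_ge0 ?lee_fin.
  - exact: emeasurable_funM.
  apply: ge0_le_integral => //.
  - by apply: emeasurable_funD => //; exact: emeasurable_funM.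
  - move=> y _; rewrite DE -EFinM -EFinD lee_fin.
    have := pw y; rewrite -[X in X * _ <= _]/(`|_|) => h.
    have := ler_wpM2r (u0_ge0 y) (ler_norm (q (tsub x y) - kappa * newton x)).
    rewrite mulrBl; lra.
have le2 : ((kappa * newton x)%:E * \int[mu]_y (u0 y)%:E <= U + \int[mu]_y D y)%E.
  rewrite -ge0_integralZl//; last by move=> y _; rewrite lee_fin.
  rewrite -ge0_integralD//.
  apply: ge0_le_integral => //.
  - by move=> y _; rewrite mule_ge0 ?lee_fin.
  - exact: emeasurable_funM.
  - exact: emeasurable_funD.
  - move=> y _; rewrite DE -EFinM -EFinD lee_fin.
    have := pw y => h.
    have := ler_wpM2r (u0_ge0 y) (ler_norm (kappa * newton x - q (tsub x y))).
    rewrite distrC mulrBl; lra.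
have Uf : U \is a fin_num.
  rewrite ge0_fin_numE; last by apply: integral_ge0 => y _; exact: qu0.
  apply: (le_lt_trans le1); rewrite -(fineK IDf) -(fineK mf) -EFinM -EFinD; exact: ltry.
rewrite -/U; move: le1 le2.
rewrite -(fineK Uf) -(fineK IDf) -(fineK mf) -EFinM -!EFinD !lee_fin => le1 le2.
apply: (@le_trans _ _ (\int[mu]_y D y)%E).
  rewrite -(fineK IDf) lee_fin /= ler_norml.
  by apply/andP; split; rewrite (mulrC M) in le1 le2 *; lra.
rewrite ID -(fineK mf) -EFinM addeCA addeC.
apply: leeD => //; rewrite -(fineK tf) -EFinM -EFinD lee_fin.
have ht : fine (tail u0 (gam * g)) <= tau by rewrite -lee_fin fineK.
have := ler_wpM2l c20 ht; rewrite c1E c2E /=.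
set X := fine _; set Y := fine _ => h.
have -> : (Y * near_coef + kappa * K ^+ n.+1 * tau) / g ^+ n.+1 =
  near_coef / g ^+ n.+1 * Y + kappa * (K ^+ n.+1 / g ^+ n.+1) * tau by ring.
by rewrite lerD2l.
Qed.

End fixed_time.

Section large_time.
Variables (q : R -> N.-tuple R -> R) (s g : R -> R).
Hypothesis mq : forall t, 0 < t -> measurable_fun [set: N.-tuple R] (q t).
Hypothesis q0 : forall t z, 0 < t -> 0 <= q t z.
Hypothesis qC : forall t z, 0 < t -> q t z <= C0 * newton z.
Hypothesis q_near : forall e, 0 < e -> exists2 d, 0 < d &
  forall t z, 0 < t -> tnorm z < d * s t -> `|q t z - kappa * newton z| <= e * newton z.
Hypothesis s0 : forall t, 0 < t -> 0 < s t.
Hypothesis g0 : forall t, 0 < t -> 0 < g t.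
Hypothesis goo : g t @[t --> +oo] --> +oo.
Hypothesis gs : (g t / s t) @[t --> +oo] --> 0.

(** Budget of eta in quarters: kernel approximation (eps), displacement of the pole (gam), far mass
    (tau), and the replacement of [kappa * newton] by q at x itself, which turns the first estimate
    into the second. The radius gam is fixed before t, so that [gam * g t] tends to infinity. *)
Lemma pointwise_large_time (eta : R) : 0 < eta -> exists2 gam, 0 < gam &
  \forall t \near +oo, forall x, nu < tnorm x / g t < m_ ->
  let U := fine (\int[mu]_y (q t (tsub x y) * u0 y)%:E) in
  let B := ((eta / g t ^+ n.+1)%:E + C0%:E * potential u0 (gam * g t) 1 x)%E in
  (`|U - M * kappa * newton x|%:E <= B)%E /\ (`|U - M * q t x|%:E <= B)%E.
Proof.
move=> eta0; have M0 := M_ge0.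
have Kn0 : 0 < K ^+ n.+1 by rewrite exprn_gt0.
(* Dividing by a + 1 rather than a covers a = 0. *)
have small a : 0 <= a -> exists2 e, 0 < e & a * e <= eta / 4.
  move=> a0; exists (eta / 4 / (a + 1)).
    by rewrite !divr_gt0// ltr_pwDr.
  have -> : a * (eta / 4 / (a + 1)) = eta / 4 * (a / (a + 1)) by ring.
  rewrite ler_piMr//; first by rewrite divr_ge0// ltW.
  rewrite ler_pdivrMr; first by rewrite mul1r lerDl.
  by rewrite ltr_pwDr.
have [eps eps0 heps] := small (M * K ^+ n.+1) (mulr_ge0 M0 (ltW Kn0)).
have [gam1 gam10 hgam1] := small (M * (kappa * (n.+1%:R * K ^+ n.+2)))
  (mulr_ge0 M0 (mulr_ge0 (ltW kappa0) (mulr_ge0 (ler0n R n.+1) (exprn_ge0 n.+2 (ltW K0))))).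
have [tau tau0 htau] := small (kappa * K ^+ n.+1) (mulr_ge0 (ltW kappa0) (ltW Kn0)).
pose gam := Num.min gam1 (nu / 2).
have gam0 : 0 < gam by rewrite lt_min gam10 divr_gt0.
have gam_le : gam <= nu / 2 by rewrite ge_min lexx orbT.
have gam_le1 : gam <= gam1 by rewrite ge_min lexx.
exists gam => //.
have [d d0 hd] := q_near eps0.
have [rho0 rho00 hrho] := tail_small mu0 u0_ge0 u0_fin tau0.
have mg : 0 < m_ + gam by rewrite addr_gt0// (lt_trans nu0).
near=> t; move=> x hx.
set U := fine (\int[mu]_y (q t _ * _)%:E); set B := ((_)%:E + _)%E.
have t0 : 0 < t by near: t; exact: nbhs_pinfty_gt.
have gt0 := g0 t0; have st0 := s0 t0.
have hx' : nu * g t < tnorm x < m_ * g t.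
  by move: hx; rewrite ltr_pdivlMr// ltr_pdivrMr.
have hgs : (m_ + gam) * g t < d * s t.
  have : g t / s t < d / (m_ + gam).
    near: t; apply: (cvgr_lt 0) => //; exact: divr_gt0.
  by rewrite ltr_pdivrMr// mulrAC ltr_pdivlMr// mulrC.
have htail : (tail u0 (gam * g t) <= tau%:E)%E.
  apply: hrho; rewrite mulrC -ler_pdivrMr//.
  by near: t; move/cvgryPge : goo; apply.
have hq z : tnorm z < (m_ + gam) * g t -> `|q t z - kappa * newton z| <= eps * newton z.
  by move=> hz; apply: hd => //; exact: lt_trans hz hgs.
have main : (`|U - M * kappa * newton x|%:E <=
    ((M * near_coef gam eps + kappa * K ^+ n.+1 * tau) / g t ^+ n.+1)%:E +
    C0%:E * potential u0 (gam * g t) 1 x)%E.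
  apply: pointwise_potential_le => //; try exact: ltW.
  - exact: mq.
  - by move=> z; exact: q0.
  - by move=> z; exact: qC.
have hnear : M * near_coef gam eps + kappa * K ^+ n.+1 * tau <= 3 * (eta / 4).
  rewrite /near_coef mulrDr.
  have h1 : M * (eps * K ^+ n.+1) <= eta / 4 by rewrite mulrCA mulrC.
  have h2 : M * (kappa * (n.+1%:R * K ^+ n.+2 * gam)) <= eta / 4.
    apply: le_trans hgam1; rewrite (_ : _ * (_ * (_ * gam)) = M * (kappa * (n.+1%:R * K ^+ n.+2)) * gam); last by ring.
    by rewrite ler_wpM2l// !mulr_ge0// ?exprn_ge0// ltW.
  lra.
have gn0 : 0 < g t ^+ n.+1 by rewrite exprn_gt0.
split.
  apply: (le_trans main); apply: leeD => //; rewrite lee_fin ler_pM2r ?invr_gt0//; lra.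
have h3 : `|M * kappa * newton x - M * q t x| <= eta / 4 / g t ^+ n.+1.
  have -> : M * kappa * newton x - M * q t x = - (M * (q t x - kappa * newton x)) by ring.
  rewrite normrN normrM ger0_norm//.
  have hx2 : tnorm x < (m_ + gam) * g t.
    have /andP[_ h] := hx'; apply: (lt_trans h); rewrite ltr_pM2r//; lra.
  have nug : nu / 2 * g t <= tnorm x.
    have /andP[h _] := hx'.
    have : nu * g t = nu / 2 * g t + nu / 2 * g t by field.
    have : 0 < nu / 2 * g t by rewrite mulr_gt0// divr_gt0.
    lra.
  have [_ hn] := newton_annulus_le gt0 nug.
  apply: (@le_trans _ _ (M * (eps * (K ^+ n.+1 / g t ^+ n.+1)))).
    rewrite ler_wpM2l//; apply: (le_trans (hq _ hx2)).
    by rewrite ler_wpM2l// ltW.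
  rewrite (_ : M * _ = M * K ^+ n.+1 * eps / g t ^+ n.+1); last by ring.
  by rewrite ler_pM2r ?invr_gt0.
apply: (@le_trans _ _ (`|U - M * kappa * newton x|%:E + (eta / 4 / g t ^+ n.+1)%:E)%E).
  rewrite -EFinD lee_fin.
  have -> : U - M * q t x = (U - M * kappa * newton x) + (M * kappa * newton x - M * q t x) by ring.
  by apply: (le_trans (ler_normD _ _)); rewrite lerD2l.
apply: (le_trans (leeD main (lexx _))).
rewrite addeAC /B; apply: leeD => //; rewrite -EFinD lee_fin -mulrDl ler_pM2r ?invr_gt0//; lra.
Unshelve. all: end_near. Qed.

End large_time.
End pointwise.

(** * Norms on the annulus *)

Lemma ereal_cvg0 (R : realType) (Q : R -> \bar R) :
  (\forall t \near +oo, (0 <= Q t)%E) ->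
  (forall e : R, 0 < e -> \forall t \near +oo, (Q t <= e%:E)%E) ->
  Q t @[t --> +oo] --> 0%E.
Proof.
move=> Q0 Qe; apply/fine_cvgP; split.
  near=> t; rewrite ge0_fin_numE; last by near: t.
  apply: (@le_lt_trans _ _ 1%:E); last exact: ltry.
  by near: t; exact: Qe.
apply/cvgrPdist_le => e e0; near=> t.
have h0 : (0 <= Q t)%E by near: t.
have h1 : (Q t <= e%:E)%E by near: t; exact: Qe.
have hf : Q t \is a fin_num by rewrite ge0_fin_numE// (le_lt_trans h1)// ltry.
by rewrite sub0r normrN /= ger0_norm ?fine_ge0// -lee_fin fineK.
Unshelve. all: end_near. Qed.

Lemma powRD_le (R : realType) (a b r : R) : 0 <= a -> 0 <= b -> 1 <= r ->
  (a + b) `^ r <= 2 `^ r * (a `^ r + b `^ r).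
Proof.
move=> a0 b0 r1; have r0 : 0 <= r by lra.
wlog ab : a b a0 b0 / a <= b => [h|].
  have [|/ltW] := leP a b; first exact: h.
  by rewrite (addrC a) (addrC (a `^ r)); exact: h.
apply: (@le_trans _ _ ((2 * b) `^ r)).
  by apply: ge0_ler_powR => //; rewrite ?nnegrE ?addr_ge0 ?mulr_ge0//; lra.
by rewrite powRM// ler_wpM2l ?powR_ge0// lerDr powR_ge0.
Qed.

Section annulus_norm.
Variables (R : realType) (n : nat).
Local Notation N := n.+3.
Local Notation mu := (@muN R N).
Local Notation rate g p := (g `^ (N%:R * (1 - invp p) - 2)).
Implicit Types (A : set (N.-tuple R)) (f : N.-tuple R -> R).

Lemma LpN_ge0 p A f : (1 <= p)%E -> (0 <= LpN p A f)%E.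
Proof.
case: p => [r|_|]; last by rewrite leeNy_eq.
  by move=> _; exact: poweR_ge0.
apply: le_ereal_inf_tmp => _ [c [c0 _] <-].
by rewrite lee_fin.
Qed.

(** The exponent is (N - 2) - N/p: the first part undoes the size of the kernel, the second the
    volume of the annulus. *)
Lemma rateE (g : R) p : 0 < g -> rate g p = g ^+ n.+1 / g `^ (N%:R * invp p).
Proof.
move=> g0; rewrite -powRN -powR_mulrn ?(ltW g0)// -powRD; last by rewrite (gt_eqF g0) implybT.
congr (_ `^ _); have -> : N%:R = n.+1%:R + 2 :> R by rewrite -natrD addn2.
ring.
Qed.

(** Taking r-th roots turns the exponent [N - (N-2) r] into minus the rate exponent, so g cancels.
    The factor c serves both claims, with c = 1 for the first and [t^alpha] for the second. *)
Lemma LpN_finite_le (r I c g : R) A f : 1 <= r -> 0 < g -> 0 < c -> 0 <= I ->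
  measurable A -> measurable_fun [set: N.-tuple R] f ->
  (\int[mu]_x (\1_A x * (c * `|f x|) `^ r)%:E <=
     (I `^ r * g `^ (N%:R - n.+1%:R * r))%:E)%E ->
  ((rate g r%:E * c)%:E * LpN r%:E A f <= I%:E)%E.
Proof.
move=> r1 g0 c0 I0 mA mf h; have r0 : 0 < r by lra.
have mi : measurable_fun [set: N.-tuple R] (fun x => (\1_A x * `|f x| `^ r)%:E).
  apply/measurable_EFinP; apply: measurable_funM; first exact: measurable_indic.
  apply: (measurableT_comp (measurable_powR r)).
  exact: measurableT_comp.
have i0 x : (0 <= (\1_A x * `|f x| `^ r)%:E)%E.
  by rewrite lee_fin mulr_ge0 ?powR_ge0// indicE.
rewrite /LpN intN_integral//.
set J := (\int[_]_x _)%E.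
have J0 : (0 <= J)%E by apply: integral_ge0 => x _; exact: i0.
have cr : 0 < c `^ r by rewrite powR_gt0.
have JE : (\int[mu]_x (\1_A x * (c * `|f x|) `^ r)%:E = (c `^ r)%:E * J)%E.
  rewrite -ge0_integralZl//; last by rewrite lee_fin ltW.
  apply: eq_integral => x _; rewrite -EFinM powRM ?(ltW c0)//; congr EFin; ring.
rewrite JE in h.
have Jf : J \is a fin_num.
  rewrite ge0_fin_numE// ltey; apply/eqP => E; move: h.
  by rewrite E gt0_muley ?lte_fin// leye_eq.
have j0 : 0 <= fine J by rewrite fine_ge0.
move: h; rewrite -(fineK Jf) -EFinM lee_fin poweR_EFin -EFinM lee_fin => h.
have h1 : c * fine J `^ r^-1 <= I * g `^ (N%:R / r - n.+1%:R).
  have := @ge0_ler_powR R r^-1 _ _ _ _ _ h.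
  rewrite invr_ge0 !nnegrE !mulr_ge0 ?powR_ge0 ?(ltW r0)// => /(_ erefl erefl erefl).
  rewrite !powRM ?powR_ge0// -!powRrM divff ?gt_eqF// !powRr1 ?(ltW c0)//.
  by rewrite mulrBl mulfK ?gt_eqF.
rewrite -mulrA; apply: (le_trans (ler_wpM2l (powR_ge0 _ _) h1)).
rewrite mulrCA -powRD; last by rewrite (gt_eqF g0) implybT.
rewrite (_ : _ + _ = 0) ?powRr0 ?mulr1//=.
have -> : N%:R = n.+1%:R + 2 :> R by rewrite -natrD addn2.
ring.
Qed.

Lemma LpN_infty_le (b c : R) A f : 0 < c -> 0 <= b ->
  (forall x, A x -> c * `|f x| <= b) -> (c%:E * LpN +oo A f <= b%:E)%E.
Proof.
move=> c0 b0 h.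
apply: (@le_trans _ _ (c%:E * (b / c)%:E)%E); last first.
  by rewrite -EFinM lee_fin mulrC mulfVK// gt_eqF.
apply: lee_wpmul2l; first by rewrite lee_fin ltW.
apply: ereal_inf_lbound; exists (b / c) => //; split; first by rewrite divr_ge0// ltW.
rewrite (_ : A `&` _ = set0) ?indic0; last first.
  apply/seteqP; split => // x [/= Ax]; rewrite ltr_pdivrMr// mulrC.
  by rewrite ltNge h.
rewrite -[LHS]/(intN (fun=> 0%E)) intN_integral//; exact: integral0.
Qed.

(** The set lies in a ball of volume at most [(2 m_ g)^N], whose 1/p-th power cancels the volume
    part of the rate; for p infinite that part is absent. *)
Lemma LpN_sup_le p (eta c g m_ : R) A f : (1 <= p)%E -> 0 < g -> 0 < c -> 0 <= eta ->
  0 < m_ -> measurable A -> measurable_fun [set: N.-tuple R] f ->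
  (forall x, A x -> tnorm x < m_ * g) ->
  (forall x, A x -> c * `|f x| <= eta / g ^+ n.+1) ->
  ((rate g p * c)%:E * LpN p A f <= ((2 * m_) `^ (N%:R * invp p) * eta)%:E)%E.
Proof.
move=> p1 g0 c0 eta0 m0 mA mf Ag hf.
have gn0 : 0 < g ^+ n.+1 by rewrite exprn_gt0.
case: p p1 => [r r1|_|//]; last first.
  rewrite rateE//= mulr0 !powRr0 divr1 mul1r EFinM -muleA.
  apply: (@le_trans _ _ ((g ^+ n.+1)%:E * (eta / g ^+ n.+1)%:E)%E); last first.
    by rewrite -EFinM lee_fin mulrC mulfVK// gt_eqF.
  apply: lee_wpmul2l; first by rewrite lee_fin ltW.
  by apply: LpN_infty_le => //; rewrite divr_ge0// ltW.
rewrite lee_fin in r1; have r0 : 0 < r by lra.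
apply: LpN_finite_le => //; first by rewrite mulr_ge0 ?powR_ge0.
have mB := @ball_measurable R n [tuple of nseq N 0] (m_ * g).
have hv := ball_volume_le [tuple of nseq N (0 : R)] (ltW (mulr_gt0 m0 g0)).
set B := (X in measurable X) in mB hv.
have b0 : 0 <= (eta / g ^+ n.+1) `^ r by rewrite powR_ge0.
apply: (@le_trans _ _ (\int[mu]_x (((eta / g ^+ n.+1) `^ r)%:E * (\1_B x)%:E))%E).
  apply: ge0_le_integral => //.
  - by move=> x _; rewrite lee_fin mulr_ge0 ?powR_ge0// indicE.
  - apply/measurable_EFinP; apply: measurable_funM; first exact: measurable_indic.
    apply: (measurableT_comp (measurable_powR r)); apply: measurable_funM => //.
    exact: measurableT_comp.
  - by apply: emeasurable_funM => //; apply/measurable_EFinP; exact: measurable_indic.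
  move=> x _; rewrite -EFinM lee_fin !indicE.
  case: (boolP (x \in A)) => [/set_mem Ax|_]; last by rewrite mul0r mulr_ge0.
  have -> : x \in B.
    apply/mem_set; rewrite /B/= (_ : tsub _ _ = x) ?Ag//.
    by apply: eq_from_tnth => i; rewrite tnth_mktuple tnth_nseq0 subr0.
  rewrite mul1r mulr1; apply: ge0_ler_powR; rewrite ?nnegrE ?(ltW r0)//.
  - by rewrite mulr_ge0// ltW.
  - by rewrite divr_ge0// ltW.
  - exact: hf.
rewrite ge0_integralZl//; last first.
  by apply/measurable_EFinP; exact: measurable_indic.
apply: (le_trans (lee_wpmul2l _ hv)); first by rewrite lee_fin.
rewrite -EFinM lee_fin /= le_eqVlt; apply/orP; left; apply/eqP.
rewrite (powRM _ (powR_ge0 _ _) eta0) -powRrM mulfVK ?gt_eqF//.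
have -> : (2 * m_) `^ N%:R = (2 * m_) ^+ N by rewrite powR_mulrn// mulr_ge0// ltW.
have -> : (2 * (m_ * g)) ^+ N = (2 * m_) ^+ N * g `^ N%:R.
  by rewrite mulrA exprMn powR_mulrn ?(ltW g0).
have -> : (eta / g ^+ n.+1) `^ r = eta `^ r * g `^ (- (n.+1%:R * r)).
  rewrite powRM ?invr_ge0 ?(ltW gn0)//; congr (_ * _).
  rewrite -powR_inv1 ?(ltW gn0)// -powR_mulrn ?(ltW g0)// -!powRrM.
  by congr (_ `^ _); ring.
rewrite [g `^ (N%:R - _)]powRD; last by rewrite (gt_eqF g0) implybT.
ring.
Qed.

Section finite_exponent.
Variable u0 : N.-tuple R -> R.
Hypothesis mu0 : measurable_fun [set: N.-tuple R] u0.
Hypothesis u0_ge0 : forall x, 0 <= u0 x.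

(** Jensen with mass bound eta contributes [eta^(r-1)] and Tonelli one more factor eta, so the r-th
    power of the potential part is of size [eta^r], like that of the explicit term. Hence L depends
    on neither eta nor g. *)
Lemma LpN_potential_le (r C0 m_ : R) : 1 <= r -> n.+1%:R * r < N%:R ->
  0 <= C0 -> 0 < m_ ->
  exists2 L : R, 0 <= L & forall (eta c g gam : R) A f, 0 < eta -> 0 < c -> 0 < g ->
  measurable A -> measurable_fun [set: N.-tuple R] f ->
  (forall x, A x -> tnorm x < m_ * g) ->
  (tail u0 (gam * g) <= eta%:E)%E ->
  (forall x, A x -> ((c * `|f x|)%:E <=
     (eta / g ^+ n.+1)%:E + C0%:E * potential u0 (gam * g) 1 x)%E) ->
  ((rate g r%:E * c)%:E * LpN r%:E A f <= (L * eta)%:E)%E.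
Proof.
move=> r1 rN C00 m0; have r0 : 0 < r by lra.
have [Cp Cp0 hCp] := potential_ball_integral mu0 u0_ge0 r0 rN.
pose B0 := (2 * m_) ^+ N + C0 `^ r * (Cp * m_ `^ (N%:R - n.+1%:R * r)).
have [B B0' BE] : exists2 B, 0 <= B & B = B0.
  by exists B0 => //; rewrite /B0 addr_ge0 ?exprn_ge0 ?mulr_ge0 ?powR_ge0// ltW.
exists (2 * B `^ r^-1); first by rewrite mulr_ge0 ?powR_ge0.
move=> eta c g gam A f eta0 c0 g0 mA mf Ag ht hf.
apply: LpN_finite_le => //; first by rewrite !mulr_ge0 ?powR_ge0// ltW.
have gn0 : 0 < g ^+ n.+1 by rewrite exprn_gt0.
have mB := @ball_measurable R n [tuple of nseq N 0] (m_ * g).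
have hv := ball_volume_le [tuple of nseq N (0 : R)] (ltW (mulr_gt0 m0 g0)).
have BE' : [set x : N.-tuple R | tnorm (tsub x [tuple of nseq N 0]) < m_ * g] =
    [set x | tnorm x < m_ * g].
  apply/funext => x; rewrite /mkset (_ : tsub _ _ = x)//.
  by apply: eq_from_tnth => i; rewrite tnth_mktuple tnth_nseq0 subr0.
rewrite BE' in mB hv.
have hP := hCp (gam * g) (m_ * g) (mulr_gt0 m0 g0).
set S := [set x | _] in mB hv hP.
pose a := (eta / g ^+ n.+1) `^ r.
pose b := C0 `^ r * eta `^ (r - 1).
have a0 : 0 <= a by rewrite powR_ge0.
have b0 : 0 <= b by rewrite mulr_ge0 ?powR_ge0.
have tr0 : 0 <= (2 : R) `^ r by rewrite powR_ge0.
have mS : measurable_fun [set: N.-tuple R] (fun x => (\1_S x : R)%:E).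
  by apply/measurable_EFinP; exact: measurable_indic.
have S0 x : (0 <= (\1_S x : R)%:E)%E by rewrite lee_fin indicE.
have mSP : measurable_fun [set: N.-tuple R] (fun x => (\1_S x)%:E * potential u0 (gam * g) r x)%E.
  by apply: emeasurable_funM => //; exact: measurable_potential.
have SP0 x : (0 <= (\1_S x)%:E * potential u0 (gam * g) r x)%E.
  by rewrite mule_ge0// potential_ge0.
have aE : (0 <= a%:E)%E by rewrite lee_fin.
have bE : (0 <= b%:E)%E by rewrite lee_fin.
have trE : (0 <= ((2 : R) `^ r)%:E)%E by rewrite lee_fin.
have D0 x : (0 <= (2 `^ r)%:E * (a%:E * (\1_S x)%:E + b%:E * ((\1_S x)%:E * potential u0 (gam * g) r x)))%E.
  apply: mule_ge0 => //; apply: adde_ge0; exact: mule_ge0.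
apply: (@le_trans _ _ (\int[mu]_x ((2 `^ r)%:E * (a%:E * (\1_S x)%:E +
    b%:E * ((\1_S x)%:E * potential u0 (gam * g) r x))))%E).
  apply: ge0_le_integral => //.
  - by move=> x _; rewrite lee_fin mulr_ge0 ?powR_ge0// indicE.
  - apply/measurable_EFinP; apply: measurable_funM; first exact: measurable_indic.
    apply: (measurableT_comp (measurable_powR r)); apply: measurable_funM => //.
    exact: measurableT_comp.
  - apply: emeasurable_funM => //; apply: emeasurable_funD; exact: emeasurable_funM.
  move=> x _; rewrite [X in (X * _)%:E]indicE.
  case: (boolP (x \in A)) => [/set_mem Ax|_]; last first.
    by rewrite mul0r; exact: D0.
  have -> : \1_S x = 1 :> R by rewrite indicE (mem_set (Ag x Ax : S x)).
  rewrite mul1r mule1 mul1e.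
  (* Where the r-th potential is infinite the right side is infinite too, unless C0 = 0, in which
     case the potential has disappeared from the hypothesis on f. *)
  have [Vfin|Voo] := ltP (potential u0 (gam * g) r x) +oo%E; last first.
    have -> : potential u0 (gam * g) r x = +oo%E by apply/eqP; rewrite -leye_eq.
    have [C00'|C0n] := eqVneq C0 0.
      have := hf x Ax; rewrite C00' mul0e adde0 lee_fin => h.
      rewrite /b C00' powR0 ?gt_eqF// mul0r mul0e adde0 -EFinM lee_fin.
      apply: (@le_trans _ _ a).
        apply: ge0_ler_powR; rewrite ?nnegrE ?(ltW r0)//.
          by rewrite mulr_ge0// ltW.
        by rewrite divr_ge0// ltW.
      rewrite ler_peMl// -[leLHS](powRr0 2); apply: ler_powR; rewrite ?ltW//.
      lra.
    rewrite gt0_muley; last first.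
      by rewrite lte_fin mulr_gt0// powR_gt0// lt0r C0n.
    by rewrite addey// gt0_muley ?lte_fin ?powR_gt0// leey.
  have [Wfin hJ] := potential_jensen mu0 u0_ge0 r1 eta0 ht Vfin.
  have Wf : potential u0 (gam * g) 1 x \is a fin_num by rewrite ge0_fin_numE// potential_ge0.
  have Vf : potential u0 (gam * g) r x \is a fin_num by rewrite ge0_fin_numE// potential_ge0.
  have := hf x Ax; rewrite -(fineK Wf) -EFinM -EFinD lee_fin.
  have W0 : 0 <= fine (potential u0 (gam * g) 1 x) by rewrite fine_ge0// potential_ge0.
  move=> h; rewrite -(fineK Vf).
  rewrite [leRHS](_ : _ = (2 `^ r * (a + b * fine (potential u0 (gam * g) r x)))%:E)// lee_fin.
  apply: (@le_trans _ _ ((eta / g ^+ n.+1 + C0 * fine (potential u0 (gam * g) 1 x)) `^ r)).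
    apply: ge0_ler_powR; rewrite ?nnegrE ?(ltW r0)//.
      by rewrite mulr_ge0// ltW.
    exact: addr_ge0 (divr_ge0 (ltW eta0) (ltW gn0)) (mulr_ge0 C00 W0).
  apply: (le_trans (powRD_le (divr_ge0 (ltW eta0) (ltW gn0)) (mulr_ge0 C00 W0) r1)).
  by rewrite ler_wpM2l// lerD2l powRM// /b -mulrA ler_wpM2l ?powR_ge0.
rewrite ge0_integralZl//; last 2 first.
- by apply: emeasurable_funD; exact: emeasurable_funM.
- by move=> x _; apply: adde_ge0; exact: mule_ge0.
rewrite ge0_integralD//; last 4 first.
- by move=> x _; exact: mule_ge0.
- exact: emeasurable_funM.
- by move=> x _; exact: mule_ge0.
- exact: emeasurable_funM.
rewrite !ge0_integralZl//.
apply: (@le_trans _ _ ((2 `^ r)%:E * (a%:E * ((2 * (m_ * g)) ^+ N)%:E +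
    b%:E * (Cp * (m_ * g) `^ (N%:R - n.+1%:R * r) * eta)%:E))%E).
  apply: lee_wpmul2l; first by rewrite lee_fin.
  apply: leeD; apply: lee_wpmul2l; rewrite ?lee_fin//.
  apply: (le_trans hP); rewrite (EFinM _ eta); apply: lee_wpmul2l => //.
  by rewrite lee_fin mulr_ge0 ?powR_ge0.
rewrite [leLHS](_ : _ = (2 `^ r * (a * (2 * (m_ * g)) ^+ N +
  b * (Cp * (m_ * g) `^ (N%:R - n.+1%:R * r) * eta)))%:E)// lee_fin.
rewrite le_eqVlt; apply/orP; left; apply/eqP.
have -> : (2 * B `^ r^-1 * eta) `^ r = 2 `^ r * B * (eta * eta `^ (r - 1)).
  rewrite (mulr_powRB1 (ltW eta0) r0) !powRM ?mulr_ge0 ?powR_ge0 ?(ltW eta0)//.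
  by rewrite -(powRrM B) mulVf ?gt_eqF// powRr1.
rewrite BE /B0 /b.
have -> : a = (eta * eta `^ (r - 1)) * g `^ (- (n.+1%:R * r)).
  rewrite (mulr_powRB1 (ltW eta0) r0) /a powRM ?invr_ge0 ?(ltW gn0) ?(ltW eta0)//; congr (_ * _).
  rewrite -powR_inv1 ?(ltW gn0)// -powR_mulrn ?(ltW g0)// -!powRrM.
  by congr (_ `^ _); ring.
have -> : (2 * (m_ * g)) ^+ N = (2 * m_) ^+ N * g `^ N%:R.
  by rewrite mulrA exprMn powR_mulrn ?(ltW g0).
rewrite (powRM _ (ltW m0) (ltW g0)) [g `^ (N%:R - _)]powRD; last by rewrite (gt_eqF g0) implybT.
ring.
Qed.

End finite_exponent.
End annulus_norm.

(** * The two regimes of the exponent *)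

Section annulus_rate.
Variables (R : realType) (n : nat).
Local Notation N := n.+3.
Local Notation mu := (@muN R N).
Variable u0 : N.-tuple R -> R.
Hypothesis mu0 : measurable_fun [set: N.-tuple R] u0.
Hypothesis u0_ge0 : forall x, 0 <= u0 x.
Hypothesis u0_fin : (\int[mu]_y (u0 y)%:E < +oo)%E.
Variables (p : \bar R) (g c : R -> R) (A : R -> set (N.-tuple R)).
Variables (f : R -> N.-tuple R -> R) (m_ C0 : R).
Hypothesis p1 : (1 <= p)%E.
Hypothesis crit : (p_crit R N <= p)%E -> class_D N%:R u0.
Hypothesis g0 : forall t, 0 < t -> 0 < g t.
Hypothesis goo : g t @[t --> +oo] --> +oo.
Hypothesis c0 : forall t, 0 < t -> 0 < c t.
Hypothesis mA : forall t, 0 < t -> measurable (A t).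
Hypothesis mf : forall t, 0 < t -> measurable_fun [set: N.-tuple R] (f t).
Hypothesis Ag : forall t x, 0 < t -> A t x -> tnorm x < m_ * g t.
Hypothesis m0 : 0 < m_.
Hypothesis C00 : 0 <= C0.
Hypothesis f_le : forall eta : R, 0 < eta -> exists2 gam, 0 < gam &
  \forall t \near +oo, forall x, A t x -> ((c t * `|f t x|)%:E <=
    (eta / g t ^+ n.+1)%:E + C0%:E * potential u0 (gam * g t) 1 x)%E.

(** At or above the critical exponent the potential is bounded uniformly, from the decay of the
    datum; below it, only in the mean. Constants are fixed in the order eta, gam, then (in the first
    regime) sig and tau, and t last. *)
Lemma annulus_rate_cvg0 :
  ((g t `^ (N%:R * (1 - invp p) - 2) * c t)%:E * LpN p (A t) (f t))%E @[t --> +oo] --> 0%E.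
Proof.
have ggt (a gam : R) : 0 < gam -> \forall t \near +oo, a < gam * g t.
  move=> gam0; near=> t; rewrite mulrC -ltr_pdivrMr//.
  by near: t; move/cvgryPgt : goo; apply.
apply: ereal_cvg0.
  near=> t; rewrite mule_ge0 ?LpN_ge0// lee_fin mulr_ge0 ?powR_ge0// ltW// c0//.
move=> e e0; have [pc|pc] := leP (p_crit R N) p.
  have [C1 [R0 [C10 [R00 hC]]]] := crit pc.
  have hC1 y : R0 < tnorm y -> tnorm y ^+ N * u0 y <= C1.
    by move=> /hC; rewrite powR_mulrn ?tnorm_ge0// ger0_norm.
  have n1N : n.+1%:R * 1 < N%:R :> R by rewrite mulr1 ltr_nat.
  have [Ck Ck0 hCk] := newton_ball_integral ltr01 n1N.
  have E2 : N%:R - n.+1%:R * 1 = 2%:R :> R.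
    have -> : N%:R = n.+1%:R + 2 :> R by rewrite -natrD addn2.
    by rewrite mulr1 addrAC subrr add0r.
  have [L L0 LE] : exists2 L, 0 <= L & L = (2 * m_) `^ (N%:R * invp p).
    by eexists; last reflexivity; exact: powR_ge0.
  have [eta eta0 heta] : exists2 eta, 0 < eta & L * ((1 + C0) * eta) <= e.
    have [D D0 DE] : exists2 D, 0 < D & D = (L + 1) * (1 + C0).
      by eexists; last reflexivity; apply: mulr_gt0; [rewrite ltr_pwDr|rewrite ltr_pwDl].
    exists (e / D); first by rewrite divr_gt0.
    rewrite (_ : L * _ = e * (L * (1 + C0) / D)); last by ring.
    rewrite ler_piMr ?(ltW e0)// ler_pdivrMr// mul1r DE ler_wpM2r ?addr_ge0//; lra.
  have [gam gam0 hgam] := f_le eta0.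
  have [b b0 bE] : exists2 b, 0 <= b & b = C1 / gam ^+ N * Ck.
    by eexists; last reflexivity; rewrite mulr_ge0// divr_ge0 ?exprn_ge0// ltW.
  (* A small sig controls the part of the potential near x. This inflates the outer part by
     [sig^(2-N)], which the choice of tau then compensates. *)
  have [sig sig0 hsig] : exists2 sig, 0 < sig & b * sig ^+ 2 <= eta / 2.
    have b1 : 0 < b + 1 by rewrite ltr_pwDr.
    exists (Num.sqrt (eta / 2 / (b + 1))); first by rewrite sqrtr_gt0 !divr_gt0.
    rewrite sqr_sqrtr; last by rewrite !divr_ge0// ltW.
    rewrite mulrCA ler_piMr ?divr_ge0 ?(ltW eta0)// ler_pdivrMr// mul1r; lra.
  have sn0 : 0 < sig ^+ n.+1 by rewrite exprn_gt0.
  have [tau tau0 htau] : exists2 tau, 0 < tau & tau / sig ^+ n.+1 = eta / 2.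
    by exists (eta / 2 * sig ^+ n.+1); rewrite ?mulfK ?gt_eqF// mulr_gt0// divr_gt0.
  have [rho0 rho00 hrho] := tail_small mu0 u0_ge0 u0_fin tau0.
  near=> t.
  have t0 : 0 < t by near: t; exact: nbhs_pinfty_gt.
  have gt0 := g0 t0; have ct0 := c0 t0.
  have gn0 : 0 < g t ^+ n.+1 by rewrite exprn_gt0.
  have htail : (tail u0 (gam * g t) <= tau%:E)%E.
    by apply: hrho; apply: ltW; near: t; exact: ggt.
  have hR0 : R0 < gam * g t by near: t; exact: ggt.
  have hf x : A t x -> ((c t * `|f t x|)%:E <=
      (eta / g t ^+ n.+1)%:E + C0%:E * potential u0 (gam * g t) 1 x)%E.
    by move: x; near: t.
  apply: (@le_trans _ _ (L * ((1 + C0) * eta))%:E); last by rewrite lee_fin.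
  rewrite LE; apply: LpN_sup_le => //.
  - by apply: mulr_ge0; rewrite ?addr_ge0// ltW.
  - exact: mA.
  - exact: mf.
  - by move=> x; exact: Ag.
  - move=> x Ax; rewrite -lee_fin; apply: (le_trans (hf x Ax)).
    have hp : (potential u0 (gam * g t) 1 x <= (eta / g t ^+ n.+1)%:E)%E.
      apply: (le_trans (potential_sup_le mu0 u0_ge0 hC1 (ltW C10) gt0 gam0 sig0 hR0 Ck0 (ltW tau0) _ htail)).
        by move=> rho rho1; have := hCk x rho rho1; rewrite E2 powR_mulrn// ltW.
      rewrite lee_fin ler_pM2r ?invr_gt0// htau -bE; lra.
    apply: (le_trans (leeD (lexx _) (lee_wpmul2l _ hp))); first by rewrite lee_fin.
    by rewrite -EFinM -EFinD lee_fin le_eqVlt; apply/orP; left; apply/eqP; ring.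
have [r rE] : exists r, p = r%:E.
  move: p1 pc; case: p => [r||//]; first by exists r.
  by move=> _; rewrite ltNge leey.
move: p1 pc; rewrite rE lee_fin => r1.
rewrite /p_crit/= lte_fin => rc.
(* Below [p_crit], that is [r < N/(N-2)], the r-th power of the Newtonian kernel is locally
   integrable. *)
have rN : n.+1%:R * r < N%:R.
  have E1 : N%:R - 2 = n.+1%:R :> R by rewrite -[N]addn2 natrD addrK.
  by move: rc; rewrite E1 ltr_pdivlMr ?ltr0n// mulrC.
have [L L0 hL] := LpN_potential_le mu0 u0_ge0 r1 rN C00 m0.
have [eta eta0 heta] : exists2 eta, 0 < eta & L * eta <= e.
  have p0 : 0 < L + 1 by rewrite ltr_pwDr.
  exists (e / (L + 1)); first by rewrite divr_gt0.
  rewrite mulrCA ler_piMr ?(ltW e0)// ler_pdivrMr// mul1r; lra.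
have [gam gam0 hgam] := f_le eta0.
have [rho0 rho00 hrho] := tail_small mu0 u0_ge0 u0_fin eta0.
near=> t.
have t0 : 0 < t by near: t; exact: nbhs_pinfty_gt.
apply: (@le_trans _ _ (L * eta)%:E); last by rewrite lee_fin.
apply: (hL _ _ _ gam) => //.
- exact: c0.
- exact: g0.
- exact: mA.
- exact: mf.
- by move=> x; exact: Ag.
- by apply: hrho; apply: ltW; near: t; exact: ggt.
- by near: t.
Unshelve. all: end_near. Qed.

End annulus_rate.

(** * Comparison of the profile with the Newtonian kernel *)

Section profile_newton.
Variables (R : realType) (n : nat).
Local Notation N := n.+3.
Local Notation mu := (@muN R N).
Local Notation zero := [tuple of nseq N (0 : R)].

Lemma E_N_newton (x : N.-tuple R) : E_N x = newton x.
Proof. by rewrite /E_N /newton/= !subSS subn0. Qed.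

Lemma newton0 : newton zero = 0 :> R.
Proof.
have -> : newton zero = (0 ^+ n.+1)^-1 :> R.
  congr ((_ ^+ _)^-1); apply/eqP; by rewrite tnorm_eq0.
by rewrite expr0n invr0.
Qed.

Lemma newton_tscale (c : R) (z : N.-tuple R) : 0 <= c ->
  newton (tscale c z) = (c ^+ n.+1)^-1 * newton z.
Proof. by move=> c0; rewrite /newton tnorm_tscale// exprMn invfM. Qed.

(** The exponents combine as [alpha - alpha N / 2 = -(N-2) alpha / 2]: multiplying by [t^alpha]
    gives the kernel the homogeneity of [newton]. *)
Lemma Zfun_rescaled (alpha t : R) (G : N.-tuple R -> R) z : 0 < t ->
  t `^ alpha * Zfun alpha G z t =
    ((t `^ (alpha / 2)) ^+ n.+1)^-1 * G (tscale (t `^ (alpha / 2))^-1 z).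
Proof.
move=> t0; rewrite /Zfun mulrA (powRN _ (alpha / 2)); congr (_ * _).
rewrite -powR_mulrn ?powR_ge0// -powRrM -powRN -powRD; last by rewrite (gt_eqF t0) implybT.
congr (_ `^ _); have -> : N%:R = n.+1%:R + 2 :> R by rewrite -natrD addn2.
by field.
Qed.

(* The value of the profile at the origin is unconstrained; setting it to [0] makes the
   bounds by [newton], which is [0] there, hold everywhere. *)
Definition punctured (F : N.-tuple R -> R) (x : N.-tuple R) : R := F x * \1_(~` [set zero]) x.

Lemma punctured_off F x : x != zero -> punctured F x = F x.
Proof.
move=> /eqP x0; rewrite /punctured indicE mem_set ?mulr1//.
Qed.

Lemma punctured0 F : punctured F zero = 0.
Proof. by rewrite /punctured indicE memNset ?mulr0//; exact. Qed.

Lemma measurable_punctured F : measurable_fun [set: N.-tuple R] F ->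
  measurable_fun [set: N.-tuple R] (punctured F).
Proof.
move=> mF; apply: measurable_funM => //; apply: measurable_indic.
by apply: measurableC; exact: measurable_set1_tuple.
Qed.

Lemma Zfun_punctured (alpha t : R) F x : 0 < t -> x != zero ->
  Zfun alpha (punctured F) x t = Zfun alpha F x t.
Proof.
move=> t0 x0; rewrite /Zfun punctured_off//.
by rewrite -tnorm_gt0 tnorm_tscale ?powR_ge0// mulr_gt0 ?powR_gt0// tnorm_gt0.
Qed.

Section bounds.
Variables (F : N.-tuple R -> R) (kappa : R).
Hypothesis F_gt0 : forall x, x != zero -> 0 < F x.
Hypothesis kappa0 : 0 < kappa.
Hypothesis F_kappa : forall e, 0 < e -> exists2 d, 0 < d & forall xi, 0 < tnorm xi < d ->
     `|F xi / E_N xi - kappa| < e.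

Lemma punctured_ge0 x : 0 <= punctured F x.
Proof.
have [->|x0] := eqVneq x zero; first by rewrite punctured0.
by rewrite punctured_off// ltW// F_gt0.
Qed.

Lemma punctured_near (e : R) : 0 < e -> exists2 d, 0 < d &
  forall z, tnorm z < d -> `|punctured F z - kappa * newton z| <= e * newton z.
Proof.
move=> /F_kappa[d d0 hd]; exists d => // z zd.
have [->|z0] := eqVneq z zero; first by rewrite punctured0 newton0 !mulr0 subr0 normr0.
have z1 : 0 < tnorm z by rewrite tnorm_gt0.
have nz : 0 < newton z by rewrite invr_gt0 exprn_gt0.
rewrite punctured_off//.
have := hd z; rewrite z1 zd E_N_newton => /(_ erefl) /ltW h.
rewrite -[X in _ <= _ * X](gtr0_norm nz).
have -> : F z - kappa * newton z = (F z / newton z - kappa) * newton z.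
  by rewrite mulrBl mulfVK// gt_eqF.
by rewrite normrM ler_wpM2r.
Qed.

(** Within d of the origin the limit kappa, with tolerance 1, gives the constant kappa + 1. Beyond
    d, two powers are given away: [|z|^(-N) <= d^(-2) |z|^(2-N)]. *)
Lemma punctured_le_newton (C : R) : 0 < C ->
  (forall x, 0 < tnorm x -> F x <= C / tnorm x ^+ N) ->
  exists2 C0, 0 < C0 & forall z, punctured F z <= C0 * newton z.
Proof.
move=> C0 hC; have [d d0 hd] := punctured_near ltr01.
exists (kappa + 1 + C / d ^+ 2).
  by rewrite !addr_gt0// divr_gt0// exprn_gt0.
move=> z; have nz := newton_ge0 z.
have Cd : 0 <= C / d ^+ 2 by rewrite divr_ge0 ?exprn_ge0// ltW.
have [zd|dz] := ltP (tnorm z) d.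
  have := hd z zd; rewrite mul1r ler_norml => /andP[_ h].
  have := mulr_ge0 Cd nz; rewrite !mulrDl mul1r; lra.
have z0 : 0 < tnorm z by apply: lt_le_trans dz.
rewrite punctured_off -?tnorm_gt0//; apply: (le_trans (hC z z0)).
apply: (@le_trans _ _ (C / d ^+ 2 * newton z)); last first.
  by rewrite ler_wpM2r// lerDr addr_ge0// ltW.
have -> : tnorm z ^+ N = tnorm z ^+ 2 * tnorm z ^+ n.+1 by rewrite -exprD.
rewrite invfM mulrA ler_wpM2r// ler_wpM2l ?(ltW C0)// lef_pV2 ?posrE ?exprn_gt0//.
by apply: lerXn2r; rewrite ?nnegrE// ltW.
Qed.

End bounds.
End profile_newton.

(** * The rescaled kernel and the mild solution *)

Section mild_solution.
Variables (R : realType) (n : nat).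
Local Notation N := n.+3.
Local Notation mu := (@muN R N).
Local Notation zero := [tuple of nseq N (0 : R)].
Variables (alpha : R) (F u0 : N.-tuple R -> R).
Hypothesis mF : measurable_fun [set: N.-tuple R] F.
Hypothesis F_gt0 : forall x, x != zero -> 0 < F x.
Hypothesis mu0 : measurable_fun [set: N.-tuple R] u0.
Hypothesis u0_ge0 : forall x, 0 <= u0 x.

Definition kernel (t : R) (z : N.-tuple R) : R :=
  t `^ alpha * Zfun alpha (punctured F) z t.

Lemma measurable_Zfun t (G : N.-tuple R -> R) : measurable_fun [set: N.-tuple R] G ->
  measurable_fun [set: N.-tuple R] (fun x => Zfun alpha G x t).
Proof.
move=> mG; apply: measurable_funM => //.
exact: (measurableT_comp mG (measurable_tscale _)).
Qed.

Lemma measurable_kernel t : measurable_fun [set: N.-tuple R] (kernel t).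
Proof.
by apply: measurable_funM => //; apply: measurable_Zfun; exact: measurable_punctured.
Qed.

Lemma kernel_ge0 t z : 0 <= kernel t z.
Proof.
exact: mulr_ge0 (powR_ge0 _ _) (mulr_ge0 (powR_ge0 _ _) (punctured_ge0 F_gt0 _)).
Qed.

Lemma rescaled_mild t x : 0 < t -> t `^ alpha * mild alpha F u0 x t =
  fine (\int[mu]_y (kernel t (tsub x y) * u0 y)%:E).
Proof.
move=> t0; have ta0 : 0 < t `^ alpha by rewrite powR_gt0.
have mi : measurable_fun [set: N.-tuple R]
    (fun y => (Zfun alpha (punctured F) (tsub x y) t * u0 y)%:E).
  apply/measurable_EFinP; apply: measurable_funM => //.
  exact: (measurableT_comp (measurable_Zfun t (measurable_punctured mF)) (measurable_tsubl x)).
have i0 y : (0 <= (Zfun alpha (punctured F) (tsub x y) t * u0 y)%:E)%E.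
  rewrite lee_fin; apply: mulr_ge0 => //.
  exact: mulr_ge0 (powR_ge0 _ _) (punctured_ge0 F_gt0 _).
rewrite /mild (intN_off1 (a := x) mi i0); last first.
  move=> y yx; rewrite Zfun_punctured//; apply: contra yx => /eqP h.
  apply/eqP; apply: eq_from_tnth => i.
  have := congr1 (fun v => tnth v i) h; rewrite tnth_mktuple tnth_nseq0 => /eqP.
  by rewrite subr_eq0 => /eqP.
have -> : (\int[mu]_y (kernel t (tsub x y) * u0 y)%:E =
   (t `^ alpha)%:E * \int[mu]_y (Zfun alpha (punctured F) (tsub x y) t * u0 y)%:E)%E.
  rewrite -ge0_integralZl//; last by rewrite lee_fin ltW.
  by apply: eq_integral => y _; rewrite -EFinM; congr EFin; rewrite /kernel -[LHS]mulrA.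
have : (0 <= \int[mu]_y (Zfun alpha (punctured F) (tsub x y) t * u0 y)%:E)%E.
  by apply: integral_ge0 => y _; exact: i0.
(* The identity also holds at points where the integral is infinite: a positive multiple is infinite
   as well, and [fine] sends both to 0. *)
case: (\int[_]_y _)%E => [r _//| _|//].
by rewrite gt0_muley ?lte_fin//= mulr0.
Qed.

Lemma measurable_mild t : 0 < t -> measurable_fun [set: N.-tuple R] (fun x => mild alpha F u0 x t).
Proof.
move=> t0; have ta0 : 0 < t `^ alpha by rewrite powR_gt0.
have -> : (fun x => mild alpha F u0 x t) = (fun x => (t `^ alpha)^-1 *
    fine (\int[mu]_y (kernel t (tsub x y) * u0 y)%:E)).
  by apply/funext => x; rewrite -rescaled_mild// mulKf// gt_eqF.
apply: measurable_funM => //.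
apply: (measurableT_comp (@fine_measurable R _ measurableT)) => //.
apply: (@measurable_fun_fubini_tonelli_F _ _ _ _ R mu
  (fun z => (kernel t (tsub z.1 z.2) * u0 z.2)%:E)); last first.
  by move=> z; rewrite lee_fin mulr_ge0// kernel_ge0.
apply/measurable_EFinP; apply: measurable_funM; last by apply: (measurableT_comp mu0).
exact: (measurableT_comp (measurable_kernel t) (@measurable_tsub2 R N)).
Qed.

Section kernel_bounds.
Variable kappa : R.
Hypothesis kappa0 : 0 < kappa.
Hypothesis F_kappa : forall e, 0 < e -> exists2 d, 0 < d & forall xi, 0 < tnorm xi < d ->
     `|F xi / E_N xi - kappa| < e.

(** Kernel and [newton] pick up the same factor under the parabolic scaling, so estimates on the
    profile carry over to every time with unchanged constants. *)
Lemma kernel_rescaled t z : 0 < t ->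
  kernel t z = ((t `^ (alpha / 2)) ^+ n.+1)^-1 * punctured F (tscale (t `^ (alpha / 2))^-1 z) /\
  newton z = ((t `^ (alpha / 2)) ^+ n.+1)^-1 * newton (tscale (t `^ (alpha / 2))^-1 z).
Proof.
move=> t0; split; first exact: Zfun_rescaled.
have s0 : 0 < t `^ (alpha / 2) by rewrite powR_gt0.
rewrite newton_tscale; last by rewrite invr_ge0 ltW.
by rewrite exprVn invrK mulKf// gt_eqF// exprn_gt0.
Qed.

Lemma kernel_near (e : R) : 0 < e -> exists2 d, 0 < d & forall t z, 0 < t ->
  tnorm z < d * t `^ (alpha / 2) -> `|kernel t z - kappa * newton z| <= e * newton z.
Proof.
move=> e0; have [d d0 hd] := punctured_near F_kappa e0.
exists d => // t z t0 hz.
have s0 : 0 < t `^ (alpha / 2) by rewrite powR_gt0.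
have c0 : 0 < ((t `^ (alpha / 2)) ^+ n.+1)^-1 by rewrite invr_gt0 exprn_gt0.
have hz' : tnorm (tscale (t `^ (alpha / 2))^-1 z) < d.
  by rewrite tnorm_tscale ?invr_ge0 ?(ltW s0)// mulrC ltr_pdivrMr.
have [-> ->] := kernel_rescaled z t0; move: (hd _ hz') c0.
move: (punctured F _) (newton _) (((t `^ (alpha / 2)) ^+ n.+1)^-1) => P W c h c0.
rewrite (_ : c * P - _ = c * (P - kappa * W)); last by ring.
by rewrite normrM gtr0_norm// mulrCA ler_pM2l.
Qed.

Lemma kernel_le (C0 : R) : (forall z, punctured F z <= C0 * newton z) ->
  forall t z, 0 < t -> kernel t z <= C0 * newton z.
Proof.
move=> hC t z t0; have [-> ->] := kernel_rescaled z t0.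
have c0 : 0 <= ((t `^ (alpha / 2)) ^+ n.+1)^-1 by rewrite invr_ge0 exprn_ge0// powR_ge0.
move: (hC (tscale (t `^ (alpha / 2))^-1 z)) c0.
move: (punctured F _) (newton _) (((t `^ (alpha / 2)) ^+ n.+1)^-1) => P W c h c0.
by rewrite mulrCA ler_wpM2l.
Qed.

End kernel_bounds.
End mild_solution.

Theorem theorem4p1 (R : realType) (N : nat) (alpha : R)
  (F : N.-tuple R -> R) (kappa : R) (p : \bar R) (u0 : N.-tuple R -> R)
  (g : R -> R) (nu mu : R) :
  (3 <= N)%N ->
  0 < alpha < 1 ->
  (* the profile F of the fundamental solution Z *)
  measurable_fun [set: N.-tuple R] F ->
  (forall x, x != [tuple of nseq N 0] -> 0 < F x) ->
  (forall x y, tnorm x = tnorm y -> F x = F y) ->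
  (forall x, x != [tuple of nseq N 0] -> forall e, 0 < e ->
     exists2 d, 0 < d & forall y, tnorm (tsub y x) < d -> `|F y - F x| < e) ->
  RintN F = 1 ->
  (* Fourier transform of Z(.,t) is E_alpha(-|w|^2 t^alpha) *)
  (forall t, 0 < t -> forall w : N.-tuple R,
     RintN (fun x => Zfun alpha F x t * cos (tdot w x)) =
       mittag_leffler alpha (- (tnorm w ^+ 2) * t `^ alpha) /\
     RintN (fun x => Zfun alpha F x t * sin (tdot w x)) = 0) ->
  (* kappa *)
  0 < kappa ->
  (forall e, 0 < e -> exists2 d, 0 < d & forall xi, 0 < tnorm xi < d ->
     `|F xi / E_N xi - kappa| < e) ->
  (* p and the initial datum *)
  (1 <= p)%E ->
  measurable_fun [set: N.-tuple R] u0 ->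
  (forall x, 0 <= u0 x) ->
  intN (fun x => (\1_[set y | u0 y != 0] x)%:E) <> 0%E ->
  (intN (fun x => `|u0 x|%:E) < +oo)%E ->
  ((p_crit R N <= p)%E -> class_D N%:R u0) ->
  (* the function g and the annulus radii *)
  (forall t, 0 < t -> 0 < g t) ->
  g t @[t --> +oo] --> +oo ->
  (g t / t `^ (alpha / 2)) @[t --> +oo] --> 0 ->
  0 < nu -> nu < mu ->
  let M := RintN u0 in
  let A := fun t => [set x : N.-tuple R | nu < tnorm x / g t < mu] in
  let e := N%:R * (1 - invp p) - 2 in
  (((g t `^ e)%R)%:E *
     LpN p (A t) (fun x => (t `^ alpha * mild alpha F u0 x t - M * kappa * E_N x)%R))%E
     @[t --> +oo] --> 0%E
  /\
  (((t `^ alpha * g t `^ e)%R)%:E *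
     LpN p (A t) (fun x => (mild alpha F u0 x t - M * Zfun alpha F x t)%R))%E
     @[t --> +oo] --> 0%E.
Proof.
case: N F u0 => [|[|[|n]]] F u0 // _ alpha01 mF F_gt0 _ F_cont F1 FT kappa0 F_kappa p1 mu0
  u0_ge0 _ u0_fin crit g0 goo gs nu0 numu M A e.
(* At t = 1 the fundamental solution is the profile itself. *)
have FT1 w : RintN (fun x => F x * cos (tdot w x)) = mittag_leffler alpha (- (tnorm w ^+ 2)) /\
    RintN (fun x => F x * sin (tdot w x)) = 0.
  have Z1 x : Zfun alpha F x 1 = F x.
    rewrite /Zfun !powR1 mul1r; congr F; apply: eq_from_tnth => i.
    by rewrite tnth_mktuple mul1r.
  have := FT 1 ltr01 w; rewrite powR1 mulr1.
  by under eq_fun do rewrite Z1; under [in X in _ /\ X -> _]eq_fun do rewrite Z1.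
have [C C_gt0 F_le] := profile_le alpha01 mF F_gt0 F_cont F1 FT1.
have [C0 C0_gt0 hC0] := punctured_le_newton kappa0 F_kappa C_gt0 F_le.
have u0E : intN (fun x => `|u0 x|%:E) = (\int[@muN R n.+3]_y (u0 y)%:E)%E.
  rewrite intN_integral//; last first.
    by apply/measurable_EFinP; exact: measurableT_comp.
  by apply: eq_integral => y _; rewrite ger0_norm.
rewrite u0E in u0_fin.
have ME : M = fine (\int[@muN R n.+3]_y (u0 y)%:E).
  rewrite /M -RintN_integral//; apply/integrableP; split; first exact/measurable_EFinP.
  by under eq_integral do rewrite /= ger0_norm//.
have K0 : 0 < 2 / nu by rewrite divr_gt0.
have nuK : nu / 2 = (2 / nu)^-1 by rewrite invf_div.
have mk t : 0 < t -> measurable_fun [set: n.+3.-tuple R] (kernel alpha F t).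
  by move=> _; exact: measurable_kernel.
have k0 t z : 0 < t -> 0 <= kernel alpha F t z by move=> _; exact: kernel_ge0.
have kC t z : 0 < t -> kernel alpha F t z <= C0 * newton z by exact: kernel_le.
have s0 t : 0 < t -> 0 < t `^ (alpha / 2) by exact: powR_gt0.
have knear (d : R) : 0 < d -> exists2 d', 0 < d' & forall t z, 0 < t ->
    tnorm z < d' * t `^ (alpha / 2) -> `|kernel alpha F t z - kappa * newton z| <= d * newton z.
  exact: kernel_near.
have main := pointwise_large_time mu0 u0_ge0 u0_fin nu0 numu kappa0 C0_gt0 K0 nuK
  mk k0 kC knear s0 g0 goo gs.
have mA t : 0 < t -> measurable (A t).
  move=> t0; have -> : A t = [set: _] `&` (@tnorm R n.+3) @^-1` [set` `]nu * g t, mu * g t[].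
    by rewrite setTI; apply/seteqP; split => x; rewrite /A/= in_itv/= ltr_pdivlMr ?ltr_pdivrMr ?g0.
  exact: measurable_tnorm.
have Ag t x : 0 < t -> A t x -> tnorm x < mu * g t.
  by move=> t0 /andP[_]; rewrite ltr_pdivrMr// g0.
have mu_gt0 : 0 < mu := lt_trans nu0 numu.
split.
  pose f t x := t `^ alpha * mild alpha F u0 x t - M * kappa * E_N x.
  have mf t : 0 < t -> measurable_fun [set: n.+3.-tuple R] (f t).
    move=> t0; apply: measurable_funB.
      by apply: measurable_funM => //; exact: measurable_mild.
    apply: measurable_funM => //; rewrite (_ : @E_N R n.+3 = @newton R n).
      exact: measurable_newton.
    by apply/funext => x; exact: E_N_newton.
  suff : ((g t `^ e * 1)%:E * LpN p (A t) (f t))%E @[t --> +oo] --> 0%E.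
    by under eq_cvg do rewrite mulr1.
  apply: (annulus_rate_cvg0 mu0 u0_ge0 u0_fin p1 crit g0 goo (c := fun=> 1) _
    mA mf Ag mu_gt0 (ltW C0_gt0)) => //.
  move=> eta eta0; have [gam gam0 h] := main eta eta0; exists gam => //.
  near=> t; move=> x Ax; have t0 : 0 < t by near: t; exact: nbhs_pinfty_gt.
  have := near h t; move=> /(_ _ x Ax)[]; first by [].
  by rewrite mul1r /f ME E_N_newton rescaled_mild.
pose f t x := mild alpha F u0 x t - M * Zfun alpha F x t.
have mf t : 0 < t -> measurable_fun [set: n.+3.-tuple R] (f t).
  move=> t0; apply: measurable_funB; first exact: measurable_mild.
  by apply: measurable_funM => //; exact: measurable_Zfun.
suff : ((g t `^ e * t `^ alpha)%:E * LpN p (A t) (f t))%E @[t --> +oo] --> 0%E.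
  by under eq_cvg do rewrite mulrC.
apply: (annulus_rate_cvg0 mu0 u0_ge0 u0_fin p1 crit g0 goo (c := fun t => t `^ alpha) _
  mA mf Ag mu_gt0 (ltW C0_gt0)) => [t|eta eta0]; first exact: powR_gt0.
have [gam gam0 h] := main eta eta0; exists gam => //.
near=> t; move=> x Ax; have t0 : 0 < t by near: t; exact: nbhs_pinfty_gt.
have := near h t; move=> /(_ _ x Ax)[]; first by [].
(* The annulus avoids the origin, so there the punctured kernel agrees with [Zfun alpha F]. *)
have x0 : x != [tuple of nseq n.+3 0].
  rewrite -tnorm_gt0; move: Ax => /andP[Ax _].
  by move: Ax; rewrite ltr_pdivlMr ?g0//; apply: lt_trans; rewrite mulr_gt0// g0.
have -> : t `^ alpha * `|f t x| = `|t `^ alpha * f t x|.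
  by rewrite normrM (ger0_norm (powR_ge0 _ _)).
move=> _; rewrite /f mulrBr ME rescaled_mild// (mulrCA _ (fine _)).
by rewrite -(Zfun_punctured _ _ t0 x0).
Unshelve. all: end_near. Qed.
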